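(* Let $n\ge1$, let $\mathcal{Q}\subseteq H^2(\mathbb{T}^n)$ be a quotient module, let $X\in\mathcal{B}_1(\mathcal{Q})$ be a module map, and let $\psi=X(P_{\mathcal{Q}}1)$. Let $\tilde{\mathcal{M}}_{\mathcal{Q},X}=(\mathcal{Q}^{conj}\ominus\{\bar\psi\})+\mathcal{M}_n+H^2_0(\mathbb{T}^n)$, regarded as a subspace of $L^1(\mathbb{T}^n)$. Then $X$ is liftable if and only if \[ \operatorname{dist}_{L^1(\mathbb{T}^n)}\Big(\frac{\bar\psi}{\|\psi\|_2^2},\ \tilde{\mathcal{M}}_{\mathcal{Q},X}\Big)\ge 1. \]
   Context: $\mathbb{D}$ is the open unit disc, $\mathbb{T}$ the unit circle, $\mu$ the normalized Lebesgue measure on $\mathbb{T}^n$. $H^2(\mathbb{T}^n)$ is the closed subspace of $L^2(\mathbb{T}^n)$ of functions whose Fourier coefficients vanish off $\mathbb{Z}_+^n$; $\|\cdot\|_p$ is the $L^p(\mathbb{T}^n,\mu)$ norm. $\mathcal{S}(\mathbb{D}^n)$ is the closed unit ball of $H^\infty(\mathbb{D}^n)$. $T_\varphi f=\varphi f$ on $H^2(\mathbb{T}^n)$. A closed subspace $\mathcal{Q}\subseteq H^2(\mathbb{T}^n)$ is a quotient module if $T_{z_i}^*\mathcal{Q}\subseteq\mathcal{Q}$ for all $i$; $P_{\mathcal{Q}}$ is the orthogonal projection onto $\mathcal{Q}$ and $S_\varphi=P_{\mathcal{Q}}T_\varphi|_{\mathcal{Q}}$. $\mathcal{B}_1(\mathcal{Q})$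 denotes the contractions on $\mathcal{Q}$; a module map is $X\in\mathcal{B}(\mathcal{Q})$ with $XS_{z_i}=S_{z_i}X$ for all $i$; a contractive module map is liftable if $X=S_\varphi$ for some $\varphi\in\mathcal{S}(\mathbb{D}^n)$. $S^{conj}=\{\bar f:f\in S\}$; $\mathcal{Q}^{conj}\ominus\{\bar\psi\}$ is the orthogonal complement of $\bar\psi$ in $\mathcal{Q}^{conj}$ (in $L^2$); $H^2_0(\mathbb{T}^n)=\{f\in H^2:f(0)=0\}$; $\mathcal{M}_n=L^2(\mathbb{T}^n)\ominus(H^2(\mathbb{T}^n)^{conj}+H^2(\mathbb{T}^n))$. $\operatorname{dist}_{L^1}(g,M)=\inf_{h\in M}\|g-h\|_1$.
   Formalization: The case ψ = 0 (which happens only for X = 0) is excluded by the added hypothesis ‖ψ‖₂ ≠ 0, since the quotient ψ̄/‖ψ‖₂² is undefined there. *)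

(* Defs.v *)
(* Model of T^n: a point of T^n is z = (e^{2 pi i theta_1}, ..., e^{2 pi i theta_n})
   with angles theta in [0,1]^n; the normalized Lebesgue measure mu on T^n is the
   pushforward of Lebesgue measure on [0,1]^n, and integration against mu is
   realized as the iterated Lebesgue integral over [0,1]^n (Tonelli).
   Complex numbers are R[i] (mathcomp real_closed complex) over R : realType.
   Elements of L^p(T^n) are represented by measurable functions
   n.-tuple R -> R[i] (of the angles); equality in L^2 is "l2eq" (||F-G||_2 = 0). *)
From HB Require Import structures.
From mathcomp Require Import all_boot all_order all_algebra.
From mathcomp Require Import all_classical all_reals all_analysis.
From mathcomp Require Import complex.
From Stdlib Require Import ClassicalEpsilon.
Set Implicit Arguments.
Unset Strict Implicit.
Unset Printing Implicit Defensive.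
Import Order.TTheory GRing.Theory Num.Theory.
Import numFieldNormedType.Exports.
Local Open Scope classical_set_scope.
Local Open Scope ring_scope.
Local Open Scope complex_scope.

Section Torus.
Variable R : realType.
Local Notation C := R[i].

(* functions on T^n, written in the angle variables *)
Definition fnT (n : nat) := n.-tuple R -> C.

(* integral of a nonnegative extended-real function against the normalized
   Lebesgue measure of T^n, as iterated integral over [0,1]^n *)
Fixpoint tint (n : nat) : (n.-tuple R -> \bar R) -> \bar R :=
  match n with
  | 0 => fun f => f [tuple]
  | m.+1 => fun f =>
      (\int[@lebesgue_measure R]_(t in `[0%R, 1%R])
          tint (fun x : m.-tuple R => f (cons_tuple t x)))%E
  end.

(* modulus of a complex number *)
Definition cabs (z : C) : R := Num.sqrt (complex.Re z ^+ 2 + complex.Im z ^+ 2).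

(* measurability of a complex-valued function on T^n *)
Definition cmeas n (F : fnT n) : Prop :=
  measurable_fun setT (fun x => complex.Re (F x)) /\
  measurable_fun setT (fun x => complex.Im (F x)).

(* ||F||_1 and ||F||_2^2 *)
Definition L1norm n (F : fnT n) : \bar R := tint (fun x => (cabs (F x))%:E).
Definition sqnorm n (F : fnT n) : \bar R := tint (fun x => (cabs (F x) ^+ 2)%:E).

(* L^2(T^n) *)
Definition L2 n : set (fnT n) := [set F | cmeas F /\ (sqnorm F < +oo)%E].

(* equality in L^2 (i.e. almost everywhere) *)
Definition l2eq n (F G : fnT n) : Prop := sqnorm (fun x => F x - G x) = 0%E.

(* Lebesgue integral of an integrable real / complex function on T^n *)
Definition rint n (g : n.-tuple R -> R) : R :=
  fine (tint (fun x => (Num.max (g x) 0)%:E)) -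
  fine (tint (fun x => (Num.max (- g x) 0)%:E)).
Definition cint n (F : fnT n) : C :=
  (rint (fun x => complex.Re (F x))) +i* (rint (fun x => complex.Im (F x))).

(* L^2 inner product <F, G> = \int F conj(G) dmu *)
Definition inner n (F G : fnT n) : C := cint (fun x => F x * (G x)^*).

Definition expi (t : R) : C := cos t +i* sin t.

(* the coordinate function z_j on T^n *)
Definition zcoord n (j : 'I_n) : fnT n := fun x => expi (2 * pi * tnth x j).

(* Fourier coefficient \hat F(k) = \int F(z) z^{-k} dmu(z), k in Z^n *)
Definition fourier n (F : fnT n) (k : n.-tuple int) : C :=
  cint (fun x => F x *
    expi (- (2 * pi * \sum_(j < n) (tnth k j)%:~R * tnth x j))).

(* k lies off Z_+^n *)
Definition offZplus n (k : n.-tuple int) : Prop := exists j : 'I_n, tnth k j < 0.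

(* H^2(T^n) *)
Definition H2 n : set (fnT n) :=
  [set F | L2 F /\ forall k, offZplus k -> fourier F k = 0].

(* H^2_0(T^n) = {f in H^2 : f(0) = 0}; f(0) is the value at the origin of the
   holomorphic extension of f, i.e. \hat f(0) *)
Definition H2_0 n : set (fnT n) :=
  [set F | H2 F /\ fourier F [tuple (0 : int) | _ < n] = 0].

(* pointwise conjugate, S^conj, sums of subspaces, relative orthocomplement *)
Definition cconj n (F : fnT n) : fnT n := fun x => (F x)^*.
Definition conjset n (S : set (fnT n)) : set (fnT n) :=
  [set G | exists2 F, S F & G = cconj F].
Definition ssum n (S1 S2 : set (fnT n)) : set (fnT n) :=
  [set F | exists2 A, S1 A & exists2 B, S2 B & F = (fun x => A x + B x)].
(* S \ominus A = {F in S | F orthogonal to every element of A} *)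
Definition orth_in n (S A : set (fnT n)) : set (fnT n) :=
  [set F | S F /\ forall G, A G -> inner F G = 0].

(* M_n = L^2 \ominus (H^2^conj + H^2) *)
Definition Mn n : set (fnT n) := orth_in (@L2 n) (ssum (conjset (@H2 n)) (@H2 n)).

(* choice of an element satisfying P *)
Definition pick_fn n (P : set (fnT n)) : fnT n :=
  epsilon (inhabits (fun _ => 0)) P.

(* closed linear subspace of L^2 *)
Definition lin_subspace n (S : set (fnT n)) : Prop :=
  S (fun _ => 0) /\
  (forall F G, S F -> S G -> S (fun x => F x + G x)) /\
  (forall (a : C) F, S F -> S (fun x => a * F x)).
Definition l2closed n (S : set (fnT n)) : Prop :=
  forall (u : nat -> fnT n) (F : fnT n), (forall k, S (u k)) -> L2 F ->
    (sqnorm (fun x => u k x - F x) @[k --> \oo] --> 0%E) -> S F.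

(* adjoint T_{z_j}^* f on H^2 *)
Definition Tzstar n (j : 'I_n) (f : fnT n) : fnT n :=
  pick_fn [set g | H2 g /\
    forall h, H2 h -> inner (fun x => zcoord j x * h x) f = inner h g].

(* quotient module *)
Definition quotient_module n (Q : set (fnT n)) : Prop :=
  Q `<=` @H2 n /\ lin_subspace Q /\ l2closed Q /\
  forall (j : 'I_n) f, Q f -> Q (Tzstar j f).

(* orthogonal projection P_Q *)
Definition projQ n (Q : set (fnT n)) (f : fnT n) : fnT n :=
  pick_fn [set g | Q g /\ forall h, Q h -> inner (fun x => f x - g x) h = 0].

(* S_phi = P_Q T_phi |_Q *)
Definition Sop n (Q : set (fnT n)) (phi : fnT n) (f : fnT n) : fnT n :=
  projQ Q (fun x => phi x * f x).

(* X in B_1(Q): bounded linear operator on Q of norm <= 1 *)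
Definition contraction_on n (Q : set (fnT n)) (X : fnT n -> fnT n) : Prop :=
  (forall f, Q f -> Q (X f)) /\
  (forall (a : C) f g, Q f -> Q g ->
     l2eq (X (fun x => a * f x + g x)) (fun x => a * X f x + X g x)) /\
  (forall f, Q f -> (sqnorm (X f) <= sqnorm f)%E).

(* module map: X S_{z_j} = S_{z_j} X on Q *)
Definition module_map n (Q : set (fnT n)) (X : fnT n -> fnT n) : Prop :=
  forall (j : 'I_n) f, Q f ->
    l2eq (X (Sop Q (zcoord j) f)) (Sop Q (zcoord j) (X f)).

(* S(D^n): closed unit ball of H^infty(D^n), via boundary values:
   measurable, |phi| <= 1 mu-a.e., Fourier coefficients vanish off Z_+^n *)
Definition Schur n : set (fnT n) :=
  [set phi | cmeas phi /\
    tint (fun x => ((1 < cabs (phi x))%R%:R)%:E) = 0%E /\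
    forall k, offZplus k -> fourier phi k = 0].

Definition liftable n (Q : set (fnT n)) (X : fnT n -> fnT n) : Prop :=
  exists2 phi, Schur phi & forall f, Q f -> l2eq (X f) (Sop Q phi f).

(* psi = X (P_Q 1) *)
Definition psiQX n (Q : set (fnT n)) (X : fnT n -> fnT n) : fnT n :=
  X (projQ Q (fun _ => 1)).

(* \tilde M_{Q,X} = (Q^conj \ominus {conj psi}) + M_n + H^2_0 *)
Definition Mtilde n (Q : set (fnT n)) (X : fnT n -> fnT n) : set (fnT n) :=
  ssum (ssum (orth_in (conjset Q) [set cconj (psiQX Q X)]) (@Mn n)) (@H2_0 n).

(* L^1 distance from g to a set S *)
Definition distL1 n (g : fnT n) (S : set (fnT n)) : \bar R :=
  ereal_inf [set L1norm (fun x => g x - h x) | h in S].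

(* conj(psi) / ||psi||_2^2 *)
Definition normalized_conj n (psi : fnT n) : fnT n :=
  fun x => (psi x)^* / (fine (sqnorm psi))%:C.

End Torus.

(* Main.v *)
(* The map X is S_phi exactly when P_Q phi = psi: the vectors P_Q z^k are total in
   Q, and X and S_phi both intertwine the compressed shifts on them.

   If such a phi exists in the unit ball of H^infty, then integration against phi
   sends conj(psi)/||psi||^2 to 1 and annihilates Mtilde, and it is contractive for
   the L^1 norm, so the distance is at least 1.  That phi leaves the orthocomplement
   of Q in H^2 invariant is seen on its Fejer means, which are analytic polynomials
   bounded by 1 and converge to phi against products of two L^2 functions.

   Conversely, if the distance is at least 1, the Hahn-Banach theorem on L^2 with the
   L^1 norm as dominating seminorm, followed by the Riesz representation theorem,
   yields phi with |phi| <= 1 that annihilates Mtilde and sends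
   conj(psi)/||psi||^2 to 1.  Annihilating M_n and H^2_0 kills every Fourier
   coefficient of phi off Z_+^n, and the remaining conditions say P_Q phi = psi. *)
Require Import Defs.
From HB Require Import structures.
From mathcomp Require Import all_boot all_order all_algebra.
From mathcomp Require Import all_classical all_reals all_analysis.
From mathcomp Require Import measurable_realfun.
From mathcomp Require Import complex ring lra zify.
From Stdlib Require ClassicalEpsilon.
Import Order.TTheory GRing.Theory Num.Theory.
Import numFieldNormedType.Exports.
Local Open Scope classical_set_scope.
Local Open Scope ring_scope.
Set Implicit Arguments.
Unset Strict Implicit.
Unset Printing Implicit Defensive.
(* [^*] keeps its [ring_scope] meaning [Num.conj], convertible to [conjc]. *)
Local Notation "x %:C" := (real_complex _ x) : ring_scope.
Local Notation "x +i* y" := (Complex x y) : ring_scope.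

(** * Lebesgue measure on the torus *)

(** The duality step stays in [L^2] on purpose. A functional dominated by the [L^1] norm is bounded
    on [L^2] because the measure has mass 1, so its symbol comes from an orthogonal projection and
    the dual of [L^1] is never described; the bound 1 on the symbol is recovered afterwards by
    testing it where its modulus exceeds 1. For bounded [phi] and [f], [g] in [L^2], the product of
    [f] with the conjugate of [g] is only integrable, so [L^2] approximation of [phi] by Fourier
    partial sums does not control the pairing. Uniformly bounded approximants are required, hence
    kernels that are positive and of integral 1. The same kernels in one variable give completeness
    of the characters on [T^n], since indicators of boxes are products of indicators depending on
    one coordinate. Elements of [L^2] are functions and not classes, and operators are linear only
    up to null sets, so compatibility of [X] with equality almost everywhere has to be derived from
    contractivity. *)

Section TorusMeasure.
Variable R : realType.

(* [lebesgue_measure] lives on [measurableTypeR R], whose sigma-algebra agrees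
   with the one of [R] although the displays differ. *)
Lemma measurable_cons_tuple (n : nat) :
  measurable_fun [set: measurableTypeR R * n.-tuple R]
    (fun p => cons_tuple (p.1 : R) p.2 : n.+1.-tuple R).
Proof.
apply: measurable_cons; last exact: measurable_snd.
by move=> _ Y mY; exact: (@measurable_fst _ _ (measurableTypeR R)).
Qed.

(** The measure in dimension [n + 1] is the image under [cons_tuple] of the uniform law times the
    measure in dimension [n]; Tonelli unfolds it into the iterated integral. This gives access to
    the convergence theorems for genuine measures. *)
Lemma torus_measure_subproof (n : nat) :
  exists P : probability (n.-tuple R) R,
    forall f : n.-tuple R -> \bar R, measurable_fun setT f ->
      (forall x, 0 <= f x)%E -> (\int[P]_x f x = tint f)%E.
Proof.
elim: n => [|n [P HP]].
  exists (\d_ ([tuple] : 0.-tuple R)) => f mf f0 /=.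
  rewrite integral_dirac//= diracE in_setT mul1e//.
pose c (p : measurableTypeR R * n.-tuple R) : n.+1.-tuple R := cons_tuple p.1 p.2.
have mc : measurable_fun setT c := @measurable_cons_tuple n.
pose mcm := isMeasurableFun.Build _ _ _ _ c mc.
pose cm : {mfun (measurableTypeR R * n.-tuple R)%type >-> n.+1.-tuple R} := HB.pack c mcm.
pose U := uniform_prob (ltr01 : (0 < 1 :> R)).
exists (distribution (U \x P)%E cm) => f mf f0.
have mfc : measurable_fun setT (f \o c) by exact: measurableT_comp.
rewrite ge0_integral_distribution// fubini_tonelli1//=.
rewrite integral_uniform//=; last 2 first.
- exact: (@measurable_fun_fubini_tonelli_F _ _ (measurableTypeR R) (n.-tuple R) R P _
  mfc (fun x => f0 (c x))).
- by move=> x; apply: integral_ge0 => y _; exact: f0.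
rewrite subr0 invr1 mul1e; apply: eq_integral => t _.
rewrite /fubini_F/= HP//.
exact: (measurableT_comp mfc (measurable_pair1 t)).
Qed.

Definition torus_measure (n : nat) : probability (n.-tuple R) R :=
  projT1 (cid (torus_measure_subproof n)).

Lemma tintE (n : nat) (f : n.-tuple R -> \bar R) :
  measurable_fun setT f -> (forall x, 0 <= f x)%E ->
  tint f = (\int[torus_measure n]_x f x)%E.
Proof.
by move=> mf f0; rewrite /torus_measure; case: cid => /= P HP; rewrite HP.
Qed.

Lemma tint_cst (n : nat) (c : \bar R) : tint (fun _ : n.-tuple R => c) = c.
Proof.
elim: n => //= n IH; under eq_integral do rewrite IH.
by rewrite integral_cst//= lebesgue_measure_itv/= lte_fin ltr01 oppr0 adde0 mule1.
Qed.

Lemma ord_S_case (n : nat) (j : 'I_n.+1) :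
  j = ord0 \/ exists k : 'I_n, j = lift ord0 k.
Proof. by case: (unliftP ord0 j) => [k|] ->; [right; exists k|left]. Qed.

Lemma tint_tnth (n : nat) (j : 'I_n) (g : R -> \bar R) :
  tint (fun x => g (tnth x j)) = (\int[@lebesgue_measure R]_(t in `[0%R, 1%R]) g t)%E.
Proof.
elim: n j => [[]//|n IH] j /=; have [->|[k ->]] := ord_S_case j.
  by apply: eq_integral => t _; rewrite (_ : (fun _ => _) = fun=> g t) ?tint_cst.
under eq_integral.
  move=> t _; rewrite (_ : (fun _ => _) = fun x : n.-tuple R => g (tnth x k)).
    rewrite IH; over.
  by apply/funext => x; rewrite tnthS.
by rewrite integral_cst//= lebesgue_measure_itv/= lte_fin ltr01 oppr0 adde0 mule1.
Qed.

End TorusMeasure.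

(** * Complex integrals *)

Section ComplexModulus.
Variable R : realType.
Implicit Types z w : R[i].

Lemma ReD z w : complex.Re (z + w) = complex.Re z + complex.Re w.
Proof. by case: z; case: w. Qed.
Lemma ImD z w : complex.Im (z + w) = complex.Im z + complex.Im w.
Proof. by case: z; case: w. Qed.
Lemma ReM z w :
  complex.Re (z * w) = complex.Re z * complex.Re w - complex.Im z * complex.Im w.
Proof. by case: z; case: w. Qed.
Lemma ImM z w :
  complex.Im (z * w) = complex.Re z * complex.Im w + complex.Im z * complex.Re w.
Proof. by case: z => a b; case: w => c d /=. Qed.
Lemma ReN z : complex.Re (- z) = - complex.Re z. Proof. by case: z. Qed.
Lemma ImN z : complex.Im (- z) = - complex.Im z. Proof. by case: z. Qed.
Lemma Re_conj z : complex.Re z^* = complex.Re z. Proof. by case: z. Qed.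
Lemma Im_conj z : complex.Im z^* = - complex.Im z. Proof. by case: z. Qed.

Lemma conjcD z w : (z + w)^* = z^* + w^*. Proof. exact: rmorphD. Qed.
Lemma conjcB z w : (z - w)^* = z^* - w^*. Proof. exact: rmorphB. Qed.
Lemma conjcM z w : (z * w)^* = z^* * w^*. Proof. exact: rmorphM. Qed.

Lemma conjc_realE (a : R) : (a%:C)^* = a%:C. Proof. exact: conjc_real. Qed.

Lemma complex_ext z w :
  complex.Re z = complex.Re w -> complex.Im z = complex.Im w -> z = w.
Proof. by case: z => a b; case: w => c d /= -> ->. Qed.

Lemma cabsE z : cabs z = Normc.normc z. Proof. by case: z. Qed.
Lemma cabs_ge0 z : 0 <= cabs z. Proof. exact: sqrtr_ge0. Qed.
Lemma cabsM z w : cabs (z * w) = cabs z * cabs w.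
Proof. by rewrite !cabsE Normc.normcM. Qed.
Lemma cabsD z w : cabs (z + w) <= cabs z + cabs w.
Proof. by rewrite !cabsE le_normcD. Qed.
Lemma cabsN z : cabs (- z) = cabs z. Proof. by rewrite !cabsE normcN. Qed.
Lemma cabsB z w : cabs (z - w) <= cabs z + cabs w.
Proof. by rewrite -(cabsN w) cabsD. Qed.
Lemma cabs_conj z : cabs z^* = cabs z.
Proof. by rewrite /cabs Re_conj Im_conj sqrrN. Qed.
Lemma cabs_real (a : R) : cabs a%:C = `|a|.
Proof. by rewrite /cabs/= [X in _ + X]expr0n/= addr0 sqrtr_sqr. Qed.
Lemma cabs0 : cabs (0 : R[i]) = 0.
Proof. by rewrite (cabs_real 0) normr0. Qed.
Lemma cabs1 : cabs (1 : R[i]) = 1.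
Proof. by rewrite (cabs_real 1) normr1. Qed.
Lemma cabs_eq0 z : (cabs z = 0) -> z = 0.
Proof. by rewrite cabsE => /Normc.eq0_normc. Qed.
Lemma cabs_sq z : cabs z ^+ 2 = complex.Re z ^+ 2 + complex.Im z ^+ 2.
Proof. by rewrite sqr_sqrtr// addr_ge0// sqr_ge0. Qed.
Lemma mul_conj z : z * z^* = (cabs z ^+ 2)%:C.
Proof.
by rewrite cabs_sq; apply: complex_ext; rewrite ?ReM ?ImM Re_conj Im_conj/=; ring.
Qed.
Lemma normr_Re_le z : `|complex.Re z| <= cabs z.
Proof. by rewrite -sqrtr_sqr ler_wsqrtr// lerDl sqr_ge0. Qed.
Lemma normr_Im_le z : `|complex.Im z| <= cabs z.
Proof. by rewrite -sqrtr_sqr ler_wsqrtr// lerDr sqr_ge0. Qed.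
Lemma Re_le_cabs z : complex.Re z <= cabs z.
Proof. exact: le_trans (ler_norm _) (normr_Re_le z). Qed.

Lemma exists_phase z : exists2 u : R[i], cabs u = 1 & u * z = (cabs z)%:C.
Proof.
have [->|z0] := eqVneq z 0.
  by exists 1; rewrite ?cabs1// cabs0 mul1r.
have c0 : cabs z != 0 by apply: contra z0 => /eqP/cabs_eq0 ->.
exists ((cabs z)^-1%:C * z^*).
  by rewrite cabsM cabs_conj cabs_real ger0_norm ?invr_ge0 ?cabs_ge0// mulVf.
rewrite -mulrA (mulrC _ z) mul_conj -rmorphM/= expr2 mulrA mulVf// mul1r//.
Qed.

Lemma cabs_expi (t : R) : cabs (expi t) = 1.
Proof. by rewrite /cabs/= cos2Dsin2 sqrtr1. Qed.
Lemma expiD (s t : R) : expi (s + t) = expi s * expi t.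
Proof.
by apply: complex_ext; rewrite ?ReM ?ImM/= ?cosD ?sinD//; ring.
Qed.
Lemma expi_conj (t : R) : (expi t)^* = expi (- t).
Proof. by apply: complex_ext; rewrite ?Re_conj ?Im_conj /= ?cosN ?sinN. Qed.
Lemma expi0 : expi (0 : R) = 1.
Proof. by apply: complex_ext => /=; rewrite ?cos0 ?sin0. Qed.

End ComplexModulus.

(** * Integrable complex functions and their integral *)

Section ComplexIntegral.
Variables (R : realType) (n : nat).
Implicit Types F G H : fnT R n.
Local Notation mu := (torus_measure R n).

Lemma cmeas_cst (c : R[i]) : cmeas (fun _ : n.-tuple R => c).
Proof. by split; exact: measurable_cst. Qed.
Lemma cmeasD F G : cmeas F -> cmeas G -> cmeas (fun x => F x + G x).
Proof.
move=> [rF iF] [rG iG]; split.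
  by under eq_fun do rewrite ReD; exact: measurable_funD.
by under eq_fun do rewrite ImD; exact: measurable_funD.
Qed.
Lemma cmeasM F G : cmeas F -> cmeas G -> cmeas (fun x => F x * G x).
Proof.
move=> [rF iF] [rG iG]; split.
  under eq_fun do rewrite ReM.
  by apply: measurable_funB; exact: measurable_funM.
under eq_fun do rewrite ImM.
by apply: measurable_funD; exact: measurable_funM.
Qed.
Lemma cmeasZ (c : R[i]) F : cmeas F -> cmeas (fun x => c * F x).
Proof. by apply: cmeasM; exact: cmeas_cst. Qed.
Lemma cmeasN F : cmeas F -> cmeas (fun x => - F x).
Proof.
by move=> /(cmeasZ (-1)); under [X in cmeas X -> _]eq_fun do rewrite mulN1r.
Qed.
Lemma cmeasB F G : cmeas F -> cmeas G -> cmeas (fun x => F x - G x).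
Proof. by move=> mF /cmeasN; exact: cmeasD. Qed.
Lemma cmeas_conj F : cmeas F -> cmeas (fun x => (F x)^*).
Proof.
move=> [rF iF]; split; first by under eq_fun do rewrite Re_conj.
by under eq_fun do rewrite Im_conj; exact: measurable_funN iF.
Qed.
Lemma measurable_cabs F : cmeas F -> measurable_fun setT (fun x => cabs (F x)).
Proof.
move=> [rF iF].
apply: (measurableT_comp (continuous_measurable_fun (@sqrt_continuous R))).
by apply: measurable_funD; exact: measurable_funX.
Qed.
Lemma cmeas_cabs F : cmeas F -> cmeas (fun x => (cabs (F x))%:C).
Proof. by move=> mF; split => /=; [exact: measurable_cabs|exact: measurable_cst]. Qed.

Lemma L1normE F : cmeas F -> L1norm F = (\int[mu]_x (cabs (F x))%:E)%E.
Proof.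
move=> mF; rewrite /L1norm tintE//.
  by apply/measurable_EFinP; exact: measurable_cabs.
by move=> x; rewrite lee_fin cabs_ge0.
Qed.
Lemma sqnormE F : cmeas F -> sqnorm F = (\int[mu]_x (cabs (F x) ^+ 2)%:E)%E.
Proof.
move=> mF; rewrite /sqnorm tintE//.
  by apply/measurable_EFinP/measurable_funX; exact: measurable_cabs.
by move=> x; rewrite lee_fin sqr_ge0.
Qed.
Lemma L1norm_ge0 F : cmeas F -> (0 <= L1norm F)%E.
Proof. by move=> mF; rewrite L1normE//; apply: integral_ge0 => x _;
  rewrite lee_fin cabs_ge0. Qed.
Lemma sqnorm_ge0 F : cmeas F -> (0 <= sqnorm F)%E.
Proof. by move=> mF; rewrite sqnormE//; apply: integral_ge0 => x _;
  rewrite lee_fin sqr_ge0. Qed.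

Definition Lone : set (fnT R n) := [set F | cmeas F /\ (L1norm F < +oo)%E].

Lemma Lone_integrable_cabs F : Lone F -> mu.-integrable setT (fun x => (cabs (F x))%:E).
Proof.
move=> [mF]; rewrite L1normE// => foo; apply/integrableP; split.
  by apply/measurable_EFinP; exact: measurable_cabs.
by under eq_integral do rewrite gee0_abs ?lee_fin ?cabs_ge0//.
Qed.

Lemma integrable_cabs_Lone F : cmeas F ->
  mu.-integrable setT (fun x => (cabs (F x))%:E) -> Lone F.
Proof.
move=> mF /integrableP[_]; split => //; rewrite L1normE//.
by under eq_integral do rewrite -[(cabs _)%:E]gee0_abs ?lee_fin ?cabs_ge0//.
Qed.

Lemma Lone_le F G : cmeas F -> Lone G ->
  (forall x, cabs (F x) <= cabs (G x)) -> Lone F.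
Proof.
move=> mF lG FG; apply: integrable_cabs_Lone => //.
apply: le_integrable (Lone_integrable_cabs lG) => //.
  by apply/measurable_EFinP; exact: measurable_cabs.
by move=> x _; rewrite !gee0_abs ?lee_fin ?cabs_ge0.
Qed.

Lemma Lone_Re F : Lone F -> mu.-integrable setT (fun x => (complex.Re (F x))%:E).
Proof.
move=> lF; apply: le_integrable (Lone_integrable_cabs lF) => //.
  by apply/measurable_EFinP; case: lF => -[].
by move=> x _; rewrite [leRHS]gee0_abs ?lee_fin ?cabs_ge0// normr_Re_le.
Qed.
Lemma Lone_Im F : Lone F -> mu.-integrable setT (fun x => (complex.Im (F x))%:E).
Proof.
move=> lF; apply: le_integrable (Lone_integrable_cabs lF) => //.
  by apply/measurable_EFinP; case: lF => -[].
by move=> x _; rewrite [leRHS]gee0_abs ?lee_fin ?cabs_ge0// normr_Im_le.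
Qed.

Lemma rintE (g : n.-tuple R -> R) : mu.-integrable setT (fun x => (g x)%:E) ->
  rint g = (\int[mu]_x g x).
Proof.
move=> ig; have mg : measurable_fun setT g.
  by apply/measurable_EFinP; exact: measurable_int ig.
rewrite /rint /Rintegral integralE [RHS]fineB; last 2 first.
- exact: (integrable_pos_fin_num measurableT ig).
- exact: (integrable_neg_fin_num measurableT ig).
rewrite !tintE//; last 4 first.
- apply/measurable_EFinP; apply: measurable_maxr => //; exact: measurableT_comp.
- by move=> x; rewrite lee_fin le_max lexx orbT.
- by apply/measurable_EFinP; exact: measurable_maxr.
- by move=> x; rewrite lee_fin le_max lexx orbT.

by congr (fine _ - fine _); apply: eq_integral => x _; rewrite ?funeposE ?funenegE EFin_max.
Qed.

Lemma cintE F : Lone F ->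
  cint F = (\int[mu]_x complex.Re (F x)) +i* (\int[mu]_x complex.Im (F x)).
Proof. by move=> lF; rewrite /cint (rintE (Lone_Re lF)) (rintE (Lone_Im lF)). Qed.

Lemma LoneD F G : Lone F -> Lone G -> Lone (fun x => F x + G x).
Proof.
move=> lF lG; have [mF _] := lF; have [mG _] := lG.
have H : Lone (fun x => (cabs (F x) + cabs (G x))%:C).
  apply: integrable_cabs_Lone.
    by split => /=; [apply: measurable_funD; exact: measurable_cabs|exact: measurable_cst].
  under eq_fun do rewrite cabs_real ger0_norm ?addr_ge0 ?cabs_ge0// EFinD.
  by apply: integrableD => //; exact: Lone_integrable_cabs.
apply: Lone_le H _; first exact: cmeasD.
by move=> x; rewrite cabs_real ger0_norm ?addr_ge0 ?cabs_ge0// cabsD.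
Qed.

Lemma L1normZ (c : R[i]) F : cmeas F ->
  L1norm (fun x => c * F x) = ((cabs c)%:E * L1norm F)%E.
Proof.
move=> mF; rewrite !L1normE//; last exact: cmeasZ.
under eq_integral do rewrite cabsM EFinM.
rewrite ge0_integralZl//; last by rewrite lee_fin cabs_ge0.
  by apply/measurable_EFinP; exact: measurable_cabs.
by move=> x _; rewrite lee_fin cabs_ge0.
Qed.

Lemma LoneZ (c : R[i]) F : Lone F -> Lone (fun x => c * F x).
Proof.
move=> [mF lF]; split; first exact: cmeasZ.
by rewrite L1normZ// lte_mul_pinfty// lee_fin cabs_ge0.
Qed.
Lemma LoneN F : Lone F -> Lone (fun x => - F x).
Proof.
by move=> /(LoneZ (-1)); under [X in Lone X -> _]eq_fun do rewrite mulN1r.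
Qed.
Lemma LoneB F G : Lone F -> Lone G -> Lone (fun x => F x - G x).
Proof. by move=> mF /LoneN; exact: LoneD. Qed.

Lemma L1norm_fin F : Lone F -> (fine (L1norm F))%:E = L1norm F.
Proof. by move=> [mF lF]; rewrite fineK// ge0_fin_numE// L1norm_ge0. Qed.

Lemma Lone_bounded (c : R) F : cmeas F -> (forall x, cabs (F x) <= c) -> Lone F.
Proof.
move=> mF Fc; apply: (@Lone_le _ (fun=> c%:C)) => //.
  split; first exact: cmeas_cst.
  by rewrite /L1norm tint_cst ltry.
by move=> x; rewrite cabs_real (le_trans (Fc x))// ler_norm.
Qed.

Lemma cintD F G : Lone F -> Lone G ->
  cint (fun x => F x + G x) = cint F + cint G.
Proof.
move=> lF lG; rewrite !cintE//; last exact: LoneD.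
apply: complex_ext => /=.
  by under eq_Rintegral do rewrite ReD; rewrite RintegralD//; exact: Lone_Re.
by under eq_Rintegral do rewrite ImD; rewrite RintegralD//; exact: Lone_Im.
Qed.

Lemma cintZ (c : R[i]) F : Lone F -> cint (fun x => c * F x) = c * cint F.
Proof.
move=> lF; rewrite !cintE//; last exact: LoneZ.
have iR a : mu.-integrable setT (EFin \o (fun x => a * complex.Re (F x))).
  exact: (integrableZl measurableT a (Lone_Re lF)).
have iI a : mu.-integrable setT (EFin \o (fun x => a * complex.Im (F x))).
  exact: (integrableZl measurableT a (Lone_Im lF)).
apply: complex_ext; rewrite ?ReM ?ImM /=.
  under eq_Rintegral do rewrite ReM.
  rewrite RintegralB// !RintegralZl//; [exact: Lone_Im|exact: Lone_Re].
under eq_Rintegral do rewrite ImM.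
rewrite RintegralD// !RintegralZl//; [exact: Lone_Re|exact: Lone_Im].
Qed.

Lemma cintN F : Lone F -> cint (fun x => - F x) = - cint F.
Proof.
by move=> lF; rewrite -mulN1r -cintZ//; congr cint; apply/funext => x; rewrite mulN1r.
Qed.
Lemma cintB F G : Lone F -> Lone G ->
  cint (fun x => F x - G x) = cint F - cint G.
Proof. by move=> lF lG; rewrite cintD ?cintN//; exact: LoneN. Qed.

Lemma cint0 : cint (fun _ : n.-tuple R => 0) = 0.
Proof.
have l0 : Lone (fun=> 0) by apply: (@Lone_bounded 0); [exact: cmeas_cst|move=> x;
  rewrite cabs0].
rewrite -[RHS](mul0r (cint (fun _ : n.-tuple R => 0))) -cintZ//.
by congr cint; apply/funext => x; rewrite mul0r.
Qed.

Lemma Lone_sum (I : Type) (s : seq I) (P : pred I) (c : I -> fnT R n) :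
  (forall i, P i -> Lone (c i)) -> Lone (fun x => \sum_(i <- s | P i) c i x).
Proof.
move=> lc; elim: s => [|i s IH].
  under eq_fun do rewrite big_nil.
  by apply: (@Lone_bounded 0); [exact: cmeas_cst|move=> x; rewrite cabs0].
under eq_fun do rewrite big_cons.
by case Pi: (P i) => //; apply: LoneD => //; exact: lc.
Qed.

Lemma cint_sum (I : Type) (s : seq I) (P : pred I) (c : I -> fnT R n) :
  (forall i, P i -> Lone (c i)) ->
  cint (fun x => \sum_(i <- s | P i) c i x) = \sum_(i <- s | P i) cint (c i).
Proof.
move=> lc; elim: s => [|i s IH].
  by rewrite big_nil -[RHS]cint0; congr cint; apply/funext => x; rewrite big_nil.
rewrite big_cons (_ : (fun _ => _) = fun x => if P i then
   c i x + \sum_(i <- s | P i) c i x else \sum_(i <- s | P i) c i x); last first.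
  by apply/funext => x; rewrite big_cons.
case Pi: (P i) => //; rewrite cintD ?IH//; [exact: lc|exact: Lone_sum].
Qed.

Lemma cint_conj F : Lone F -> cint (fun x => (F x)^*) = (cint F)^*.
Proof.
move=> lF; have [mF _] := lF; have lc : Lone (fun x => (F x)^*).
  apply: Lone_le lF _; first exact: cmeas_conj.
  by move=> x; rewrite cabs_conj.
rewrite !cintE//; apply: complex_ext; rewrite ?Re_conj ?Im_conj/=.
  by apply: eq_Rintegral => x _; rewrite Re_conj.
under eq_Rintegral do rewrite Im_conj -mulN1r.
by rewrite RintegralZl ?mulN1r//; exact: Lone_Im.
Qed.

(** A unimodular factor makes the integral a nonnegative real; it is then the integral of a real
    part, which the modulus dominates. *)
Lemma cabs_cint_le F : Lone F -> ((cabs (cint F))%:E <= L1norm F)%E.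
Proof.
move=> lF; have [u u1 uF] := exists_phase (cint F).
have lu : Lone (fun x => u * F x) by exact: LoneZ.
have -> : cabs (cint F) = complex.Re (cint (fun x => u * F x)).
  by rewrite cintZ// uF.
rewrite cintE//= L1normE; last by case: lF.
rewrite /Rintegral fineK; last exact: integrable_fin_num (Lone_Re lu).
apply: le_integral => //; [exact: Lone_Re|exact: Lone_integrable_cabs|].
by move=> x _; rewrite lee_fin (le_trans (Re_le_cabs _))// cabsM u1 mul1r.
Qed.

Lemma L1norm_le F G : cmeas F -> cmeas G -> (forall x, cabs (F x) <= cabs (G x)) ->
  (L1norm F <= L1norm G)%E.
Proof.
move=> mF mG FG; rewrite !L1normE//; apply: ge0_le_integral => //.
- by move=> x _; rewrite lee_fin cabs_ge0.
- by apply/measurable_EFinP; exact: measurable_cabs.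
- by apply/measurable_EFinP; exact: measurable_cabs.
- by move=> x _; rewrite lee_fin.
Qed.

Lemma L1normD F G : cmeas F -> cmeas G ->
  (L1norm (fun x => (F x + G x)%R) <= L1norm F + L1norm G)%E.
Proof.
move=> mF mG; rewrite !L1normE//; last exact: cmeasD.
rewrite -ge0_integralD//; last 4 first.
- by move=> x _; rewrite lee_fin cabs_ge0.
- by apply/measurable_EFinP; exact: measurable_cabs.
- by move=> x _; rewrite lee_fin cabs_ge0.
- by apply/measurable_EFinP; exact: measurable_cabs.
apply: ge0_le_integral => //.
- by move=> x _; rewrite lee_fin cabs_ge0.
- by apply/measurable_EFinP; exact: (measurable_cabs (cmeasD mF mG)).

- by apply: emeasurable_funD; apply/measurable_EFinP; exact: measurable_cabs.
- by move=> x _; rewrite -EFinD lee_fin cabsD.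
Qed.

Lemma cint_eq F G : Lone F -> Lone G -> L1norm (fun x => F x - G x) = 0%E ->
  cint F = cint G.
Proof.
move=> lF lG FG0; apply/eqP; rewrite -subr_eq0 -cintB//; apply/eqP/cabs_eq0/eqP.
rewrite eq_le cabs_ge0 andbT -lee_fin (le_trans (cabs_cint_le _)) ?FG0//.
exact: LoneB.
Qed.

End ComplexIntegral.

(** * Completeness of L2 and orthogonal projections *)

Section AeConvergence.
Context d (T : measurableType d) (R : realType) (mu : {measure set T -> \bar R}).

Lemma sum_half_le2 (m : nat) : \sum_(0 <= i < m) (2^-1 : R) ^+ i <= 2.
Proof.
suff -> : \sum_(0 <= i < m) (2^-1 : R) ^+ i = 2 - 2 * 2^-1 ^+ m.
  by rewrite lerBlDr lerDl mulr_ge0// exprn_ge0// invr_ge0.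
elim: m => [|m IH]; first by rewrite big_nil expr0 mulr1 subrr.
by rewrite big_nat_recr//= IH exprS; field.
Qed.

(** The sum of all [|g k.+1 - g k|] has integral at most 2, so it is finite almost everywhere, and
    there the telescoping series converges absolutely. *)
Lemma cvg_ae_of_summable (g : nat -> T -> R) :
  (forall k, measurable_fun setT (g k)) ->
  (forall k, (\int[mu]_x `|g k.+1 x - g k x|%:E <= ((2^-1) ^+ k)%:E)%E) ->
  {ae mu, forall x, cvgn (g ^~ x)}.
Proof.
move=> mg gle.
pose h k x := (`|g k.+1 x - g k x|%:E : \bar R).
have mh k : measurable_fun setT (h k).
  apply/measurable_EFinP; apply: measurableT_comp => //.
  exact: measurable_funB.
have h0 k x : (0 <= h k x)%E by rewrite lee_fin.
pose S x := (\sum_(k <oo) h k x)%E.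
have S0 x : (0 <= S x)%E by apply: nneseries_ge0.
have iS : (\int[mu]_x S x <= 2%:E)%E.
  rewrite integral_nneseries//; apply: lime_le.
    by apply: is_cvg_nneseries => k _ _; exact: integral_ge0.
  apply: nearW => m; apply: le_trans (_ : _ <= \sum_(0 <= i < m) ((2^-1) ^+ i)%:E)%E _.
    by apply: lee_sum => k _; exact: gle.
  by rewrite sumEFin lee_fin sum_half_le2.
have integrS : mu.-integrable setT S.
  apply/integrableP; split; first exact: ge0_emeasurable_sum.
  by under eq_integral do rewrite gee0_abs//; rewrite (le_lt_trans iS)// ltry.
have := integrable_ae measurableT integrS; apply: filterS => x /(_ I) Sfin.
have cs : cvgn [normed series (telescope (g ^~ x))].
  apply: nondecreasing_is_cvgn.
    by apply: nondecreasing_series => k _ _; exact: normr_ge0.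
  exists (fine (S x)) => _ [m _ <-].
  rewrite -lee_fin fineK// /series/= -sumEFin.
  exact: nneseries_lim_ge.
have /cvg_ex[l gl] := normed_cvg cs.
apply/cvg_ex; exists (g 0%N x + l).
under eq_fun do rewrite (eq_sum_telescope (g ^~ x)).
by apply: cvgD => //; exact: cvg_cst.
Qed.

(* [fine] of the limsup is a measurable representative of the a.e. limit. *)
Definition seq_limit (g : nat -> T -> R) (x : T) : R :=
  fine (limn_esup (fun k => (g k x)%:E)).

Lemma measurable_seq_limit (g : nat -> T -> R) :
  (forall k, measurable_fun setT (g k)) -> measurable_fun setT (seq_limit g).
Proof.
move=> mg; apply: (measurableT_comp (@fine_measurable R _ measurableT)).
by apply: measurable_fun_limn_esup => k; apply/measurable_EFinP.
Qed.

Lemma cvg_seq_limit (g : nat -> T -> R) x :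
  cvgn (g ^~ x) -> (g k x @[k --> \oo] --> seq_limit g x).
Proof.
move=> /cvg_ex[l gl]; suff -> : seq_limit g x = l by [].
rewrite /seq_limit (_ : limn_esup _ = l%:E)//.
by apply: (cvg_limn_einf_sup _).2; apply/cvg_EFin => //; exact: nearW.
Qed.

End AeConvergence.

(** * The inner product of square-integrable functions *)

Section SquareIntegrable.
Variables (R : realType) (n : nat).
Implicit Types F G H : fnT R n.
Local Notation mu := (torus_measure R n).

Lemma measurable_cabs2 F : cmeas F ->
  measurable_fun setT (fun x => (cabs (F x) ^+ 2)%:E).
Proof. by move=> mF; apply/measurable_EFinP/measurable_funX; exact: measurable_cabs. Qed.

Lemma L2_cmeas F : L2 F -> cmeas F. Proof. by case. Qed.

Lemma sqnorm_le F G : cmeas F -> cmeas G -> (forall x, cabs (F x) <= cabs (G x)) ->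
  (sqnorm F <= sqnorm G)%E.
Proof.
move=> mF mG FG; rewrite !sqnormE//; apply: ge0_le_integral => //.
- by move=> x _; rewrite lee_fin sqr_ge0.
- exact: measurable_cabs2.
- exact: measurable_cabs2.
- by move=> x _; rewrite lee_fin ler_sqr ?nnegrE ?cabs_ge0.
Qed.

Lemma L2_le F G : cmeas F -> L2 G -> (forall x, cabs (F x) <= cabs (G x)) -> L2 F.
Proof.
by move=> mF [mG lG] FG; split => //; apply: le_lt_trans lG; exact: sqnorm_le.
Qed.

Lemma sqnormZ (c : R[i]) F : cmeas F ->
  sqnorm (fun x => c * F x) = ((cabs c ^+ 2)%:E * sqnorm F)%E.
Proof.
move=> mF; rewrite !sqnormE//; last exact: cmeasZ.
under eq_integral do rewrite cabsM exprMn EFinM.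
rewrite ge0_integralZl//; last by rewrite lee_fin sqr_ge0.
  exact: measurable_cabs2.
by move=> x _; rewrite lee_fin sqr_ge0.
Qed.

Lemma L2Z (c : R[i]) F : L2 F -> L2 (fun x => c * F x).
Proof.
move=> [mF lF]; split; first exact: cmeasZ.
by rewrite sqnormZ// lte_mul_pinfty// lee_fin sqr_ge0.
Qed.

Lemma L2D F G : L2 F -> L2 G -> L2 (fun x => F x + G x).
Proof.
move=> [mF lF] [mG lG]; split; first exact: cmeasD.
rewrite sqnormE; last exact: cmeasD.
have : (2%:E * (sqnorm F + sqnorm G) < +oo)%E by rewrite lte_mul_pinfty// lte_add_pinfty.
apply: le_lt_trans; rewrite !sqnormE// -ge0_integralD//; last 4 first.
- by move=> x _; rewrite lee_fin sqr_ge0.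
- exact: measurable_cabs2.
- by move=> x _; rewrite lee_fin sqr_ge0.
- exact: measurable_cabs2.
rewrite -ge0_integralZl//; last 2 first.
- by apply: emeasurable_funD; exact: measurable_cabs2.
- by move=> x _; rewrite adde_ge0// lee_fin sqr_ge0.
apply: ge0_le_integral => //.
- by move=> x _; rewrite lee_fin sqr_ge0.
- exact: (measurable_cabs2 (cmeasD mF mG)).
- by apply: measurable_funeM; apply: emeasurable_funD; exact: measurable_cabs2.
- move=> x _; rewrite -EFinD -EFinM lee_fin.
  have h : cabs (F x + G x) ^+ 2 <= (cabs (F x) + cabs (G x)) ^+ 2.
    by rewrite ler_sqr ?nnegrE ?addr_ge0 ?cabs_ge0// cabsD.
  apply: le_trans h _; have := sqr_ge0 (cabs (F x) - cabs (G x)); lra.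
Qed.

Lemma L2N F : L2 F -> L2 (fun x => - F x).
Proof. by move=> /(L2Z (-1)); under [X in L2 X -> _]eq_fun do rewrite mulN1r. Qed.
Lemma L2B F G : L2 F -> L2 G -> L2 (fun x => F x - G x).
Proof. by move=> lF /L2N; exact: L2D. Qed.
Lemma L2_conj F : L2 F -> L2 (fun x => (F x)^*).
Proof.
move=> lF; apply: (L2_le _ lF); first exact: cmeas_conj (L2_cmeas lF).
by move=> x; rewrite cabs_conj.
Qed.
Lemma L2_cst (c : R[i]) : L2 (fun _ : n.-tuple R => c).
Proof. by split; [exact: cmeas_cst|rewrite /sqnorm tint_cst ltry]. Qed.
Lemma L2_bounded (c : R) F : cmeas F -> (forall x, cabs (F x) <= c) -> L2 F.
Proof.
move=> mF Fc; apply: (L2_le mF (L2_cst c%:C)) => x.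
by rewrite cabs_real (le_trans (Fc x))// ler_norm.
Qed.
Lemma L2_mulb (c : R) H F : cmeas H -> (forall x, cabs (H x) <= c) -> L2 F ->
  L2 (fun x => H x * F x).
Proof.
move=> mH Hc lF; apply: (L2_le _ (L2Z c%:C lF)).
  exact: cmeasM (L2_cmeas lF).
by move=> x; rewrite !cabsM ler_wpM2r ?cabs_ge0// cabs_real (le_trans (Hc x))// ler_norm.
Qed.
Lemma L2_cabs F : L2 F -> L2 (fun x => (cabs (F x))%:C).
Proof.
move=> lF; apply: (L2_le _ lF); first exact: cmeas_cabs (L2_cmeas lF).
by move=> x; rewrite cabs_real ger0_norm ?cabs_ge0.
Qed.

Lemma L2M F G : L2 F -> L2 G -> Lone (fun x => F x * G x).
Proof.
move=> [mF lF] [mG lG]; split; first exact: cmeasM.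
rewrite L1normE; last exact: cmeasM.
have : (sqnorm F + sqnorm G < +oo)%E by rewrite lte_add_pinfty.
apply: le_lt_trans; rewrite !sqnormE// -ge0_integralD//; last 4 first.
- by move=> x _; rewrite lee_fin sqr_ge0.
- exact: measurable_cabs2.
- by move=> x _; rewrite lee_fin sqr_ge0.
- exact: measurable_cabs2.
apply: ge0_le_integral => //.
- by move=> x _; rewrite lee_fin cabs_ge0.
- by apply/measurable_EFinP; exact: (measurable_cabs (cmeasM mF mG)).
- by apply: emeasurable_funD; exact: measurable_cabs2.
- move=> x _; rewrite -EFinD lee_fin cabsM.
  have := sqr_ge0 (cabs (F x) - cabs (G x)).
  have := mulr_ge0 (cabs_ge0 (F x)) (cabs_ge0 (G x)); lra.
Qed.

Lemma L2_Lone F : L2 F -> Lone F.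
Proof.
move=> lF; have := L2M lF (L2_cst 1).
by under [X in Lone X -> _]eq_fun do rewrite mulr1.
Qed.

Lemma L2_innerL F G : L2 F -> L2 G -> Lone (fun x => F x * (G x)^*).
Proof. by move=> lF lG; apply: L2M => //; exact: L2_conj. Qed.

Definition nsq F : R := fine (sqnorm F).

Lemma sqnormK F : L2 F -> sqnorm F = (nsq F)%:E.
Proof. by move=> [mF lF]; rewrite fineK// ge0_fin_numE// sqnorm_ge0. Qed.
Lemma nsq_ge0 F : L2 F -> 0 <= nsq F.
Proof. by move=> [mF lF]; rewrite fine_ge0// sqnorm_ge0. Qed.

Lemma inner_self F : L2 F -> inner F F = (nsq F)%:C.
Proof.
move=> lF; rewrite /inner cintE; last exact: L2_innerL.
apply: complex_ext => /=.
  rewrite /nsq sqnormE; last exact: L2_cmeas.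
  by congr fine; apply: eq_integral => x _; rewrite mul_conj.
by under eq_Rintegral do rewrite mul_conj/=; rewrite Rintegral_cst// mul0r.
Qed.

Lemma innerDl F G H : L2 F -> L2 G -> L2 H ->
  inner (fun x => F x + G x) H = inner F H + inner G H.
Proof.
move=> lF lG lH; rewrite /inner -cintD; [|exact: L2_innerL|exact: L2_innerL].
by congr cint; apply/funext => x; rewrite mulrDl.
Qed.
Lemma innerZl (c : R[i]) F G : L2 F -> L2 G ->
  inner (fun x => c * F x) G = c * inner F G.
Proof.
move=> lF lG; rewrite /inner -cintZ; last exact: L2_innerL.
by congr cint; apply/funext => x; rewrite mulrA.
Qed.
Lemma inner_conj F G : L2 F -> L2 G -> inner G F = (inner F G)^*.
Proof.
move=> lF lG; rewrite /inner -cint_conj; last exact: L2_innerL.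
by congr cint; apply/funext => x; rewrite conjcM conjCK mulrC.
Qed.
Lemma innerNl F G : L2 F -> L2 G -> inner (fun x => - F x) G = - inner F G.
Proof.
move=> lF lG; rewrite -mulN1r -innerZl//.
by congr inner; apply/funext => x; rewrite mulN1r.
Qed.
Lemma innerBl F G H : L2 F -> L2 G -> L2 H ->
  inner (fun x => F x - G x) H = inner F H - inner G H.
Proof. by move=> lF lG lH; rewrite innerDl// ?innerNl//; exact: L2N. Qed.
Lemma innerDr F G H : L2 F -> L2 G -> L2 H ->
  inner H (fun x => F x + G x) = inner H F + inner H G.
Proof.
move=> lF lG lH; rewrite inner_conj//; last exact: L2D.
by rewrite innerDl// conjcD -!inner_conj.
Qed.
Lemma innerZr (c : R[i]) F G : L2 F -> L2 G ->
  inner G (fun x => c * F x) = c^* * inner G F.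
Proof.
move=> lF lG; rewrite inner_conj//; last exact: L2Z.
by rewrite innerZl// conjcM -inner_conj.
Qed.
Lemma innerBr F G H : L2 F -> L2 G -> L2 H ->
  inner H (fun x => F x - G x) = inner H F - inner H G.
Proof.
move=> lF lG lH; rewrite inner_conj//; last exact: L2B.
by rewrite innerBl// conjcB -!inner_conj.
Qed.

Lemma nsqZ (c : R[i]) F : L2 F -> nsq (fun x => c * F x) = cabs c ^+ 2 * nsq F.
Proof. by move=> lF; rewrite /nsq sqnormZ ?fineM ?(sqnormK lF)//; exact: L2_cmeas. Qed.

Lemma nsqD F G : L2 F -> L2 G ->
  nsq (fun x => F x + G x) = nsq F + nsq G + 2 * complex.Re (inner F G).
Proof.
move=> lF lG; have lFG := L2D lF lG.
have := inner_self lFG;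
  rewrite innerDl// !innerDr// !inner_self// => /(congr1 (@complex.Re R)).
rewrite !ReD [inner G F]inner_conj// Re_conj/= => <-; ring.
Qed.

Lemma nsqB F G : L2 F -> L2 G ->
  nsq (fun x => F x - G x) = nsq F + nsq G - 2 * complex.Re (inner F G).
Proof.
move=> lF lG; rewrite nsqD//; last exact: L2N.
rewrite [inner F _]inner_conj//; last exact: L2N.
rewrite innerNl// Re_conj ReN [inner G F]inner_conj// Re_conj.
have -> : nsq (fun x => - G x) = nsq G.
  by have := nsqZ (-1) lG; rewrite cabsN cabs1 expr1n mul1r => <-; congr nsq;
    apply/funext => x; rewrite mulN1r.
ring.
Qed.

(** [key] expands the squared norm of [F - t c G] with [c] the inner product; the optimal [t] is the
    inverse of [nsq G]. *)
Lemma cauchy_schwarz F G : L2 F -> L2 G ->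
  cabs (inner F G) ^+ 2 <= nsq F * nsq G.
Proof.
move=> lF lG; set c := inner F G.
have key (t : R) : 0 <= nsq F - 2 * t * cabs c ^+ 2 + t ^+ 2 * cabs c ^+ 2 * nsq G.
  have lZ := L2Z (t%:C * c) lG.
  have := nsq_ge0 (L2B lF lZ); rewrite nsqB// nsqZ// innerZr// -/c.
  rewrite conjcM conjc_realE -mulrA (mulrC c^*) mul_conj -rmorphM/=.
  rewrite cabsM cabs_real exprMn -normrX (ger0_norm (sqr_ge0 t)) /=; lra.
have [G0|G0] := eqVneq (nsq G) 0.
  rewrite G0 mulr0; have [//|c0] := leP (cabs c ^+ 2) 0.
  (* When [nsq G = 0] the bound is affine in [t], and this [t] would make its right-hand side equal
     to -1. *)
  have := key ((nsq F + 1) / (2 * cabs c ^+ 2)); rewrite G0 mulr0 addr0.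
  have -> : 2 * ((nsq F + 1) / (2 * cabs c ^+ 2)) * cabs c ^+ 2 = nsq F + 1.
    by field; move: c0; apply: contraTneq => ->; rewrite expr0n ltxx.
  lra.
have Gp : 0 < nsq G by rewrite lt_def G0 nsq_ge0.
have := key (nsq G)^-1.
have -> : nsq F - 2 * (nsq G)^-1 * cabs c ^+ 2 + (nsq G)^-1 ^+ 2 * cabs c ^+ 2 * nsq G
   = nsq F - cabs c ^+ 2 / nsq G by field.
by rewrite subr_ge0 ler_pdivrMr.
Qed.

Definition nrm F : R := Num.sqrt (nsq F).

Lemma nrm_ge0 F : 0 <= nrm F. Proof. exact: sqrtr_ge0. Qed.
Lemma sqr_nrm F : L2 F -> nrm F ^+ 2 = nsq F.
Proof. by move=> lF; rewrite sqr_sqrtr// nsq_ge0. Qed.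

Lemma cabs_inner_le F G : L2 F -> L2 G -> cabs (inner F G) <= nrm F * nrm G.
Proof.
move=> lF lG; rewrite -ler_sqr ?nnegrE ?mulr_ge0 ?cabs_ge0 ?nrm_ge0//.
by rewrite exprMn !sqr_nrm// cauchy_schwarz.
Qed.

Lemma nrmD F G : L2 F -> L2 G -> nrm (fun x => F x + G x) <= nrm F + nrm G.
Proof.
move=> lF lG; rewrite -ler_sqr ?nnegrE ?addr_ge0 ?nrm_ge0//.
rewrite sqr_nrm ?nsqD//; last exact: L2D.
have := le_trans (Re_le_cabs _) (cabs_inner_le lF lG).
rewrite sqrrD !sqr_nrm// -mulr_natl; lra.
Qed.

Lemma nrm1 : nrm (fun _ => 1) = 1.
Proof. by rewrite /nrm /nsq /sqnorm tint_cst/= cabs1 expr1n sqrtr1. Qed.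

(** Cauchy-Schwarz for the modulus of [F] against the constant 1, whose norm is 1. This comparison
    makes functionals dominated by the [L^1] norm bounded on [L^2]. *)
Lemma L1norm_nrm F : L2 F -> (L1norm F <= (nrm F)%:E)%E.
Proof.
move=> lF; have lc := L2_cabs lF; have [mF l1F] := L2_Lone lF.
have -> : L1norm F = (cabs (inner (fun x => (cabs (F x))%:C) (fun=> 1)))%:E.
  rewrite /inner (_ : (fun _ => _) = fun x => (cabs (F x))%:C); last first.
    by apply/funext => x; apply: complex_ext; rewrite ?ReM ?ImM/=; ring.
  rewrite cintE; last exact: L2_Lone.
  rewrite /= /Rintegral integral0/= cabs_real ger0_norm.
    by rewrite -L1normE// fineK// ge0_fin_numE// L1norm_ge0.
  by apply: fine_ge0; apply: integral_ge0 => x _; rewrite lee_fin cabs_ge0.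
rewrite lee_fin (le_trans (cabs_inner_le lc (L2_cst 1)))// nrm1 mulr1.
rewrite (_ : nrm (fun x => (cabs (F x))%:C) = nrm F)// /nrm /nsq /sqnorm.
congr (Num.sqrt (fine (tint _))); apply/funext => x.
by rewrite cabs_real ger0_norm ?cabs_ge0.
Qed.

End SquareIntegrable.

(** * Completeness and nearest points in closed subspaces *)

Section Projection.
Variables (R : realType) (n : nat).
Implicit Types F G H f g h : fnT R n.
Local Notation mu := (torus_measure R n).

Lemma half_exp_cvg0 : ((2^-1 : R) ^+ k @[k --> \oo] --> 0).
Proof.
by apply: cvg_expr; rewrite ger0_norm ?invr_ge0// invf_lt1// ltr1n.
Qed.

Lemma limn_einf_le_near (u : nat -> \bar R) (c : \bar R) (k : nat) :
  (forall m, (k <= m)%N -> (u m <= c)%E) -> (limn_einf u <= c)%E.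
Proof.
move=> uc; rewrite limn_einf_lim; apply: lime_le; first exact: is_cvg_einfs.
apply: nearW => m; apply: (@le_trans _ _ (u (maxn m k))).
  by apply: ereal_inf_lbound; exists (maxn m k) => //=; exact: leq_maxl.
by apply: uc; exact: leq_maxr.
Qed.

(* A form of the Riesz-Fischer theorem: a fast Cauchy sequence converges a.e.,
   and by Fatou also in [L^2]. *)
Lemma L2_complete (u : nat -> fnT R n) : (forall k, L2 (u k)) ->
  (forall k m, (k <= m)%N -> nrm (fun x => u m x - u k x) <= 2^-1 ^+ k) ->
  exists2 F, L2 F &
    (sqnorm (fun x => u k x - F x) @[k --> \oo] --> 0%E).
Proof.
move=> lu uC.
have mu_ k := L2_cmeas (lu k).
have step (c : R[i] -> R) : (forall z, `|c z| <= cabs z) ->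
  (forall z w, c (z - w) = c z - c w) ->
    (forall k, measurable_fun setT (fun x => c (u k x))) ->
    {ae mu, forall x, cvgn (fun k => c (u k x))}.
  move=> cle cB mc; apply: (@cvg_ae_of_summable _ _ _ mu (fun k x => c (u k x))) => // k.
  apply: (@le_trans _ _ (L1norm (fun x => u k.+1 x - u k x)%R)).
    rewrite L1normE; last exact: cmeasB.
    apply: ge0_le_integral => //.
    - apply/measurable_EFinP; apply: measurableT_comp => //.
      exact: measurable_funB.
    - by apply/measurable_EFinP; exact: (measurable_cabs (cmeasB (mu_ k.+1) (mu_ k))).
    - by move=> x _; rewrite lee_fin -cB cle.
  apply: le_trans (L1norm_nrm _) _; first exact: L2B.
  by rewrite lee_fin uC.
have aeR : {ae mu, forall x, cvgn (fun k => complex.Re (u k x))}.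
  apply: step => [z|z w|k]; [exact: normr_Re_le|by rewrite ReD ReN|by case: (mu_ k)].
have aeI : {ae mu, forall x, cvgn (fun k => complex.Im (u k x))}.
  apply: step => [z|z w|k]; [exact: normr_Im_le|by rewrite ImD ImN|by case: (mu_ k)].
pose F x := seq_limit (fun k x => complex.Re (u k x)) x +i*
            seq_limit (fun k x => complex.Im (u k x)) x.
have mF : cmeas F.
  by split => /=; apply: measurable_seq_limit => k; case: (mu_ k).
have bound k : (sqnorm (fun x => u k x - F x)%R <= ((2^-1 ^+ k) ^+ 2)%:E)%E.
  have mkm m := cmeasB (mu_ m) (mu_ k).
  have mkF := cmeasB (mu_ k) mF.
  have mL : measurable_fun setT
      (fun x => limn_einf (fun m => (cabs (u m x - u k x) ^+ 2)%:E)).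
    apply: measurableT_comp => //.
    apply: measurable_fun_limn_esup => m.
    by apply: measurableT_comp => //; exact: (measurable_cabs2 (mkm m)).
  have L0 x : (0 <= limn_einf (fun m => (cabs (u m x - u k x) ^+ 2)%:E))%E.
    rewrite limn_einf_lim; apply: lime_ge; first exact: is_cvg_einfs.
    apply: nearW => m; apply: le_ereal_inf_tmp => _ [p _ <-].
    by rewrite lee_fin sqr_ge0.
  rewrite sqnormE//.
  rewrite (@ge0_ae_eq_integral _ _ _ mu setT _
      (fun x => limn_einf (fun m => (cabs (u m x - u k x) ^+ 2)%:E)))//; last 3 first.
  - exact: (measurable_cabs2 mkF).
  - by move=> x _; rewrite lee_fin sqr_ge0.
  - apply: filterS2 aeR aeI => x cR cI _.
    apply/esym; apply: (cvg_limn_einf_sup _).1.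
    apply/cvg_EFin; first exact: nearW.
    under eq_fun do rewrite cabs_sq ReD ReN ImD ImN.
    rewrite cabs_sq ReD ReN ImD ImN -(sqrrN (_ - _ )) -(sqrrN (complex.Im _ - _)) !opprB.
    apply: cvgD; rewrite !expr2; apply: cvgM; (apply: cvgB; last exact: cvg_cst);
      exact: cvg_seq_limit.
  apply: le_trans (fatou mu measurableT _ _) _.
  - by move=> m; exact: (measurable_cabs2 (mkm m)).
  - by move=> m x _; rewrite lee_fin sqr_ge0.
  apply: (@limn_einf_le_near _ _ k) => m km; rewrite -sqnormE//.
  rewrite sqnormK; last exact: L2B.
  rewrite lee_fin -sqr_nrm; last exact: L2B.
  by rewrite ler_sqr ?nnegrE ?nrm_ge0 ?exprn_ge0 ?invr_ge0// uC.
have lF : L2 F.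
  have l0 : L2 (fun x => u 0%N x - F x).
    by split; [exact: cmeasB|apply: le_lt_trans (bound 0%N) _; rewrite ltry].
  have := L2B (lu 0%N) l0; congr L2; apply/funext => x.
  by rewrite opprB addrCA subrr addr0.
exists F => //.
apply: (@squeeze_cvge _ _ _ _ (cst 0%E) _ (fun k => ((2^-1 ^+ k) ^+ 2)%:E)).
- apply: nearW => k; rewrite bound andbT sqnorm_ge0//; exact: cmeasB.
- exact: cvg_cst.
- apply/cvg_EFin; first exact: nearW.
  rewrite -[X in _ --> X](mulr0 0); under eq_fun do rewrite expr2.
  by apply: cvgM; exact: half_exp_cvg0.
Qed.

Lemma subspaceB (S : set (fnT R n)) f g : lin_subspace S -> S f -> S g ->
  S (fun x => f x - g x).
Proof.
move=> [S0 [SD SZ]] Sf Sg; have := SD _ _ Sf (SZ (-1) _ Sg).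
by under [X in S X -> _]eq_fun do rewrite mulN1r.
Qed.

(** The nearest point of [S] is the limit of a minimizing sequence, which the parallelogram law
    makes Cauchy; orthogonality is the first-order condition at the minimum. *)
Lemma proj_exists (S : set (fnT R n)) f : S `<=` @L2 R n -> lin_subspace S ->
  l2closed S -> L2 f ->
  exists2 g, S g & forall h, S h -> inner (fun x => f x - g x) h = 0.
Proof.
move=> SL linS clS lf; have [S0 [SD SZ]] := linS.
pose D := [set nsq (fun x => f x - g x) | g in S].
have D0 : has_inf D.
  split; first by exists (nsq (fun x => f x - 0)), (fun=> 0).
  exists 0 => _ [g Sg <-]; apply: nsq_ge0; exact: L2B (SL _ Sg).
pose d := inf D.
have dle g : S g -> d <= nsq (fun x => f x - g x).
  by move=> Sg; apply: ge_inf; [case: D0|exists g].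
(* With this excess over the infimum, the parallelogram law bounds the squared distance of [u k] and
   [u m] by the mean of [4^-k] and [4^-m], hence by [4^-k] for [k <= m], the rate that [L2_complete]
   asks for. *)
have pick k : exists g, S g /\ nsq (fun x => f x - g x) < d + (2^-1 ^+ k) ^+ 2 / 4.
  have e0 : 0 < (2^-1 ^+ k) ^+ 2 / 4 :> R by rewrite divr_gt0// exprn_gt0// exprn_gt0//
    invr_gt0.
  by have [_ [g Sg <-] gd] := inf_adherent e0 D0; exists g.
have [u hu] := choice pick.
have Su k : S (u k) by case: (hu k).
have lu k : L2 (u k) by exact: SL.
(* Parallelogram law for [f - g] and [f - h]; the midpoint of [g] and [h] lies in [S], so its
   squared distance to [f] is at least [d]. *)
have par g h : S g -> S h ->
    nsq (fun x => h x - g x) <= 2 * nsq (fun x => f x - g x) + 2 * nsq (fun x => f x -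
      h x) - 4 * d.
  move=> Sg Sh; have lg := SL _ Sg; have lh := SL _ Sh.
  have a := L2B lf lg; have b := L2B lf lh.
  have Sm : S (fun x => 2^-1 * (g x + h x)) by apply: SZ; exact: SD.
  have := dle _ Sm.
  have -> : (fun x => f x - 2^-1 * (g x + h x)) =
    (fun x => 2^-1 * ((f x - g x) + (f x - h x))).
    by apply/funext => x; field.
  rewrite nsqZ; last exact: L2D.
  have -> : (fun x => h x - g x) = (fun x => (f x - g x) - (f x - h x)).
    by apply/funext => x; ring.
  rewrite (nsqD a b) (nsqB a b).
  have -> : cabs (2^-1 : R[i]) ^+ 2 = 4^-1.
    rewrite (_ : 2^-1 = (2^-1 : R)%:C); last by rewrite fmorphV/= rmorph_nat.
    by rewrite cabs_real ger0_norm ?invr_ge0//; field.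
  lra.
have uC k m : (k <= m)%N -> nrm (fun x => u m x - u k x) <= 2^-1 ^+ k.
  move=> km; rewrite -ler_sqr ?nnegrE ?nrm_ge0 ?exprn_ge0 ?invr_ge0//.
  rewrite sqr_nrm; last exact: L2B.
  apply: le_trans (par _ _ (Su k) (Su m)) _.
  have := (hu k).2; have := (hu m).2.
  have : (2^-1 : R) ^+ m <= 2^-1 ^+ k.
    by rewrite ler_wiXn2l// ?invr_ge0// invf_le1// ler1n.
  rewrite -(@ler_sqr _ (2^-1 ^+ m)) ?nnegrE ?exprn_ge0 ?invr_ge0//.
  set A := (2^-1 ^+ m) ^+ 2; set B := (2^-1 ^+ k) ^+ 2; lra.
have [g lg ug] := L2_complete lu uC.
have Sg : S g by exact: clS ug.
have dg : nsq (fun x => f x - g x) <= d.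
  have lfg := L2B lf lg.
  have -> : nsq (fun x => f x - g x) = nrm (fun x => f x - g x) ^+ 2 by rewrite sqr_nrm.
  have c0 : nrm (fun x => u k x - g x) @[k --> \oo] --> 0.
    have -> : 0 = Num.sqrt (fine (0 : \bar R)) :> R by rewrite sqrtr0.
    exact: (cvg_comp _ _ (fine_cvg ug) (@sqrt_continuous R _)).
  have c1 : (nrm (fun x => f x - u k x) @[k --> \oo] --> Num.sqrt d).
    suff c1 : nsq (fun x => f x - u k x) @[k --> \oo] --> d.
      exact: (cvg_comp _ _ c1 (@sqrt_continuous R _)).
    apply: (@squeeze_cvgr _ _ _ _ (cst d) (fun k => d + (2^-1 ^+ k) ^+ 2 / 4)).
    - by apply: nearW => k; rewrite dle//= ltW// (hu k).2.
    - exact: cvg_cst.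
    - rewrite -[X in _ --> X]addr0; apply: cvgD; first exact: cvg_cst.
      rewrite -[X in _ --> X](mul0r (4^-1)) -(mulr0 0); apply: cvgM; last exact: cvg_cst.
      by under eq_fun do rewrite expr2; apply: cvgM; exact: half_exp_cvg0.
  have le1 : nrm (fun x => f x - g x) <= Num.sqrt d.
    have := cvgD c1 c0; rewrite addr0 => c2.
    apply: (cvgr_to_ge (c2 _)); apply: nearW => k /=.
    have := nrmD (L2B lf (lu k)) (L2B (lu k) lg).
    by under [X in nrm X <= _]eq_fun do rewrite addrA subrK.
  have d0 : 0 <= d.
    by apply: lb_le_inf; [case: D0|move=> _ [h Sh <-]; apply: nsq_ge0;
      exact: L2B (SL _ Sh)].
  by rewrite -(sqr_sqrtr d0) ler_sqr ?nnegrE ?nrm_ge0 ?sqrtr_ge0.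
exists g => // h Sh; have lh := SL _ Sh; have lr := L2B lf lg.
set c := inner _ h; apply: cabs_eq0; apply/eqP.
(* Minimality of [g] compared with the competitor [g + t c h]. *)
have key (t : R) : 2 * t * cabs c ^+ 2 <= t ^+ 2 * cabs c ^+ 2 * nsq h.
  have lZ := L2Z (t%:C * c) lh.
  have := dle _ (SD _ _ Sg (SZ (t%:C * c) _ Sh)).
  have -> : (fun x => f x - (g x + t%:C * c * h x)) =
    (fun x => (f x - g x) - t%:C * c * h x).
    by apply/funext => x; ring.
  rewrite (nsqB lr lZ) nsqZ// innerZr// -/c.
  rewrite conjcM conjc_realE -mulrA (mulrC c^*) mul_conj -rmorphM/=.
  rewrite cabsM cabs_real exprMn -normrX (ger0_norm (sqr_ge0 t)) /=; lra.
have [//|c0] := eqVneq (cabs c) 0.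
have cp : 0 < cabs c ^+ 2 by rewrite exprn_gt0// lt_def c0 cabs_ge0.
have h0 := nsq_ge0 lh.
(* The added 1 keeps the denominator positive when [h] is null. Then [s * nsq h = 1 - s < 1], so
   [key] can hold only for [c = 0]. *)
have := key (nsq h + 1)^-1; set s := _^-1.
have sp : 0 < s by rewrite invr_gt0 ltr_wpDl.
have sh : s * nsq h = 1 - s by rewrite /s; field; rewrite gt_eqF// ltr_wpDl.
have -> : s ^+ 2 * cabs c ^+ 2 * nsq h = s * cabs c ^+ 2 * (1 - s) by rewrite -sh; ring.
have := mulr_gt0 sp cp; nra.
Qed.

Lemma projQP (Q : set (fnT R n)) f : Q `<=` @L2 R n -> lin_subspace Q ->
  l2closed Q -> L2 f ->
  Q (projQ Q f) /\ forall h, Q h -> inner (fun x => f x - projQ Q f x) h = 0.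
Proof.
move=> QL linQ clQ lf; rewrite /projQ /pick_fn.
apply: (@ClassicalEpsilon.epsilon_spec _ _ [set g | Q g /\ forall h, Q h ->
  inner (fun x => f x - g x) h = 0]).
by have [g Qg gh] := proj_exists QL linQ clQ lf; exists g.
Qed.

End Projection.

(** * Characters and Fejer means *)

Section Characters.
Variable R : realType.

Lemma sin_int_period (s : R) (k : int) : sin (s + 2 * pi * k%:~R) = sin s.
Proof.
have P m a : sin (a + 2 * pi * m%:R) = sin a :> R.
  rewrite -[RHS](periodicn (@sinD2pi R) m a); congr (sin (_ + _)).
  by rewrite -(mulr_natr pi 2) -(mulr_natr _ m); ring.
case: k => m; first by rewrite P.
by rewrite NegzE mulrNz mulrN -(P m.+1 (s - _)) subrK.
Qed.

(** For [k <> 0] the antiderivative of the cosine term has equal values at 0 and 1 by periodicity.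
    The free factor [c] and phase [s] are what the induction over coordinates produces: [c] is the 0
    or 1 left by the inner integrals and [s] collects the outer coordinates. *)
Lemma integral_shifted_cos (c s : R) (k : int) :
  (\int[@lebesgue_measure R]_(t in `[0%R,
    1%R]) (1 + c * cos (s + 2 * pi * (k%:~R * t)))%R%:E
   = (1 + c * (k == 0)%:R * cos s)%R%:E)%E.
Proof.
have [->|k0] := eqVneq k 0.
  under eq_integral do rewrite mul0r mulr0 addr0.
  rewrite integral_cst//= lebesgue_measure_itv/= lte_fin ltr01 oppr0 adde0 mule1.
  by rewrite mulr1.
have kn : 2 * pi * k%:~R != 0 :> R.
  by rewrite mulf_neq0 ?intr_eq0// mulf_neq0 ?pnatr_eq0// gt_eqF ?pi_gt0.
pose F (t : R) := t + c * ((2 * pi * k%:~R)^-1 * sin (s + 2 * pi * (k%:~R * t))).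
have dF (t : R) : is_derive t 1 F (1 + c * cos (s + 2 * pi * (k%:~R * t))).
  rewrite /F; apply: is_derive_eq.
  rewrite /GRing.scale/= add0r mul1r mulr1 (mulrC (cos _)).
  by rewrite mulKf.
have cF : continuous F.
  by move=> t; apply: differentiable_continuous; apply/derivable1_diffP;
    exact: (@ex_derive _ _ _ _ _ _ _ (dF t)).
rewrite (@continuous_FTC2 _ _ F)//.
- rewrite /F (_ : false%:R = 0 :> R)// !mulr0 mulr1 !addr0 sin_int_period -EFinB.
  by congr (_%:E); ring.
- apply: continuous_subspaceT => t.
  apply: cvgD; first exact: cvg_cst.
  apply: cvgM; first exact: cvg_cst.
  suff L : (s + 2 * pi * (k%:~R * u)) @[u --> t] --> s + 2 * pi * (k%:~R * t).
    exact: (cvg_comp _ _ L (@continuous_cos R _)).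
  apply: cvgD; first exact: cvg_cst.
  apply: cvgM; first exact: cvg_cst.
  by apply: cvgM; [exact: cvg_cst|exact: cvg_id].
- split.
  + by move=> t _; exact: (@ex_derive _ _ _ _ _ _ _ (dF t)).
  + by apply: cvg_at_right_filter; exact: cF.
  + by apply: cvg_at_left_filter; exact: cF.
- by move=> t _; rewrite derive1E; exact: derive_val.
Qed.

Variable n : nat.
Implicit Types (k m : n.-tuple int) (x : n.-tuple R) (F : fnT R n).

Definition chr k : fnT R n :=
  fun x => expi (2 * pi * \sum_(j < n) (tnth k j)%:~R * tnth x j).
Definition k0 : n.-tuple int := [tuple (0 : int) | _ < n].
Definition kadd k m : n.-tuple int := [tuple tnth k j + tnth m j | j < n].
Definition kopp k : n.-tuple int := [tuple - tnth k j | j < n].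

Lemma chr_kadd k m x : chr (kadd k m) x = chr k x * chr m x.
Proof.
rewrite /chr -expiD -mulrDr -big_split/=; congr (expi (_ * _)).
by apply: eq_bigr => j _; rewrite tnth_mktuple rmorphD/= mulrDl.
Qed.
Lemma chr_kopp k x : chr (kopp k) x = (chr k x)^*.
Proof.
rewrite /chr expi_conj -mulrN -sumrN; congr (expi (_ * _)).
by apply: eq_bigr => j _; rewrite tnth_mktuple rmorphN/= mulNr.
Qed.
Lemma chr_k0 x : chr k0 x = 1.
Proof.
by rewrite /chr big1 ?mulr0 ?expi0// => j _; rewrite tnth_mktuple mul0r.
Qed.
Lemma cabs_chr k x : cabs (chr k x) = 1. Proof. exact: cabs_expi. Qed.

Lemma cmeas_chr k : cmeas (chr k).
Proof.
have mg : measurable_fun setT (fun x => 2 * pi * \sum_(j < n) (tnth k j)%:~R * tnth x j).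
  apply: measurable_funM; first exact: measurable_cst.
  apply: measurable_sum => j; apply: measurable_funM; first exact: measurable_cst.
  exact: measurable_tnth.
split => /=; apply: measurableT_comp mg; apply: continuous_measurable_fun.
  exact: continuous_cos.
exact: continuous_sin.
Qed.

Lemma L2_chr k : L2 (chr k).
Proof. by apply: (@L2_bounded _ _ 1); [exact: cmeas_chr|move=> x; rewrite cabs_chr]. Qed.

Lemma fourierE F k : fourier F k = inner F (chr k).
Proof. by congr cint; apply/funext => x; rewrite /chr expi_conj. Qed.

End Characters.

Arguments chr R {n} k _.

(** * Orthonormality of the characters *)

Section Orthogonality.
Variable R : realType.

(* Adding 1 keeps the integrand nonnegative, where [tint] is the iterated integral. *)
Lemma tint_one_plus_cos (n : nat) (s : R) (k : n.-tuple int) :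
  tint (fun x : n.-tuple R =>
    (1 + cos (s + 2 * pi * \sum_(j < n) (tnth k j)%:~R * tnth x j))%:E) =
  (1 + (k == k0 n)%:R * cos s)%:E.
Proof.
elim: n s k => [|n IH] s k.
  by rewrite /= big_ord0 mulr0 addr0 [k]tuple0 [k0 0]tuple0 eqxx mul1r.
case/tupleP: k => k h.
have -> : ([tuple of k :: h] == k0 n.+1) = (h == k0 n) && (k == 0).
  apply/eqP/andP => [e|[/eqP-> /eqP->]].
    split; apply/eqP.
      apply: eq_from_tnth => j; have := congr1 (fun z => tnth z (lift ord0 j)) e.
      by rewrite tnthS !tnth_mktuple.
    by have := congr1 (fun z => tnth z ord0) e; rewrite tnth0 tnth_mktuple.
  apply: eq_from_tnth => j; rewrite tnth_mktuple.
  by have [->|[i ->]] := ord_S_case j; rewrite ?tnth0// tnthS tnth_mktuple.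
rewrite /=; under eq_integral.
  move=> t _.
  rewrite (_ : (fun _ => _) = fun x : n.-tuple R =>
    (1 + cos ((s + 2 * pi * (k%:~R * t)) + 2 * pi * \sum_(j < n) (tnth h j)%:~R * tnth
      x j))%:E).
    rewrite IH; over.
  apply/funext => x; rewrite big_ord_recl !tnth0; congr ((1 + cos _)%:E).
  by under eq_bigr do rewrite !tnthS; rewrite mulrDr addrA.
by rewrite integral_shifted_cos; congr ((1 + _)%:E); rewrite -natrM mulnb.
Qed.

Lemma cint_chr (n : nat) (k : n.-tuple int) : cint (chr R k) = (k == k0 n)%:R.
Proof.
have key (s : R) : rint (fun x : n.-tuple R =>
     cos (s + 2 * pi * \sum_(j < n) (tnth k j)%:~R * tnth x j)) = (k == k0 n)%:R * cos s.

  have mth : measurable_fun setT (fun x : n.-tuple R => cos (s + 2 * pi * \sum_(j < n)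
    (tnth k j)%:~R * tnth x j)).
    apply: (measurableT_comp (continuous_measurable_fun (@continuous_cos R))).
    apply: measurable_funD; first exact: measurable_cst.
    apply: measurable_funM; first exact: measurable_cst.
    apply: measurable_sum => j; apply: measurable_funM; first exact: measurable_cst.
    exact: measurable_tnth.
  have lone : Lone (fun x : n.-tuple R => (cos (s + 2 * pi * \sum_(j < n) (tnth k
    j)%:~R * tnth x j))%:C).
    apply: (@Lone_bounded _ _ 1); first by split => //=; exact: measurable_cst.
    by move=> x; rewrite cabs_real ler_norml cos_geN1 cos_le1.
  have i1 := Lone_Re lone; rewrite /= in i1.
  rewrite rintE//.
  have := tint_one_plus_cos s k.
  rewrite tintE; last 2 first.
  - by apply/measurable_EFinP; apply: measurable_funD => //; exact: measurable_cst.
  - by move=> x; rewrite lee_fin -lerBlDl sub0r cos_geN1.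
  under eq_integral do rewrite EFinD.
  rewrite integralD//; last exact: finite_measure_integrable_cst.
  rewrite integral_cst// [X in (_ * X)%E](_ : _ = 1%E); last exact: probability_setT.
  move=> /(congr1 fine); rewrite fineD//; last exact: (integrable_fin_num measurableT i1).
  by rewrite mule1 /= => /addrI.
rewrite /cint /chr/=; apply: complex_ext => /=.
  have := key 0; rewrite cos0 mulr1 => e.
  under [X in rint X]eq_fun do rewrite -[2 * pi * _]add0r.
  by rewrite e; case: (k == _).
(* The sine is the cosine with phase [- pi / 2], so [key] also covers the imaginary part, with the
   factor [cos (pi / 2) = 0]. *)
have := key (- (pi / 2)); rewrite cosN cos_pihalf mulr0 => e.
have -> : (fun x : n.-tuple R => sin (2 * pi * \sum_(j < n) (tnth k j)%:~R * tnth x j))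
   = (fun x => cos (- (pi / 2) + 2 * pi * \sum_(j < n) (tnth k j)%:~R * tnth x j)).
  by apply/funext => x; rewrite addrC cosBpihalf.
by rewrite e; case: (k == _).
Qed.

Lemma kadd_kopp_eq0 (n : nat) (k m : n.-tuple int) :
  (kadd k (kopp m) == k0 n) = (k == m).
Proof.
apply/eqP/eqP => [e|->]; apply: eq_from_tnth => j; last first.
  by rewrite !tnth_mktuple subrr.
have := congr1 (fun z => tnth z j) e; rewrite !tnth_mktuple => /eqP.
by rewrite subr_eq0 => /eqP.
Qed.

Lemma inner_chr (n : nat) (k m : n.-tuple int) :
  inner (chr R k) (chr R m) = (k == m)%:R.
Proof.
rewrite -kadd_kopp_eq0 -cint_chr /inner; congr cint; apply/funext => x.
by rewrite chr_kadd chr_kopp.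
Qed.

End Orthogonality.

(** * Fejer means and the positive kernel on the torus *)

Section Fejer.
Variables (R : realType) (n : nat).
Implicit Types (phi : fnT R n) (x t : n.-tuple R) (N : nat).

Definition vec N (a : {ffun 'I_n -> 'I_N.+1}) : n.-tuple int :=
  [tuple (a j : nat)%:Z | j < n].
Definition dvec N (a b : {ffun 'I_n -> 'I_N.+1}) := kadd (vec a) (kopp (vec b)).
Definition fejer_cst N : R := ((N.+1)%:R ^+ n)^-1.

(** The Fejer mean, with the triangular weights replaced by multiplicities: each frequency is
    counted once for every pair in the cube [{0, ..., N}^n] having it as difference. In this form
    the kernel is visibly a squared modulus. *)
Definition fejer N phi : fnT R n := fun x =>
  (fejer_cst N)%:C * \sum_(a : {ffun 'I_n -> 'I_N.+1}) \sum_(b : {ffun 'I_n -> 'I_N.+1})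
     fourier phi (dvec a b) * chr R (dvec a b) x.

(** The product over the coordinates of the one-variable Fejer kernels at [x - t]. *)
Definition fejer_kernel N x t : R :=
  fejer_cst N * cabs (\sum_(a : {ffun 'I_n -> 'I_N.+1})
     chr R (vec a) x * (chr R (vec a) t)^*) ^+ 2.

Lemma fejer_cst_gt0 N : 0 < fejer_cst N.
Proof. by rewrite invr_gt0 exprn_gt0. Qed.

Lemma fejer_kernel_ge0 N x t : 0 <= fejer_kernel N x t.
Proof. by rewrite mulr_ge0 ?sqr_ge0// ltW// fejer_cst_gt0. Qed.

Lemma fejer_kernelE N x t : (fejer_kernel N x t)%:C =
  (fejer_cst N)%:C * \sum_(a : {ffun 'I_n -> 'I_N.+1}) \sum_(b : {ffun 'I_n -> 'I_N.+1})
     (chr R (dvec a b) t)^* * chr R (dvec a b) x.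
Proof.
rewrite /fejer_kernel rmorphM/= -mul_conj rmorph_sum big_distrlr/=; congr (_ * _).
apply: eq_bigr => a _; apply: eq_bigr => b _.
rewrite /dvec !chr_kadd !chr_kopp !conjcM !conjCK; ring.
Qed.

Lemma L2_sum (I : Type) (r : seq I) (c : I -> fnT R n) :
  (forall i, L2 (c i)) -> L2 (fun x => \sum_(i <- r) c i x).
Proof.
move=> lc; elim: r => [|i r IH]; under eq_fun do rewrite ?big_nil ?big_cons.
  exact: L2_cst.
exact: L2D.
Qed.

Lemma L2_fejer_kernel N x : L2 (fun t => (fejer_kernel N x t)%:C).
Proof.
under eq_fun do rewrite fejer_kernelE.
apply: L2Z; apply: L2_sum => a; apply: L2_sum => b.
under eq_fun do rewrite mulrC; apply: L2Z; apply: L2_conj; exact: L2_chr.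
Qed.

Lemma L2_fejer N phi : L2 (fejer N phi).
Proof.
apply: L2Z; apply: L2_sum => a; apply: L2_sum => b; apply: L2Z; exact: L2_chr.
Qed.

Lemma cint_sum2 (I : finType) (c : I -> I -> fnT R n) :
  (forall i j, Lone (c i j)) ->
  cint (fun x => \sum_i \sum_j c i j x) = \sum_i \sum_j cint (c i j).
Proof.
move=> lc; rewrite cint_sum; last by move=> i _; apply: Lone_sum => j _.
by apply: eq_bigr => i _; rewrite cint_sum.
Qed.

Lemma Lone_mulb (c : R) (F G : fnT R n) : Lone F -> cmeas G ->
  (forall x, cabs (G x) <= c) -> Lone (fun x => F x * G x).
Proof.
move=> lF mG Gc; apply: (Lone_le _ (LoneZ c%:C lF)).
  by apply: cmeasM => //; case: lF.
move=> x; rewrite !cabsM mulrC ler_wpM2r ?cabs_ge0// cabs_real.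
by rewrite (le_trans (Gc x))// ler_norm.
Qed.

Lemma Lone_conj_chr phi k : Lone phi -> Lone (fun t => phi t * (chr R k t)^*).
Proof.
move=> lp; apply: (@Lone_mulb 1) => //; first exact: cmeas_conj (cmeas_chr R k).
by move=> x; rewrite cabs_conj cabs_chr.
Qed.

Lemma fejerE N phi x : Lone phi ->
  fejer N phi x = cint (fun t => phi t * (fejer_kernel N x t)%:C).
Proof.
move=> lp; under eq_fun => t.
  rewrite fejer_kernelE mulrCA mulr_sumr.
  under eq_bigr do rewrite mulr_sumr.
  over.
have l1 a b : Lone (fun t => phi t * ((chr R (dvec a b) t)^* * chr R (dvec a b) x)).
  under eq_fun do rewrite mulrA mulrC.
  by apply: LoneZ; exact: Lone_conj_chr.
rewrite cintZ; last by apply: Lone_sum => a _; apply: Lone_sum => b _; exact: l1.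
rewrite cint_sum2//; congr (_ * _); apply: eq_bigr => a _; apply: eq_bigr => b _.
under [X in _ = cint X]eq_fun do rewrite mulrA mulrC.
by rewrite cintZ ?fourierE 1?mulrC//; exact: Lone_conj_chr.
Qed.

Lemma vec_inj N : injective (@vec N).
Proof.
move=> a b e; apply/ffunP => j; have := congr1 (fun z => tnth z j) e.
by rewrite !tnth_mktuple => -[] /ord_inj.
Qed.

(** The integral is the Fejer mean of the constant 1, to which only the [(N + 1)^n] diagonal pairs
    [a = b] contribute; [fejer_cst] is the inverse of that number. *)
Lemma cint_fejer_kernel N x : cint (fun t => (fejer_kernel N x t)%:C) = 1.
Proof.
have lone1 : Lone (fun _ : n.-tuple R => 1 : R[i]) by apply: L2_Lone; exact: L2_cst.
have := fejerE N x lone1; under [X in _ = cint X -> _]eq_fun do rewrite mul1r.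
move=> <-; rewrite /fejer.
have f1 k : fourier (fun _ : n.-tuple R => 1) k = (k0 n == k)%:R.
  rewrite fourierE -inner_chr; congr inner; apply/funext => t.
  by rewrite chr_k0.
have -> : \sum_(a : {ffun 'I_n -> 'I_N.+1}) \sum_(b : {ffun 'I_n -> 'I_N.+1})
   fourier (fun=> 1) (dvec a b) * chr R (dvec a b) x = ((N.+1)%:R ^+ n)%:C.
  transitivity (\sum_(a : {ffun 'I_n -> 'I_N.+1}) (1 : R[i])).
    apply: eq_bigr => a _; rewrite (bigD1 a)//= big1 => [|b ba].
      rewrite f1 eq_sym kadd_kopp_eq0 eqxx mul1r addr0.
      have /eqP -> : dvec a a == k0 n by rewrite kadd_kopp_eq0.
      exact: chr_k0.
    rewrite f1 eq_sym kadd_kopp_eq0 (inj_eq (@vec_inj N)) eq_sym (negbTE ba).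
    by rewrite mul0r.
  by rewrite sumr_const card_ffun !card_ord rmorphXn/= rmorph_nat natrX.
by rewrite -rmorphM/= mulVf// expf_neq0// pnatr_eq0.
Qed.

Lemma L1norm_nonneg (g : n.-tuple R -> R) : (forall t, 0 <= g t) ->
  Lone (fun t => (g t)%:C) ->
    L1norm (fun t => (g t)%:C) = (complex.Re (cint (fun t => (g t)%:C)))%:E.
Proof.
move=> g0 lg; rewrite L1normE; last by case: lg.
rewrite cintE//= /Rintegral fineK;
  last exact: (integrable_fin_num measurableT (Lone_Re lg)).
by apply: eq_integral => t _; rewrite cabs_real ger0_norm.
Qed.

(** The kernel is nonnegative of integral 1, so a Fejer mean is an average of values of [phi].
    Fourier partial sums have no such uniform bound. *)
Lemma cabs_fejer_le N phi x : cmeas phi -> (forall t, cabs (phi t) <= 1) ->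
  cabs (fejer N phi x) <= 1.
Proof.
move=> mp p1; have lp : Lone phi by exact: Lone_bounded p1.
have lk := L2_Lone (L2_fejer_kernel N x); have [mk _] := lk.
have l : Lone (fun t => phi t * (fejer_kernel N x t)%:C).
  under eq_fun do rewrite mulrC; exact: (@Lone_mulb 1).
rewrite fejerE// -lee_fin (le_trans (cabs_cint_le l))//.
have -> : 1%:E = L1norm (fun t => (fejer_kernel N x t)%:C).
  by rewrite L1norm_nonneg ?cint_fejer_kernel//; exact: fejer_kernel_ge0.
apply: L1norm_le => //; first by case: l.
by move=> t; rewrite cabsM ler_piMl ?cabs_ge0.
Qed.

Definition fejer_coef N (m : n.-tuple int) : R :=
  fejer_cst N * \sum_(a : {ffun 'I_n -> 'I_N.+1}) \sum_(b : {ffun 'I_n -> 'I_N.+1})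
     (dvec a b == m)%:R.

Lemma fourier_fejer N phi m :
  fourier (fejer N phi) m = (fejer_coef N m)%:C * fourier phi m.
Proof.
rewrite fourierE /inner /fejer; under eq_fun => x.
  rewrite -mulrA mulr_suml; under eq_bigr do rewrite mulr_suml.
  over.
have l1 (a b : {ffun 'I_n -> 'I_N.+1}) :
    Lone (fun x => fourier phi (dvec a b) * chr R (dvec a b) x * (chr R m x)^*).
  by apply: Lone_conj_chr; apply: L2_Lone; apply: L2Z; exact: L2_chr.
rewrite cintZ; last by apply: Lone_sum => a _; apply: Lone_sum => b _; exact: l1.
rewrite cint_sum2// /fejer_coef rmorphM/= -mulrA; congr (_ * _).
rewrite rmorph_sum mulr_suml; apply: eq_bigr => a _.
rewrite rmorph_sum mulr_suml; apply: eq_bigr => b _.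
under eq_fun do rewrite -mulrA.
rewrite cintZ; last by apply: Lone_conj_chr; apply: L2_Lone; exact: L2_chr.
rewrite (_ : cint _ = inner (chr R (dvec a b)) (chr R m))// inner_chr.
by case: eqP => [->|_]; rewrite ?mulr1 ?mul1r ?mulr0 ?mul0r.
Qed.

End Fejer.

(** * Convergence of the Fejer multipliers to 1 *)

Section FejerCoefficients.
Variables (R : realType).

Lemma sum_leq_ord (N p : nat) : (\sum_(i < N) (p <= i) = N - p)%N.
Proof.
elim: N => [|N IH]; first by rewrite big_ord0.
by rewrite big_ord_recr/= IH; case: leqP => ?; lia.
Qed.

Lemma sum_diff_nat (N p : nat) :
  (\sum_(i < N) \sum_(l < N) ((i : nat) == l + p) = N - p)%N.
Proof.
rewrite -sum_leq_ord; apply: eq_bigr => i _; case: leqP => [pi|ip].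
  have lN : (i - p < N)%N by rewrite (leq_ltn_trans (leq_subr _ _)).
  rewrite (bigD1 (Ordinal lN))//= subnK// eqxx big1// => l /eqP nl.
  case: eqP => // e; exfalso; apply: nl; apply: val_inj => /=; rewrite e; lia.
by rewrite big1// => l _; case: eqP => // e; move: ip; rewrite e; lia.
Qed.

Lemma sum_diff_int (N : nat) (m : int) :
  (\sum_(i < N) \sum_(l < N) ((i : nat)%:Z - (l : nat)%:Z == m)%R = N - `|m|)%N.
Proof.
case: m => p.
  rewrite -sum_diff_nat; apply: eq_bigr => i _; apply: eq_bigr => l _.
  by congr nat_of_bool; apply/eqP/eqP; lia.
rewrite exchange_big/= -sum_diff_nat; apply: eq_bigr => i _; apply: eq_bigr => l _.
by congr nat_of_bool; apply/eqP/eqP; rewrite ?NegzE; lia.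
Qed.

(** The condition that a pair has difference [m] splits over the coordinates, and the sum of
    products distributes into a product of one-variable counts. The truncated subtraction gives 0
    for frequencies beyond [N]. *)
Lemma fejer_coefE (n N : nat) (m : n.-tuple int) :
  fejer_coef R N m = \prod_(j < n) ((N.+1 - `|tnth m j|)%N%:R / N.+1%:R).
Proof.
rewrite /fejer_coef /fejer_cst big_split/= mulrC; congr (_ * _); last first.
  by rewrite prodr_const card_ord exprVn.
have e (a b : {ffun 'I_n -> 'I_N.+1}) : (dvec a b == m)%:R =
   \prod_(j < n) ((a j : nat)%:Z - (b j : nat)%:Z == tnth m j)%:R :> R.
  have [/eqP <-|ne] := boolP (dvec a b == m).
    by rewrite big1// => j _; rewrite !tnth_mktuple eqxx.
  have [j nj] : exists j, (a j : nat)%:Z - (b j : nat)%:Z != tnth m j.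
    apply/existsP; rewrite -negb_forall; apply: contra ne => /forallP h.
    by apply/eqP/eq_from_tnth => j; rewrite !tnth_mktuple; exact/eqP.
  by rewrite (bigD1 j)//= (negbTE nj) mul0r.
under eq_bigr do under eq_bigr do rewrite e.
transitivity (\sum_(a : {ffun 'I_n -> 'I_N.+1}) \prod_(j < n)
    \sum_(l < N.+1) ((a j : nat)%:Z - (l : nat)%:Z == tnth m j)%:R : R).
  apply: eq_bigr => a _.
  by rewrite (bigA_distr_bigA (fun (j : 'I_n) (l : 'I_N.+1) =>
     ((a j : nat)%:Z - (l : nat)%:Z == tnth m j)%:R : R)).
rewrite -(bigA_distr_bigA (fun (j : 'I_n) (i : 'I_N.+1) =>
   \sum_(l < N.+1) ((i : nat)%:Z - (l : nat)%:Z == tnth m j)%:R : R)).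
apply: eq_bigr => j _; rewrite -sum_diff_int natr_sum; apply: eq_bigr => i _.
by rewrite natr_sum.
Qed.

Lemma fejer_coef_cvg (n : nat) (m : n.-tuple int) :
  (fejer_coef R N m @[N --> \oo] --> (1 : R)).
Proof.
under eq_fun do rewrite fejer_coefE.
elim: (index_enum _) => [|j r IH].
  by under eq_fun do rewrite big_nil; exact: cvg_cst.
under eq_fun do rewrite big_cons.
set p := `|tnth m j|%N.
(* [harmonic N] is [1 / (N + 1)], so this is the factor itself when [p <= N + 1] and a negative
   lower bound for it otherwise. *)
have h : (1 - p%:R * harmonic N) @[N --> \oo] --> (1 : R).
  rewrite -[X in _ --> X]subr0 -(mulr0 p%:R); apply: cvgB; first exact: cvg_cst.
  by apply: cvgM; [exact: cvg_cst|exact: cvg_harmonic].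
suff c1 : ((N.+1 - p)%N%:R / N.+1%:R) @[N --> \oo] --> (1 : R).
  by have := cvgM c1 IH; rewrite mulr1; apply.
apply: (@squeeze_cvgr _ _ _ _ (fun N => 1 - p%:R * harmonic N) (cst 1)) => //;
  last exact: cvg_cst.
apply: nearW => N /=; rewrite ler_pdivrMr ?ltr0n// mul1r ler_nat leq_subr andbT.
rewrite ler_pdivlMr ?ltr0n// mulrBl mul1r -mulrA mulVf ?pnatr_eq0// mulr1.
by rewrite lerBlDr -natrD ler_nat; lia.
Qed.

End FejerCoefficients.

(** * Uniqueness of Fourier coefficients *)

Section KernelEstimate.
Variable R : realType.

Lemma ler_cos_pi (a b : R) : 0 <= b -> b <= a -> a <= pi -> cos a <= cos b.
Proof.
move=> b0 ba ap; rewrite leNgt ltr_cos ?in_itv/= ?b0 ?(le_trans ba)//.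
  by rewrite -leNgt.
by rewrite (le_trans b0 ba).
Qed.

Lemma cos_2pi_le (u d : R) : 0 < d -> d <= `|u| -> `|u| <= 1 - d ->
  cos (2 * pi * u) <= cos (2 * pi * d).
Proof.
move=> d0 du ud; have pp := pi_gt0 R.
have -> : cos (2 * pi * u) = cos (2 * pi * `|u|).
  by case: (ger0P u) => // _; rewrite mulrN cosN.
move: (`|u|) du ud => {}u du ud; have [u2|u2] := leP u (2^-1).
  by apply: ler_cos_pi; nra.
have -> : cos (2 * pi * u) = cos (2 * pi * (1 - u)).
  rewrite -[RHS]cosN -(cosD2pi (- _)); congr cos; rewrite -mulr_natr; ring.
by apply: ler_cos_pi; nra.
Qed.

Lemma cos_2pi_lt1 (d : R) : 0 < d -> d <= 2^-1 -> cos (2 * pi * d) < 1.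
Proof.
move=> d0 d2; have pp := pi_gt0 R;
  have i0 : (0 : R) \in `[0, pi] by rewrite in_itv/= lexx ltW.
have i1 : 2 * pi * d \in `[0, pi] by rewrite in_itv/=; apply/andP; split; nra.
by rewrite -[X in _ < X]cos0 (ltr_cos i0 i1); nra.
Qed.

Lemma expiMn (m : nat) (s : R) : expi (m%:R * s) = expi s ^+ m.
Proof.
elim: m => [|m IH]; first by rewrite mul0r expi0 expr0.
by rewrite exprS -IH -expiD; congr expi; rewrite -natr1; ring.
Qed.

Lemma cabs_expi_sub1 (s : R) : cabs (expi s - 1) ^+ 2 = 2 - 2 * cos s.
Proof.
rewrite cabs_sq ReD ReN ImD ImN /= oppr0 addr0.
have := cos2Dsin2 s; nra.
Qed.

(** The kernel is the squared modulus of a geometric sum in [z], divided by [N + 1], and the cosine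
    factor is the squared modulus of [z - 1]. Their product telescopes to that of [z^(N+1) - 1], at
    most 4, over [N + 1]. *)
Lemma fejer_kernel1_le (N : nat) (x t : 1.-tuple R) :
  fejer_kernel N x t * (2 - 2 * cos (2 * pi * (tnth x ord0 - tnth t ord0)))
    <= 4 / N.+1%:R.
Proof.
set u := tnth x ord0 - tnth t ord0; set z := expi (2 * pi * u).
have -> : fejer_kernel N x t = N.+1%:R^-1 * cabs (\sum_(i < N.+1) z ^+ i) ^+ 2.
  rewrite /fejer_kernel /fejer_cst expr1; congr (_ * cabs _ ^+ 2).
  transitivity (\sum_(a : {ffun 'I_1 -> 'I_N.+1}) \prod_(j < 1) z ^+ (a j)).
    apply: eq_bigr => a _; rewrite big_ord1 -chr_kopp -expiMn /chr !big_ord1 -expiD.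
    by congr expi; rewrite /u !tnth_mktuple mulrNz -!pmulrn; ring.
  by rewrite -(bigA_distr_bigA (fun _ (i : 'I_N.+1) => z ^+ i)) big_ord1.
rewrite -cabs_expi_sub1 -/z -(mulrA N.+1%:R^-1) -exprMn -cabsM.
rewrite (mulrC N.+1%:R^-1) ler_pM2r ?invr_gt0 ?ltr0n//.
rewrite (mulrC (\sum_(i < _) _)) -subrX1 -expiMn.
have h : cabs (expi (N.+1%:R * (2 * pi * u)) - 1) <= 2.
  by rewrite (le_trans (cabsB _ _))// cabs_expi cabs1.
have := cabs_ge0 (expi (N.+1%:R * (2 * pi * u)) - 1); nra.
Qed.

End KernelEstimate.

(** * Null sets of the torus and dominated convergence *)

Section AlmostEverywhere.
Variables (R : realType) (n : nat).
Implicit Types (F G : fnT R n) (x : n.-tuple R).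
Local Notation mu := (torus_measure R n).

Definition cind (B : set (n.-tuple R)) : fnT R n := fun x => (\1_B x)%:C.

Lemma cmeas_cind B : measurable B -> cmeas (cind B).
Proof. by move=> mB; split => /=; [exact: measurable_indic|exact: measurable_cst]. Qed.
Lemma cabs_cind B x : cabs (cind B x) <= 1.
Proof. by rewrite cabs_real indicE; case: (_ \in _); rewrite ?normr1 ?normr0. Qed.

Lemma L1norm_ae_le (c : R) F : cmeas F -> 0 <= c ->
  {ae mu, forall x, cabs (F x) <= c} -> (L1norm F <= c%:E)%E.
Proof.
move=> mF c0 Fc; rewrite L1normE//.
have -> : c%:E = (\int[mu]_x (cst c%:E) x)%E.
  by rewrite integral_cst// [X in (_ * X)%E](_ : _ = 1%E) ?mule1//; exact: probability_setT.
apply: ae_ge0_le_integral => //.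
- by move=> x _; rewrite lee_fin cabs_ge0.
- by apply/measurable_EFinP; exact: measurable_cabs.
- by apply: filterS Fc => x Fx _; rewrite lee_fin.
Qed.

Lemma ae_L1norm0 F : cmeas F -> {ae mu, forall x, F x = 0} -> L1norm F = 0%E.
Proof.
move=> mF F0; apply/eqP; rewrite eq_le L1norm_ge0// andbT.
by apply: L1norm_ae_le => //; apply: filterS F0 => x ->; rewrite cabs0.
Qed.

Lemma L1norm0_ae F : cmeas F -> L1norm F = 0%E -> {ae mu, forall x, F x = 0}.
Proof.
move=> mF; rewrite L1normE// => F0.
have mc : measurable_fun setT (fun x => (cabs (F x))%:E).
  by apply/measurable_EFinP; exact: measurable_cabs.
have := (ae_eq_integral_abs mu measurableT mc).1.
under eq_integral do rewrite gee0_abs ?lee_fin ?cabs_ge0//.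
move=> /(_ F0); apply: filterS => x /(_ I) [] h; exact: cabs_eq0.
Qed.

Lemma ae_sqnorm0 F : cmeas F -> {ae mu, forall x, F x = 0} -> sqnorm F = 0%E.
Proof.
move=> mF F0; rewrite sqnormE//.
rewrite (@ge0_ae_eq_integral _ _ _ mu setT _ (cst 0%E))//.
- by rewrite integral0.
- exact: measurable_cabs2.
- by move=> x _; rewrite lee_fin sqr_ge0.
- by apply: filterS F0 => x -> _; rewrite cabs0 expr0n.
Qed.

Lemma sqnorm0_ae F : cmeas F -> sqnorm F = 0%E -> {ae mu, forall x, F x = 0}.
Proof.
move=> mF; rewrite sqnormE// => F0.
have := (ae_eq_integral_abs mu measurableT (measurable_cabs2 mF)).1.
under eq_integral do rewrite gee0_abs ?lee_fin ?sqr_ge0//.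
move=> /(_ F0); apply: filterS => x /(_ I) [] /eqP; rewrite sqrf_eq0 => /eqP.
exact: cabs_eq0.
Qed.

Lemma cint_ae F G : Lone F -> Lone G -> {ae mu, forall x, F x = G x} ->
  cint F = cint G.
Proof.
move=> lF lG FG; apply: cint_eq => //; apply: ae_L1norm0.
  by apply: cmeasB; [case: lF|case: lG].
by apply: filterS FG => x ->; rewrite subrr.
Qed.

(** Hyperplanes are null. The values 0 and [a] are the jumps of the indicator of a ray seen on the
    circle, where 0 and 1 are the same point. *)
Lemma ae_tnth (j : 'I_n) (a : R) :
  {ae mu, forall x, [/\ 0 < tnth x j, tnth x j < 1 & tnth x j != a]}.
Proof.
pose B : set R := ~` (`]0, 1[ `\ a).
have mB : measurable B by apply: measurableC; apply: measurableD.
have mP : measurable ((fun x : n.-tuple R => tnth x j) @^-1` B).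
  by rewrite -[X in measurable X]setTI; apply: (measurable_tnth j).
exists ((fun x => tnth x j) @^-1` B); split => //.
- have -> : mu ((fun x => tnth x j) @^-1` B) = tint (fun x => (\1_B (tnth x j))%:E).
    rewrite tintE.
    + have := integral_indic mu measurableT mP; rewrite setIT => <-.
      by apply: eq_integral => x _; rewrite !indicE.
    + by apply/measurable_EFinP; apply: (measurableT_comp (measurable_indic mB));
      exact: measurable_tnth.
    + by move=> x; rewrite lee_fin.
  rewrite (tint_tnth j (fun t => (\1_B t)%:E)) integral_indic//.
  apply: countable_lebesgue_measure0; apply: sub_countable (_ : countable [set 0; 1; a]).
    apply: subset_card_le => t [Bt /=]; rewrite in_itv/= => /andP[t0 t1].
    have [->|t0'] := eqVneq t 0; first by left; left.
    have [->|t1'] := eqVneq t 1; first by left; right.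
    have [->|ta] := eqVneq t a; first by right.
    exfalso; apply: Bt; split; last exact/eqP.
    by rewrite /= in_itv/= !lt_def t0' t0 eq_sym t1' t1.
  by apply: finite_set_countable; rewrite !finite_setU; split; [split|]; exact: finite_set1.
- move=> x nx [/=]; rewrite in_itv/= => /andP[x0 x1] xa; apply: nx.
  by split => //; exact/eqP.
Qed.

Lemma cint_dct (r : fnT R n) (F : nat -> fnT R n) G : Lone r ->
  (forall N, cmeas (F N)) -> cmeas G ->
  (forall N x, cabs (F N x) <= cabs (r x)) -> (forall x, cabs (G x) <= cabs (r x)) ->
  {ae mu, forall x, cabs (F N x - G x) @[N --> \oo] --> 0} ->
  cabs (cint (F N) - cint G) @[N --> \oo] --> 0.
Proof.
move=> lr mF mG Fr Gr FG.
have lF N : Lone (F N) by exact: Lone_le (Fr N).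
have lG : Lone G by exact: Lone_le Gr.
have c0 : (L1norm (fun x => F N x - G x) @[N --> \oo] --> 0%E).
  have e N : L1norm (fun x => F N x - G x) = (\int[mu]_x (cabs (F N x - G x))%:E)%E.
    by rewrite L1normE//; exact: cmeasB.
  under eq_fun do rewrite e.
  pose f_ N x := (cabs (F N x - G x))%:E.
  pose g x := (cabs (r x) + cabs (r x))%:E.
  have mf N : measurable_fun setT (f_ N).
    by apply/measurable_EFinP; exact: (measurable_cabs (cmeasB (mF N) mG)).
  have f0 : {ae mu, forall x, setT x -> f_ ^~ x @ \oo --> 0%E}.
    by apply: filterS FG => x h _; apply/cvg_EFin => //; exact: nearW.
  have ig : mu.-integrable setT g.
    rewrite /g; under eq_fun do rewrite EFinD.
    by apply: integrableD => //; exact: Lone_integrable_cabs.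
  have fg : {ae mu, forall x N, setT x -> (`|f_ N x| <= g x)%E}.
    apply: nearW => x N _; rewrite gee0_abs ?lee_fin ?cabs_ge0//.
    by rewrite (le_trans (cabsB _ _))// lerD.
  have [_ _] := dominated_convergence measurableT mf (measurable_cst (0%E : \bar R)) f0
    ig fg.
  by rewrite integral0.
apply: (@squeeze_cvgr _ _ _ _ (cst 0) (fun N => fine (L1norm (fun x => F N x - G x)))).
- apply: nearW => N /=; rewrite cabs_ge0/= -lee_fin L1norm_fin; last exact: LoneB.
  by rewrite -cintB// cabs_cint_le//; exact: LoneB.
- exact: cvg_cst.
- exact: fine_cvg c0.
Qed.

End AlmostEverywhere.

(** * Fejer means of indicators of arcs *)

Section RayApproximation.
Variable R : realType.

Definition ray (n : nat) (j : 'I_n) (a : R) : set (n.-tuple R) :=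
  (fun x => tnth x j) @^-1` `]-oo, a[.

Lemma rayE (n : nat) (j : 'I_n) a (x : n.-tuple R) :
  cind (ray j a) x = (tnth x j < a)%R%:R.
Proof.
rewrite /cind indicE (_ : (x \in ray j a) = (tnth x j < a)); last first.
  by apply/idP/idP; rewrite inE /ray/= in_itv.
by case: (_ < _).
Qed.

Lemma measurable_ray (n : nat) (j : 'I_n) a : measurable (ray j a).
Proof. by rewrite -[X in measurable X]setTI; apply: (measurable_tnth j). Qed.

(** The error averages [phi t - phi x] against the kernel. This difference vanishes unless [t] and
    [x] lie on different sides of a jump, and then their distance on the circle is at least [d],
    where the kernel is of order [1 / (N + 1)]. *)
Lemma fejer_ray_cvg (a : R) (x : 1.-tuple R) :
  0 < tnth x ord0 -> tnth x ord0 < 1 -> tnth x ord0 != a ->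
  cabs (fejer N (cind (ray ord0 a)) x - cind (ray ord0 a) x) @[N --> \oo] --> 0.
Proof.
set y := tnth x ord0 => y0 y1 ya; set phi := cind _.
have mphi : cmeas phi by apply: cmeas_cind; exact: measurable_ray.
have lphi : Lone phi by apply: (Lone_bounded mphi); exact: cabs_cind.
(* The distance of [y] to the jumps at [a], 0 and 1. *)
pose d := Num.min `|y - a| (Num.min y (1 - y)).
have d0 : 0 < d by rewrite !lt_min normr_gt0 subr_eq0 ya y0 subr_gt0.
have [da dy d1y] : [/\ d <= `|y - a|, d <= y & d <= 1 - y].
  by rewrite /d !ge_min !lexx !orbT.
have d2 : d <= 2^-1 by lra.
pose c := 2 - 2 * cos (2 * pi * d).
have cp : 0 < c by have := cos_2pi_lt1 d0 d2; rewrite /c; lra.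
have bound N : cabs (fejer N phi x - phi x) <= 4 / c * harmonic N.
  have lk := L2_Lone (L2_fejer_kernel N x).
  have l1 : Lone (fun t => phi t * (fejer_kernel N x t)%:C).
    under eq_fun do rewrite mulrC; apply: (@Lone_mulb _ _ 1) => //; exact: cabs_cind.
  have -> : fejer N phi x - phi x =
      cint (fun t => phi t * (fejer_kernel N x t)%:C - phi x * (fejer_kernel N x t)%:C).
    by rewrite cintB ?cintZ ?cint_fejer_kernel ?mulr1 ?fejerE//; exact: LoneZ.
  have lB := LoneB l1 (LoneZ (phi x) lk).
  rewrite -lee_fin (le_trans (cabs_cint_le lB))//.
  apply: L1norm_ae_le; first by case: lB.
    by rewrite mulr_ge0 ?divr_ge0 ?ltW// harmonic_gt0.
  apply: filterS (ae_tnth ord0 a) => t [t0 t1 _].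
  rewrite -mulrBl cabsM cabs_real ger0_norm ?fejer_kernel_ge0//.
  have K0 := fejer_kernel_ge0 N x t.
  have [e|ne] := eqVneq (phi t) (phi x).
    by rewrite e subrr cabs0 mul0r mulr_ge0 ?divr_ge0 ?ltW// harmonic_gt0.
  have p1 : cabs (phi t - phi x) <= 1.
    rewrite /phi !rayE; do 2 case: (_ < _);
      rewrite ?subrr ?sub0r ?subr0 ?cabsN ?cabs0 ?cabs1//.
  (* Since [a] separates [t] from [y], they are at least [|y - a|] apart; since both lie in the unit
     interval and [y] keeps distance [d] from its ends, they are at most [1 - d] apart, which
     excludes closeness across the end points. *)
  have ud : d <= `|y - tnth t ord0| /\ `|y - tnth t ord0| <= 1 - d.
    move: ne; rewrite /phi !rayE -/y; move: (tnth t ord0) t0 t1 => s s0 s1.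
    have [sa|sa] := ltP s a; have [yb|yb] := ltP y a; rewrite ?eqxx// => _.
      have := da; rewrite !ger0_norm ?subr_ge0//; [lra..|].
      by rewrite (le_trans (ltW sa)).
    have := da; rewrite !ler0_norm ?subr_le0 ?(ltW yb) ?(le_trans (ltW yb))//; lra.
  have := fejer_kernel1_le N x t; rewrite -/y.
  have := cos_2pi_le d0 ud.1 ud.2.
  set C := cos _; set D := fejer_kernel _ _ _ => hC hK.
  apply: (@le_trans _ _ D); first by rewrite ler_piMl.
  have hc : c <= 2 - 2 * C by rewrite /c; lra.
  rewrite mulrAC ler_pdivlMr//.
  by apply: le_trans hK; rewrite ler_wpM2l.
apply: (@squeeze_cvgr _ _ _ _ (cst 0) (fun N => 4 / c * harmonic N)).
- by apply: nearW => N /=; rewrite cabs_ge0 bound.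
- exact: cvg_cst.
- by rewrite -[X in _ --> X](mulr0 (4 / c)); apply: cvgM;
  [exact: cvg_cst|exact: cvg_harmonic].
Qed.

End RayApproximation.

(** * From rays to boxes, and totality of the characters *)

Section Uniqueness.
Variables (R : realType) (n : nat).
Implicit Types (F G f g : fnT R n) (x : n.-tuple R).
Local Notation mu := (torus_measure R n).

Definition single (j : 'I_n) (p : int) : n.-tuple int :=
  [tuple if i == j then p else 0 | i < n].

Lemma chr_single (j : 'I_n) (p : int) x :
  chr R (single j p) x = expi (2 * pi * (p%:~R * tnth x j)).
Proof.
rewrite /chr (bigD1 j)//= tnth_mktuple eqxx big1 ?addr0// => i ij.
by rewrite tnth_mktuple (negbTE ij) mul0r.
Qed.

Lemma chr_lift1 (j : 'I_n) (k : 1.-tuple int) x :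
  chr R k [tuple tnth x j | _ < 1] = chr R (single j (tnth k ord0)) x.
Proof. by rewrite chr_single /chr big_ord1 tnth_mktuple. Qed.

(** Indexing by lists makes the pi-system property immediate: concatenation is intersection, and the
    empty list is the whole space. *)
Definition boxes (s : seq ('I_n * R)) : set (n.-tuple R) :=
  \big[setI/setT]_(p <- s) ray p.1 p.2.

Lemma measurable_boxes s : measurable (boxes s).
Proof. by rewrite /boxes; apply: bigsetI_measurable => p _; exact: measurable_ray. Qed.

Lemma measurable_tuple_boxes :
  @measurable _ (n.-tuple R) = <<s [set B | exists s, B = boxes s] >>.
Proof.
set G := [set B | _]; apply/seteqP; split.
  apply: smallest_sub; first exact: smallest_sigma_algebra.
  move=> A; rewrite -bigcup_seq => -[j _ [Y mY <-]].
  have mt : measurable_fun [set: g_sigma_algebraType G] (fun x : n.-tuple R => tnth x j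
    : R).
    have E : @measurable _ R = <<s @RGenInftyO.G R >> := RGenInftyO.measurableE R.
    apply: (measurability _ E) => _ [_ [a ->] <-].
    apply: sub_sigma_algebra; exists [:: (j, a)].
    by rewrite /boxes big_seq1 setTI.
  exact: mt.
apply: smallest_sub; first exact: sigma_algebra_measurable.
by move=> _ [s ->]; exact: measurable_boxes.
Qed.

(** The measurable sets over which [g] integrates to 0 form a Dynkin class containing the pi-system
    of boxes, hence are all the measurable sets. *)
Lemma integral_boxes_ae0 (g : n.-tuple R -> R) :
  mu.-integrable setT (fun x => (g x)%:E) ->
  (forall s, (\int[mu]_(x in boxes s) (g x)%:E = 0)%E) ->
  {ae mu, forall x, g x = 0}.
Proof.
move=> ig g0.
have all0 : forall A, measurable A -> (\int[mu]_(x in A) (g x)%:E = 0)%E.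
  move=> A mA; have := mA; rewrite measurable_tuple_boxes.
  move: A {mA}; apply: (dynkin_induction measurable_tuple_boxes).
  - move=> _ _ [s ->] [t ->]; exists (s ++ t).
    by rewrite /boxes big_cat.
  - by have := g0 [::]; rewrite /boxes big_nil.
  - by move=> _ [s ->]; exact: g0.
  - move=> S mS S0; have := g0 [::]; rewrite /boxes big_nil -(setUv S) integral_setU//.
    + by rewrite S0 add0e.
    + exact: measurableC.
    + by apply: measurable_funTS; exact: measurable_int ig.
    + by rewrite disj_set2E setICr.
  - move=> F mF tF F0; rewrite integral_bigcup//.
      by rewrite eseries0.
    by apply: integrableS ig => //; exact: bigcup_measurable.
have := @integral_ae_eq _ _ _ mu setT measurableT (cst 0%E) (fun x => (g x)%:E) ig
  (measurable_cst _).
case=> [E _ mE|N [mN N0 sN]]; first by rewrite all0// integral0.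
exists N; split => // x /= nx; apply: sN => /= h; apply: nx.
by have := h I => -[].
Qed.

(** All Fourier coefficients of [r * G] vanish, with [G] bounded by 1. Keeping every frequency [k],
    and not only 0, makes the property stable under multiplication of [G] by trigonometric
    polynomials. *)
Definition annihilates (r G : fnT R n) : Prop :=
  [/\ cmeas G, forall x, cabs (G x) <= 1 & forall k,
    cint (fun x => r x * chr R k x * G x) = 0].

(* The Fejer means of the indicator of a ray are trigonometric polynomials that
   converge to it boundedly and almost everywhere. *)
Lemma annihilates_ray (r G : fnT R n) j a : Lone r -> annihilates r G ->
  annihilates r (fun x => G x * cind (ray j a) x).
Proof.
move=> lr [mG G1 Gk]; have [mr _] := lr.
have mR : cmeas (cind (ray j a)) by apply: cmeas_cind; exact: measurable_ray.
split; first exact: cmeasM.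
  move=> x; rewrite cabsM -[leRHS](mulr1 1) ler_pM ?cabs_ge0//; exact: cabs_cind.
move=> k; pose phi : fnT R 1 := cind (ray ord0 a).
pose q N x := fejer N phi [tuple tnth x j | _ < 1].
have qE N : q N = fun x => (fejer_cst R 1 N)%:C * \sum_(b : {ffun 'I_1 -> 'I_N.+1})
    \sum_(c : {ffun 'I_1 -> 'I_N.+1})
     fourier phi (dvec b c) * chr R (single j (tnth (dvec b c) ord0)) x.
  apply/funext => x; rewrite /q /fejer; congr (_ * _).
  by apply: eq_bigr => b _; apply: eq_bigr => c _; rewrite chr_lift1.
have mq N : cmeas (q N).
  rewrite qE; apply: L2_cmeas; apply: L2Z; apply: L2_sum => b; apply: L2_sum => c.
  by apply: L2Z; exact: L2_chr.
have q1 N x : cabs (q N x) <= 1.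
  apply: cabs_fejer_le; last by move=> t; exact: cabs_cind.
  by apply: cmeas_cind; exact: measurable_ray.
have base (l : n.-tuple int) : Lone (fun x => r x * chr R l x * G x).
  apply: (@Lone_mulb _ _ 1) => //; apply: (@Lone_mulb _ _ 1) => //; first exact: cmeas_chr.
  by move=> x; rewrite cabs_chr.
pose F N x := r x * chr R k x * G x * q N x.
have F0 N : cint (F N) = 0.
  rewrite /F qE; under eq_fun => x.
    rewrite mulrCA mulr_sumr; under eq_bigr => b _.
      rewrite mulr_sumr; under eq_bigr => c _.
        rewrite mulrCA (_ : r x * chr R k x * G x * _ =
           r x * chr R (kadd k (single j (tnth (dvec b c) ord0))) x * G x); last first.
          by rewrite chr_kadd; ring.
        over.
      over.
    over.
  rewrite cintZ; last first.
    by apply: Lone_sum => b _; apply: Lone_sum => c _; apply: LoneZ; exact: base.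
  rewrite cint_sum2; last by move=> b c; apply: LoneZ; exact: base.
  rewrite big1 ?mulr0// => b _; rewrite big1// => c _.
  by rewrite cintZ ?Gk ?mulr0//; exact: base.
have mB : cmeas (fun x => r x * chr R k x * G x) by case: (base k).
have cvg := @cint_dct R n r F (fun x => r x * chr R k x * (G x * cind (ray j a) x)) lr.
have {}cvg : cabs (cint (F N) - cint (fun x => r x * chr R k x * (G x * cind (ray j a)
  x))) @[N --> \oo] --> 0.
  apply: cvg.
  - by move=> N; exact: cmeasM.
  - apply: cmeasM; last exact: cmeasM.
    by apply: cmeasM => //; exact: cmeas_chr.
  - move=> N x; rewrite /F (cabsM _ (q N x)) (cabsM _ (G x)) (cabsM (r x)) cabs_chr
    mulr1 -mulrA.
    by rewrite ler_piMr ?cabs_ge0// mulr_ile1 ?cabs_ge0 ?q1.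
  - move=> x; rewrite !cabsM cabs_chr mulr1.
    by rewrite ler_piMr ?cabs_ge0// mulr_ile1 ?cabs_ge0// cabs_cind.
  - apply: filterS (ae_tnth j a) => x [x0 x1 xa].
    have e N : F N x - r x * chr R k x * (G x * cind (ray j a) x) =
        r x * chr R k x * G x * (fejer N phi [tuple tnth x j | _ < 1] - phi [tuple tnth
          x j | _ < 1]).
      by rewrite /F /q /phi !rayE tnth_mktuple; ring.
    under eq_fun do rewrite e cabsM.
    have c0 : cabs (fejer N phi [tuple tnth x j | _ < 1] - phi [tuple tnth x j | _ < 1])
        @[N --> \oo] --> 0 by apply: fejer_ray_cvg; rewrite tnth_mktuple.
    have := cvgM (cvg_cst (cabs (r x * chr R k x * G x))) c0.
    by rewrite mulr0; apply.
move: cvg; under eq_fun do rewrite F0 sub0r cabsN.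
by move=> /(cvg_unique _ (cvg_cst _)) c0; apply: cabs_eq0; exact: c0.
Qed.

(** Starting from [G = 1], the factors of a box are multiplied in one ray at a time, so [r]
    integrates to 0 over every box; the real and imaginary parts are then treated separately. *)
Lemma fourier_unique (r : fnT R n) : Lone r ->
  (forall k, cint (fun x => r x * chr R k x) = 0) -> {ae mu, forall x, r x = 0}.
Proof.
move=> lr rk.
have box s : annihilates r (cind (boxes s)).
  elim: s => [|[j a] s IH].
    split; first exact: (cmeas_cind (measurable_boxes [::])).
      by move=> x; exact: cabs_cind.
    move=> k; rewrite -[RHS](rk k); congr cint; apply/funext => x.
    by rewrite /cind /boxes big_nil indicT mulr1.
  have := annihilates_ray j a lr IH.
  congr annihilates; apply/funext => x.
  by rewrite /cind /boxes big_cons -rmorphM/= indicI mulrC.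
have b0 s : cint (fun x => r x * cind (boxes s) x) = 0.
  have [_ _ /(_ (k0 n)) <-] := box s; congr cint; apply/funext => x.
  by rewrite chr_k0 mulr1.
have lb s : Lone (fun x => r x * cind (boxes s) x).
  by apply: (@Lone_mulb _ _ 1) => // [|x];
    [exact: (cmeas_cind (measurable_boxes s))|exact: cabs_cind].
have rz : {ae mu, forall x, complex.Re (r x) = 0}.
  apply: integral_boxes_ae0 => [|s]; first exact: Lone_Re.
  have := congr1 (@complex.Re R) (b0 s); rewrite cintE//= /Rintegral => h.
  rewrite -[LHS]fineK; last first.
    apply: (integrable_fin_num (measurable_boxes s)).
    by apply: integrableS (Lone_Re lr) => //; exact: measurable_boxes.
  congr (_%:E); rewrite -[RHS]h [in LHS]integral_mkcond; congr fine;
    apply: eq_integral => x _.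
  rewrite patchE /cind ReM/= mulr0 subr0 indicE.
  by case: (x \in _); rewrite ?mulr1 ?mulr0.
have iz : {ae mu, forall x, complex.Im (r x) = 0}.
  apply: integral_boxes_ae0 => [|s]; first exact: Lone_Im.
  have := congr1 (@complex.Im R) (b0 s); rewrite cintE//= /Rintegral => h.
  rewrite -[LHS]fineK; last first.
    apply: (integrable_fin_num (measurable_boxes s)).
    by apply: integrableS (Lone_Im lr) => //; exact: measurable_boxes.
  congr (_%:E); rewrite -[RHS]h [in LHS]integral_mkcond; congr fine;
    apply: eq_integral => x _.
  rewrite patchE /cind ImM/= mulr0 add0r indicE.
  by case: (x \in _); rewrite ?mulr1 ?mulr0.
by apply: filterS2 rz iz => x hr hi; apply: complex_ext.
Qed.

Lemma l2closed_l2eq (S : set (fnT R n)) f g : l2closed S -> S g -> L2 f ->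
  l2eq g f -> S f.
Proof.
move=> clS Sg lf gf; apply: (clS (fun=> g)) => //.
by rewrite gf; exact: cvg_cst.
Qed.

(** The residual of the projection onto [S] is orthogonal to every character, hence null. A property
    that defines a closed subspace may therefore be checked on characters. *)
Lemma total_characters (S : set (fnT R n)) : S `<=` @L2 R n -> lin_subspace S ->
  l2closed S -> (forall k, S (chr R k)) -> @L2 R n `<=` S.
Proof.
move=> SL linS clS Sc f lf; have [g Sg gh] := proj_exists SL linS clS lf.
have lg := SL _ Sg; apply: (l2closed_l2eq clS Sg lf).
have lr := L2B lf lg.
have r0 : {ae mu, forall x, f x - g x = 0}.
  apply: fourier_unique; first exact: L2_Lone.
  move=> k; rewrite -[RHS](gh _ (Sc (kopp k))); congr cint; apply/funext => x.
  by rewrite chr_kopp conjCK.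
apply: ae_sqnorm0; first by apply: L2_cmeas; exact: L2B.
by apply: filterS r0 => x /eqP; rewrite subr_eq0 => /eqP ->; rewrite subrr.
Qed.

End Uniqueness.

(** * Weak convergence of multiplication by Fejer means *)

Section WeakConvergence.
Variables (R : realType) (n : nat).
Implicit Types (F G f g phi : fnT R n) (x : n.-tuple R).
Local Notation mu := (torus_measure R n).

Lemma cvg0_epsP (u : nat -> R) : (forall N, 0 <= u N) ->
  (forall e, 0 < e -> \forall N \near \oo, u N <= e) -> u @ \oo --> 0.
Proof.
move=> u0 ue; apply/cvgr0Pnorm_le => e e0; apply: filterS (ue e e0) => N.
by rewrite ger0_norm.
Qed.

Lemma nrm_cvg0 (u : nat -> fnT R n) F : (forall k, L2 (u k)) -> L2 F ->
  (sqnorm (fun x => u k x - F x) @[k --> \oo] --> 0%E) ->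
  nrm (fun x => u k x - F x) @[k --> \oo] --> 0.
Proof.
move=> lu lF h; have -> : 0 = Num.sqrt (fine (0 : \bar R)) :> R by rewrite sqrtr0.
exact: (cvg_comp _ _ (fine_cvg h) (@sqrt_continuous R _)).
Qed.

(** The [B N] behave as seminorms with a bound [M * nrm] independent of [N], so the functions on
    which they tend to 0 form a closed subspace, and the characters suffice. *)
Lemma null_on_characters (B : nat -> fnT R n -> R) (M : R) : 0 <= M ->
  (forall N f, 0 <= B N f) ->
  (forall N f g, L2 f -> L2 g -> B N (fun x => f x + g x) <= B N f + B N g) ->
  (forall N (a : R[i]) f, L2 f -> B N (fun x => a * f x) <= cabs a * B N f) ->
  (forall N f, L2 f -> B N f <= M * nrm f) ->
  (forall k, B N (chr R k) @[N --> \oo] --> 0) ->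
  forall f, L2 f -> B N f @[N --> \oo] --> 0.
Proof.
move=> M0 B0 BD BZ BM Bk f lf.
pose S := [set f | L2 f /\ B N f @[N --> \oo] --> 0].
suff : S f by case.
apply: (@total_characters R n S) => //.
- by move=> g [].
- split.
    split; first exact: L2_cst.
    apply: (@squeeze_cvgr _ _ _ _ (cst 0) (cst 0)); [|exact: cvg_cst..].
    apply: nearW => N /=; rewrite B0/=.
    by have := BZ N 0 _ (L2_cst n 0); rewrite cabs0 !mul0r.
  split=> [g h [lg Bg] [lh Bh]|a g [lg Bg]]; split; [exact: L2D| |exact: L2Z|].
  + apply: (@squeeze_cvgr _ _ _ _ (cst 0) (fun N => B N g + B N h)); [|exact: cvg_cst|].
      by apply: nearW => N /=; rewrite B0 BD.
    by rewrite -[X in _ --> X](addr0 0); apply: cvgD.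
  + apply: (@squeeze_cvgr _ _ _ _ (cst 0) (fun N => cabs a * B N g)); [|exact: cvg_cst|].
      by apply: nearW => N /=; rewrite B0 BZ.
    by rewrite -[X in _ --> X](mulr0 (cabs a)); apply: cvgM => //; exact: cvg_cst.
- move=> u F uS lF uF; split => //.
  have lu k : L2 (u k) by case: (uS k).
  have nu := nrm_cvg0 lu lF uF.
  apply: cvg0_epsP => // e e0.
  (* Half of [e] is kept for the approximant [u k0], half for the remainder, which is multiplied by
     at most [M]; [M + 1] avoids a division by 0. *)
  have d0 : 0 < e / 2 / (M + 1) by rewrite !divr_gt0// ltr_wpDl.
  have [k0 _ hk] : \forall k \near \oo, nrm (fun x => u k x - F x) <= e / 2 / (M + 1).
    by have /cvgr0Pnorm_le/(_ _ d0) := nu; apply: filterS => k; rewrite ger0_norm ?nrm_ge0.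
  have [_ Bu] := uS k0.
  have /cvgr0Pnorm_le/(_ (e / 2)) := Bu; rewrite divr_gt0// => /(_ isT).
  apply: filterS => N; rewrite ger0_norm// => hN.
  have lB := L2B (lu k0) lF.
  have -> : F = (fun x => u k0 x + (-1) * (u k0 x - F x)).
    by apply/funext => x; ring.
  apply: le_trans (BD _ _ _ (lu k0) (L2Z _ lB)) _.
  have h1 := BZ N (-1) _ lB; rewrite cabsN cabs1 mul1r in h1.
  have h2 := BM N _ lB.
  have h3 := hk k0 (leqnn k0).
  have h4 : M * nrm (fun x => u k0 x - F x) <= e / 2.
    apply: (@le_trans _ _ ((M + 1) * (e / 2 / (M + 1)))).
      by apply: ler_pM => //; rewrite ?nrm_ge0// lerDl.
    by rewrite mulrC divfK// gt_eqF// ltr_wpDl.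
  lra.
- by move=> k; split; [exact: L2_chr|exact: Bk].
Qed.

Lemma nrm_mulb (c : R) H f : 0 <= c -> cmeas H -> (forall x, cabs (H x) <= c) -> L2 f ->
  nrm (fun x => H x * f x) <= c * nrm f.
Proof.
move=> c0 mH Hc lf; have lH := L2_mulb mH Hc lf.
rewrite -ler_sqr ?nnegrE ?mulr_ge0 ?nrm_ge0// exprMn !sqr_nrm//.
have -> : c ^+ 2 * nsq f = nsq (fun x => c%:C * f x).
  by rewrite nsqZ// cabs_real -normrX ger0_norm ?sqr_ge0.
rewrite -lee_fin -!sqnormK//; last exact: L2Z.
apply: sqnorm_le; [exact: L2_cmeas|exact: L2_cmeas (L2Z _ lf)|].
by move=> x; rewrite !cabsM cabs_real (ger0_norm c0) ler_wpM2r ?cabs_ge0.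
Qed.

Variable phi : fnT R n.
Hypotheses (mphi : cmeas phi) (phi1 : forall x, cabs (phi x) <= 1).

Let lphi : L2 phi. Proof. exact: L2_bounded phi1. Qed.
Let h N : fnT R n := fun x => fejer N phi x - phi x.
Let lh N : L2 (h N). Proof. by apply: L2B => //; exact: L2_fejer. Qed.
Let h2 N x : cabs (h N x) <= 2.
Proof.
apply: le_trans (cabsB _ _) _.
have := cabs_fejer_le N x mphi phi1; have := phi1 x; lra.
Qed.
Let lhf N f : L2 f -> L2 (fun x => h N x * f x).
Proof. by apply: (@L2_mulb _ _ 2) => //; exact: L2_cmeas (lh N). Qed.
Let nhf N f : L2 f -> nrm (fun x => h N x * f x) <= 2 * nrm f.
Proof. by apply: nrm_mulb => //; exact: L2_cmeas (lh N). Qed.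

Let weak_chr k m : cabs (inner (fun x => h N x * chr R k x) (chr R m)) @[N --> \oo] --> 0.
Proof.
pose d := kadd m (kopp k).
have e N : cabs (inner (fun x => h N x * chr R k x) (chr R m)) =
    `|fejer_coef R N d - 1| * cabs (fourier phi d).
  have -> : inner (fun x => h N x * chr R k x) (chr R m) = inner (h N) (chr R d).
    congr cint; apply/funext => x; rewrite chr_kadd chr_kopp conjcM conjCK; ring.
  rewrite innerBl//; [|exact: L2_fejer|exact: L2_chr].
  rewrite -!fourierE fourier_fejer -cabs_real -cabsM rmorphB/= rmorph1.
  by congr cabs; ring.
under eq_fun do rewrite e.
have c0 : (fejer_coef R N d - 1) @[N --> \oo] --> 0.
  by have := cvgB (fejer_coef_cvg d) (cvg_cst (1 : R)); rewrite subrr; apply.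
have := cvgM (cvg_norm c0) (cvg_cst (cabs (fourier phi d))).
by rewrite normr0 mul0r; apply.
Qed.

(** On two characters the pairing is a Fourier coefficient of [phi] times a multiplier minus 1. As
    [h N] is bounded by 2 for all [N], the limit extends to [L^2] in one slot at a time: [g] with
    [f] a character, then [f]. *)
Lemma weak_fejer f g : L2 f -> L2 g ->
  cabs (inner (fun x => h N x * f x) g) @[N --> \oo] --> 0.
Proof.
move=> lf lg; have lc (k : n.-tuple int) := L2_chr R k.
have inner_mulD N f1 f2 g1 : L2 f1 -> L2 f2 -> L2 g1 ->
    inner (fun x => h N x * (f1 x + f2 x)) g1 =
    inner (fun x => h N x * f1 x) g1 + inner (fun x => h N x * f2 x) g1.
  move=> l1 l2 l3; rewrite -innerDl//; [|exact: lhf|exact: lhf].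
  by congr inner; apply/funext => x; rewrite mulrDr.
have inner_mulZ N (a : R[i]) f1 g1 : L2 f1 -> L2 g1 ->
    inner (fun x => h N x * (a * f1 x)) g1 = a * inner (fun x => h N x * f1 x) g1.
  move=> l1 l3; rewrite -innerZl//; last exact: lhf.
  by congr inner; apply/funext => x; rewrite mulrCA.
have step k : cabs (inner (fun x => h N x * chr R k x) g) @[N --> \oo] --> 0.
  apply: (@null_on_characters (fun N g => cabs (inner (fun x => h N x * chr R k x) g))
     (2 * nrm (chr R k))) => //.
  - by rewrite mulr_ge0 ?nrm_ge0.
  - by move=> N f1; exact: cabs_ge0.
  - by move=> N f1 f2 l1 l2; rewrite innerDr//; [exact: cabsD|exact: lhf].
  - by move=> N a f1 l1; rewrite innerZr//; [rewrite cabsM cabs_conj|exact: lhf].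
  - move=> N f1 l1; apply: le_trans (cabs_inner_le (lhf N (lc k)) l1) _.
    by rewrite ler_wpM2r ?nrm_ge0// nhf.
apply: (@null_on_characters (fun N f => cabs (inner (fun x => h N x * f x) g)) (2 * nrm
  g)) => //.
- by rewrite mulr_ge0 ?nrm_ge0.
- by move=> N f1; exact: cabs_ge0.
- by move=> N f1 f2 l1 l2; rewrite inner_mulD// cabsD.
- by move=> N a f1 l1; rewrite inner_mulZ// cabsM.
- move=> N f1 l1 /=; apply: le_trans (cabs_inner_le (lhf N l1) lg) _.
  by rewrite mulrAC ler_wpM2r ?nrm_ge0// nhf.
Qed.

(* The Fejer means of [phi] are bounded by 1 and only involve frequencies of the
   spectrum of [phi]; boundedness is what allows [f * g^*] to be merely integrable. *)
Lemma inner_mul_spectral0 f g : L2 f -> L2 g ->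
  (forall k, fourier phi k <> 0 -> inner (fun x => chr R k x * f x) g = 0) ->
  inner (fun x => phi x * f x) g = 0.
Proof.
move=> lf lg fg0.
have lcf k : L2 (fun x => chr R k x * f x).
  by apply: (@L2_mulb _ _ 1) => //; [exact: cmeas_chr|move=> x; rewrite cabs_chr].
have lpf : L2 (fun x => phi x * f x) by exact: (@L2_mulb _ _ 1).
have lFf N : L2 (fun x => fejer N phi x * f x).
  apply: (@L2_mulb _ _ 1) => //; first by apply: L2_cmeas; exact: L2_fejer.
  by move=> x; exact: cabs_fejer_le.
have F0 N : inner (fun x => fejer N phi x * f x) g = 0.
  rewrite /inner /fejer; under eq_fun => x.
    rewrite -!mulrA mulr_suml; under eq_bigr do rewrite mulr_suml.
    over.
  have l1 (a b : {ffun 'I_n -> 'I_N.+1}) :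
      Lone (fun x => fourier phi (dvec a b) * chr R (dvec a b) x * (f x * (g x)^*)).
    under eq_fun do rewrite -mulrA [X in _ * X]mulrA.
    by apply: LoneZ; exact: L2_innerL (lcf _) lg.
  rewrite cintZ; last by apply: Lone_sum => a _; apply: Lone_sum => b _; exact: l1.
  rewrite cint_sum2// big1 ?mulr0// => a _; rewrite big1// => b _.
  under eq_fun do rewrite -mulrA [X in _ * X]mulrA.
  rewrite cintZ; last exact: L2_innerL (lcf _) lg.
  have [->|/eqP/fg0 e] := eqVneq (fourier phi (dvec a b)) 0; first by rewrite mul0r.
  by move: e; rewrite /inner => ->; rewrite mulr0.
have e N : inner (fun x => h N x * f x) g = - inner (fun x => phi x * f x) g.
  rewrite (_ : (fun _ => _) = fun x => fejer N phi x * f x - phi x * f x); last first.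
    by apply/funext => x; rewrite mulrBl.
  by rewrite innerBl// F0 sub0r.
have := weak_fejer lf lg; under eq_fun do rewrite e cabsN.
by move=> /(cvg_unique _ (cvg_cst _)) c0; apply: cabs_eq0; exact: c0.
Qed.

End WeakConvergence.

(** * Hahn-Banach and duality *)

Section HahnBanach.
Variables (R : realType) (n : nat).
Implicit Types (f g h : fnT R n) (A B : set (fnT R n * R)).
Variable p : fnT R n -> R.
Hypothesis pD : forall f g, L2 f -> L2 g -> p (fun x => f x + g x) <= p f + p g.
Hypothesis pZ : forall (t : R) f, 0 <= t -> L2 f -> p (fun x => t%:C * f x) = t * p f.

(* Partial real-linear functionals are handled through their graphs. *)
Definition lin_graph A : Prop := forall f a g b (t : R), A (f, a) -> A (g, b) ->
  A (fun x => f x + t%:C * g x, a + t * b).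
Definition dominated_graph A : Prop := forall f a, A (f, a) -> L2 f /\ a <= p f.

Lemma lin_graph0 A : lin_graph A -> A !=set0 -> A (fun=> 0, 0).
Proof.
move=> linA [[f a] Af]; have := linA _ _ _ _ (-1) Af Af.
rewrite mulN1r subrr (_ : (fun _ => _) = fun=> 0)//.
by apply/funext => x; rewrite rmorphN1 mulN1r subrr.
Qed.

Lemma lin_graphZ A f a (t : R) : lin_graph A -> A (f, a) ->
  A (fun x => t%:C * f x, t * a).
Proof.
move=> linA Af; have A0 := lin_graph0 linA (ex_intro _ _ Af).
have := linA _ _ _ _ t A0 Af; rewrite add0r (_ : (fun _ => _) = fun x => t%:C * f x)//.
by apply/funext => x; rewrite add0r.
Qed.

(** Two values at [f] differ by a value at 0, which domination bounds by [p 0 = 0]; both orders give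
    equality. *)
Lemma graph_functional A f a b : lin_graph A -> dominated_graph A ->
  A (f, a) -> A (f, b) -> a = b.
Proof.
move=> linA domA Aa Ab.
have p0 : p (fun=> 0) = 0.
  rewrite -[RHS](mul0r (p (fun=> 0))) -(pZ (lexx 0) (L2_cst n 0)); congr p.
  by apply/funext => x; rewrite mulr0.
have key c d : A (f, c) -> A (f, d) -> c <= d.
  move=> Ac Ad; have := linA _ _ _ _ (-1) Ac Ad.
  rewrite (_ : (fun _ => _) = fun=> 0); last by apply/funext => x;
    rewrite rmorphN1 mulN1r subrr.
  by move=> /domA[_]; rewrite p0; lra.
by apply/eqP; rewrite eq_le !key.
Qed.

(** The value [c] at [f0] has to lie above all [a - p (f - f0)] and below all [p (g + f0) - b].
    Subadditivity puts the lower bounds under the upper ones, so their supremum serves; other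
    multiples of [f0] reduce to these two cases by positive homogeneity. *)
Lemma graph_extend A f0 : lin_graph A -> dominated_graph A -> A !=set0 -> L2 f0 ->
  exists c : R, dominated_graph
    [set v | exists f a t, A (f, a) /\ v = (fun x => f x + t%:C * f0 x, a + t * c)].
Proof.
move=> linA domA A0 l0.
pose L := [set r | exists f a, A (f, a) /\ r = a - p (fun x => f x - f0 x)].
have Lne : L !=set0 by case: A0 => -[f a] Af; exists (a - p (fun x => f x - f0 x)), f, a.
have LU r g b : L r -> A (g, b) -> r <= p (fun x => g x + f0 x) - b.
  move=> [f [a [Af ->]]] Ag; have [lf _] := domA _ _ Af; have [lg _] := domA _ _ Ag.
  have [_] := domA _ _ (linA _ _ _ _ 1 Af Ag).
  have := pD (L2B lf l0) (L2D lg l0).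
  rewrite (_ : (fun x => f x - f0 x + (g x + f0 x)) = fun x => f x + (1 : R)%:C * g x);
    last first.
    by apply/funext => x; rewrite rmorph1; ring.
  lra.
have hL : has_sup L.
  split => //; case: A0 => -[g b] Ag; exists (p (fun x => g x + f0 x) - b) => r Lr.
  exact: LU.
exists (sup L) => _ _ [f [a [t [Af [-> ->]]]]]; have [lf fa] := domA _ _ Af.
split; first by apply: L2D => //; exact: L2Z.
have [t0|t0|->] := ltrgtP t 0; last first.
- rewrite mul0r addr0 (_ : (fun _ => _) = f)//.
  by apply/funext => x; rewrite mul0r addr0.
- have Ag := lin_graphZ t^-1 linA Af.
  have cle : sup L <= p (fun x => t^-1%:C * f x + f0 x) - t^-1 * a.
    by apply: ge_sup => // r Lr; exact: LU Ag.
  have -> : (fun x => f x + t%:C * f0 x) = (fun x => t%:C * (t^-1%:C * f x + f0 x)).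
    apply/funext => x; rewrite mulrDr mulrA -rmorphM/= mulfV ?gt_eqF//.
    by rewrite rmorph1 mul1r.
  rewrite pZ; [|exact: ltW|by apply: L2D => //; exact: L2Z].
  have -> : a = t * (t^-1 * a) by rewrite mulrA mulfV ?gt_eqF// mul1r.
  by rewrite -mulrDr ler_pM2l//; lra.
- have s0 : 0 < - t by lra.
  have sn : - t != 0 by rewrite gt_eqF.
  have Ag := lin_graphZ (- t)^-1 linA Af.
  have cge : (- t)^-1 * a - p (fun x => (- t)^-1%:C * f x - f0 x) <= sup L.
    by apply: ub_le_sup; [case: hL|exists (fun x => (- t)^-1%:C * f x), ((- t)^-1 * a)].
  have -> : (fun x => f x + t%:C * f0 x) = (fun x => (- t)%:C * ((- t)^-1%:C * f x - f0 x)).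
    apply/funext => x; rewrite mulrBr mulrA -rmorphM/= mulfV//.
    by rewrite rmorph1 mul1r rmorphN mulNr opprK.
  rewrite pZ; [|exact: ltW|by apply: L2B => //; exact: L2Z].
  have -> : a + t * sup L = - t * ((- t)^-1 * a - sup L).
    by rewrite mulrBr mulrA mulfV// mul1r; ring.
  by rewrite ler_pM2l//; lra.
Qed.

Lemma hahn_banach A : lin_graph A -> dominated_graph A -> A !=set0 ->
  exists u : fnT R n -> R,
    [/\ forall f g (t : R), L2 f -> L2 g -> u (fun x => f x + t%:C * g x) = u f + t * u g,
        forall f, L2 f -> u f <= p f & forall f a, A (f, a) -> u f = a].
Proof.
move=> linA domA A0.
(* The empty graph must satisfy [P], being the union of the empty chain; this is why only nonempty
   graphs have to contain [A]. A maximal graph is nonempty because [A] itself extends the empty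
   one. *)
pose P B := [/\ lin_graph B, dominated_graph B & B !=set0 -> A `<=` B].
have [F FP totF|M [[linM domM AM] Mmax]] := @Zorn_bigcup _ P.
  split.
  - move=> f a g b t [B1 FB1 B1f] [B2 FB2 B2g].
    have [B12|B21] := totF _ _ FB1 FB2.
      by exists B2 => //; have [lin2 _ _] := FP _ FB2; apply: lin2 => //; exact: B12.
    by exists B1 => //; have [lin1 _ _] := FP _ FB1; apply: lin1 => //; exact: B21.
  - by move=> f a [B FB Bf]; have [_ dom _] := FP _ FB; exact: dom.
  - move=> [v [B FB Bv]] w Aw; exists B => //; have [_ _ sub] := FP _ FB.
    by apply: sub Aw; exists v.
have M0 : M !=set0.
  apply/set0P/eqP => M0; apply: (Mmax A); last by split => // _; exact: subset_refl.
  rewrite M0; split; first exact: sub0set.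
  by case: A0 => v Av /(_ _ Av).
have {}AM := AM M0.
have tot f : L2 f -> exists a, M (f, a).
  move=> lf; apply: contrapT => nf.
  have [c domB] := graph_extend linM domM M0 lf.
  set B := (X in dominated_graph X) in domB.
  have MB : M `<=` B.
    move=> [g a] Mg; exists g, a, 0; split => //.
    rewrite mul0r addr0; congr pair; apply/funext => x.
    by rewrite mul0r addr0.
  have Bf : B (f, c).
    exists (fun=> 0), 0, 1; split; first exact: lin_graph0.
    rewrite mul1r add0r; congr pair; apply/funext => x.
    by rewrite rmorph1 mul1r add0r.
  apply: (Mmax B).
    by split => // /(_ _ Bf) Mf; apply: nf; exists c.
  split => //.
  - move=> _ _ _ _ t [g1 [a1 [t1 [M1 [-> ->]]]]] [g2 [a2 [t2 [M2 [-> ->]]]]].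
    exists (fun x => g1 x + t%:C * g2 x), (a1 + t * a2), (t1 + t * t2); split.
      exact: linM.
    congr pair; last by ring.
    by apply/funext => x; rewrite rmorphD rmorphM/=; ring.
  - by move=> _; exact: subset_trans AM MB.
have [u hu] : exists u : fnT R n -> R, forall f, L2 f -> M (f, u f).
  have h f : exists a, L2 f -> M (f, a).
    by have [/tot[a Ma]|nf] := pselect (L2 f); [exists a|exists 0].
  by have [u hu] := choice h; exists u.
have fM := @graph_functional M.
exists u; split.
- move=> f g t lf lg; apply: (fM _ _ _ linM domM (hu _ _)).
    by apply: L2D => //; exact: L2Z.
  by apply: linM; exact: hu.
- by move=> f /hu /domM[].
- move=> f a Af; have [lf _] := domA _ _ Af.
  by apply: (fM _ _ _ linM domM (hu _ lf)); exact: AM.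
Qed.

End HahnBanach.

(** * Representation of functionals dominated by the [L^1] norm *)

Section DualElement.
Variables (R : realType) (n : nat).
Implicit Types (f g h phi : fnT R n).
Local Notation mu := (torus_measure R n).
Local Notation ci := ((0 : R) +i* (1 : R)).

(** [La f = u f - i u (i f)] is the complex-linear functional with real part [u]. The residual [r]
    of [f0] off its closed kernel is orthogonal to that kernel, and [La] is the inner product with a
    multiple of [r]. *)
Lemma riesz_real (u : fnT R n -> R) f0 :
  (forall f g (t : R), L2 f -> L2 g -> u (fun x => f x + t%:C * g x) = u f + t * u g) ->
  (forall f, L2 f -> u f <= nrm f) -> L2 f0 -> u f0 != 0 ->
  exists2 phi, L2 phi & forall f, L2 f -> u f = complex.Re (cint (fun x => phi x * f x)).
Proof.
move=> ulin ule l0 u0.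
have uD f g : L2 f -> L2 g -> u (fun x => f x + g x) = u f + u g.
  move=> lf lg; rewrite -[in RHS](mul1r (u g)) -ulin//; congr u; apply/funext => x.
  by rewrite rmorph1 mul1r.
have uz : u (fun=> 0) = 0.
  have := uD _ _ (L2_cst n 0) (L2_cst n 0); rewrite addr0 => /eqP.
  by rewrite -subr_eq subrr eq_sym => /eqP.
have uZ (t : R) f : L2 f -> u (fun x => t%:C * f x) = t * u f.
  move=> lf; have := ulin _ _ t (L2_cst n 0) lf; rewrite uz add0r => <-.
  by congr u; apply/funext => x; rewrite add0r.
have uN f : L2 f -> u (fun x => - f x) = - u f.
  move=> lf; rewrite -mulN1r -uZ//; congr u; apply/funext => x.
  by rewrite rmorphN1 mulN1r.
pose La f : R[i] := u f +i* (- u (fun x => ci * f x)).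
have LaD f g : L2 f -> L2 g -> La (fun x => f x + g x) = La f + La g.
  move=> lf lg; apply: complex_ext; rewrite ?ReD ?ImD /= ?uD//.
  rewrite -opprD -uD; [|exact: L2Z|exact: L2Z]; congr (- u _).
  by apply/funext => x; rewrite mulrDr.
have LaZ (c : R[i]) f : L2 f -> La (fun x => c * f x) = c * La f.
  case: c => a b lf; have lif := L2Z ci lf.
  have e1 : u (fun x => (a +i* b) * f x) = a * u f + b * u (fun x => ci * f x).
    rewrite -!uZ// -uD; [|exact: L2Z|exact: L2Z]; congr u; apply/funext => x.
    by rewrite mulrA -mulrDl; congr (_ * _); apply: complex_ext;
      rewrite ?ReD ?ImD ?ReM ?ImM/=; ring.
  have e2 : u (fun x => ci * ((a +i* b) * f x)) = a * u (fun x => ci * f x) - b * u f.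
    rewrite -!uZ// -uN; last exact: L2Z.
    rewrite -uD; [|exact: L2Z|by apply: L2N; exact: L2Z]; congr u; apply/funext => x.
    rewrite !mulrA -mulNr -mulrDl; congr (_ * _).
    by apply: complex_ext; rewrite ?ReD ?ImD ?ReN ?ImN ?ReM ?ImM/=; ring.
  by apply: complex_ext; rewrite ?ReM ?ImM /= ?e1 ?e2; ring.
have uabs f : L2 f -> `|u f| <= nrm f.
  move=> lf; rewrite ler_norml ule// andbT lerNl -uN//.
  apply: le_trans (ule _ (L2N lf)) _.
  have := nrm_mulb ler01 (@cmeas_cst R n (-1)) _ lf.
  rewrite mul1r (_ : (fun x => -1 * f x) = fun x => - f x).
    by apply => x; rewrite cabsN cabs1.
  by apply/funext => x; rewrite mulN1r.
have Lale f : L2 f -> cabs (La f) <= 2 * nrm f.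
  move=> lf; have lif := L2Z ci lf.
  have h : cabs (La f) <= `|u f| + `|u (fun x => ci * f x)|.
    have -> : La f = (u f)%:C + ci * (- u (fun x => ci * f x))%:C.
      by apply: complex_ext; rewrite ?ReD ?ImD ?ReM ?ImM/=; ring.
    apply: le_trans (cabsD _ _) _; rewrite cabsM !cabs_real normrN.
    by rewrite {1}/cabs/= expr0n/= add0r expr1n sqrtr1 mul1r.
  have h1 := uabs _ lf; have h2 := uabs _ lif.
  have h3 : nrm (fun x => ci * f x) <= 1 * nrm f.
    apply: (@nrm_mulb R n 1 (fun=> ci)) => // x.
    by rewrite /cabs/= expr0n/= add0r expr1n sqrtr1.
  lra.
have La_N1 f : L2 f -> La (fun x => - f x) = - La f.
  move=> lf; rewrite -mulN1r -LaZ//; congr La; apply/funext => x.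
  by rewrite mulN1r.
pose K := [set f | L2 f /\ La f = 0].
have linK : lin_subspace K.
  split.
    split; first exact: L2_cst.
    rewrite -[RHS](mul0r (La (fun=> 0))) -(LaZ 0 _ (L2_cst n 0)).
    by congr La; apply/funext => x; rewrite mul0r.
  split=> [f g [lf f1] [lg g1]|c f [lf f1]]; split.
  - exact: L2D.
  - by rewrite LaD// f1 g1 addr0.
  - exact: L2Z.
  - by rewrite LaZ// f1 mulr0.
have clK : l2closed K.
  move=> v F vK lF vF; split => //.
  have lv k : L2 (v k) by case: (vK k).
  have nv := nrm_cvg0 lv lF vF.
  apply: cabs_eq0; apply/eqP; rewrite eq_le cabs_ge0 andbT.
  have c2 : (2 * nrm (fun x => v k x - F x)) @[k --> \oo] --> 0.
    by have := cvgM (cvg_cst (2 : R)) nv; rewrite mulr0; apply.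
  apply: (cvgr_to_ge c2); apply: nearW => k /=.
  apply: le_trans (Lale _ (L2B (lv k) lF)).
  by rewrite LaD ?La_N1//; [have [_ ->] := vK k; rewrite sub0r cabsN|exact: L2N].
have KL : K `<=` @L2 R n by move=> f [].
have [g Kg gh] := proj_exists KL linK clK l0.
have [lg g1] := Kg.
pose r x := f0 x - g x.
have lr : L2 r by exact: L2B.
have Lar : La r = La f0 by rewrite /r LaD ?La_N1 ?g1 ?oppr0 ?addr0//; exact: L2N.
have Lar0 : La r != 0.
  rewrite Lar; apply: contra u0 => /eqP/(congr1 (@complex.Re R))/= ->.
  by rewrite eqxx.
have nr0 : nsq r != 0.
  apply: contra Lar0 => /eqP n0; apply/eqP/cabs_eq0/eqP.
  rewrite eq_le cabs_ge0 andbT (le_trans (Lale _ lr))// /nrm n0 sqrtr0 mulr0//.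
pose c : R[i] := La r * (nsq r)^-1%:C.
exists (fun x => c * (r x)^*).
  by apply: L2Z; exact: L2_conj.
move=> f lf.
have -> : (fun x => c * (r x)^* * f x) = (fun x => c * (f x * (r x)^*)).
  by apply/funext => x; ring.
rewrite cintZ; last exact: L2_innerL.
(* [f - (La f / La r) r] lies in the kernel of [La], hence is orthogonal to [r]. *)
have -> : cint (fun x => f x * (r x)^*) = La f / La r * (nsq r)%:C.
  rewrite -[LHS]/(inner f r) -inner_self// -innerZl//; apply/eqP; rewrite -subr_eq0.
  rewrite -innerBl//; last exact: L2Z.
  rewrite inner_conj//; last by apply: L2B => //; exact: L2Z.
  rewrite gh ?rmorph0//.
  split; first by apply: L2B => //; exact: L2Z.
  rewrite LaD ?La_N1 ?LaZ//; [|exact: L2Z|by apply: L2N; exact: L2Z].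
  by rewrite divfK// subrr.
rewrite /c (_ : _ * _ = La f)//.
rewrite mulrACA -rmorphM/= mulVf// rmorph1 mulr1 mulrC divfK//.
Qed.

(** Testing with the conjugate of [phi] on [A], where its modulus exceeds 1, shows that the integral
    of [|phi|^2] over [A] is at most that of [|phi|], so [A] is null. Replacing [phi] by 0 on [A]
    gives the bound at every point. *)
Lemma dual_bounded phi : L2 phi ->
  (forall f, L2 f -> ((complex.Re (cint (fun x => phi x * f x)%R))%:E <= L1norm f)%E) ->
  exists phi', [/\ cmeas phi', forall x, cabs (phi' x) <= 1 &
    forall f, L2 f -> cint (fun x => phi' x * f x) = cint (fun x => phi x * f x)].
Proof.
move=> lp pf; have mp := L2_cmeas lp.
pose A := [set x | 1 < cabs (phi x)].
have mA : measurable A.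
  rewrite (_ : A = (fun x => cabs (phi x)) @^-1` `]1, +oo[); last first.
    by apply/seteqP; split => x; rewrite /A/= in_itv/= andbT.
  by rewrite -[X in measurable X]setTI; apply: (measurable_cabs mp).
have mI := cmeas_cind mA; have mIC := cmeas_cind (measurableC mA).
pose f x := cind A x * (phi x)^*.
have lf : L2 f.
  by apply: (@L2_mulb _ _ 1) => //; [move=> x; exact: cabs_cind|exact: L2_conj].
have fE x : phi x * f x = (\1_A x * cabs (phi x) ^+ 2)%:C.
  by rewrite /f /cind mulrCA mul_conj -rmorphM.
have l2 : Lone (fun x => (\1_A x * cabs (phi x) ^+ 2)%:C).
  have := L2M lp lf; congr Lone; apply/funext => x; exact: fE.
have d0 x : 0 <= \1_A x * cabs (phi x) ^+ 2 - \1_A x * cabs (phi x).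
  rewrite indicE; have [xA|_] := boolP (x \in A); last by rewrite !mul0r subrr.
  have : 1 < cabs (phi x) by move: xA; rewrite inE.
  rewrite !mul1r; nra.
have lc : Lone (fun x => (\1_A x * cabs (phi x))%:C).
  have := L2_Lone (L2_mulb mI (cabs_cind A) (L2_cabs lp)); congr Lone.
  by apply/funext => x; rewrite rmorphM.
have l3 : Lone (fun x => (\1_A x * cabs (phi x) ^+ 2 - \1_A x * cabs (phi x))%:C).
  have := LoneB l2 lc; congr Lone; apply/funext => x; by rewrite rmorphB.
have le0 : (L1norm (fun x => (\1_A x * cabs (phi x) ^+ 2 - \1_A x * cabs (phi x))%R%:C)
  <= 0)%E.
  rewrite L1norm_nonneg//.
  have -> : cint (fun x => (\1_A x * cabs (phi x) ^+ 2 - \1_A x * cabs (phi x))%:C) =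
     cint (fun x => (\1_A x * cabs (phi x) ^+ 2)%:C) - cint (fun x => (\1_A x * cabs
       (phi x))%:C).
    by rewrite -cintB//; congr cint; apply/funext => x; rewrite rmorphB.
  have := pf _ lf; under [X in cint X]eq_fun do rewrite fE.
  have -> : L1norm f = L1norm (fun x => (\1_A x * cabs (phi x))%:C).
    congr tint; apply/funext => x; congr (_%:E).
    by rewrite /f cabsM cabs_conj /cind !cabs_real normrM (ger0_norm (cabs_ge0 _)).
  rewrite L1norm_nonneg//; last by move=> x; rewrite mulr_ge0 ?cabs_ge0.
  by rewrite !lee_fin ReD ReN subr_le0.
have A0 : {ae mu, forall x, ~ A x}.
  have m3 := l3.1; have := L1norm0_ae m3.
  have -> : L1norm (fun x => (\1_A x * cabs (phi x) ^+ 2 - \1_A x * cabs (phi x))%:C) = 0%E.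
    by apply/eqP; rewrite eq_le le0 L1norm_ge0.
  move=> /(_ erefl); apply: filterS => x /(congr1 (@complex.Re R))/= h xA.
  have := xA; rewrite /A/= => x1; move: h; rewrite indicE mem_set// !mul1r; nra.
pose phi' x := cind (~` A) x * phi x.
have mp' : cmeas phi' by exact: cmeasM.
have p1 x : cabs (phi' x) <= 1.
  rewrite /phi' cabsM cabs_real indicE; have [xA|xA] := boolP (x \in ~` A).
    by rewrite normr1 mul1r leNgt; apply/negP; move: xA; rewrite inE.
  by rewrite normr0 mul0r.
exists phi'; split => // g lg; apply: cint_ae.
- by apply: L2M => //; exact: L2_bounded p1.
- exact: L2M.
apply: filterS A0 => x nA; rewrite /phi' /cind indicE mem_set//.
by rewrite mul1r.
Qed.

(** The functional to be extended sends [c g0 + h] to [Re c]. The distance hypothesis, rescaled by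
    [c], says exactly that [|c|] is at most the [L^1] norm of [c g0 + h]. *)
Lemma dual_element (M : set (fnT R n)) g0 : M `<=` @L2 R n -> lin_subspace M -> L2 g0 ->
  (forall h, M h -> (1 <= L1norm (fun x => (g0 x - h x)%R))%E) ->
  exists phi, [/\ cmeas phi, forall x, cabs (phi x) <= 1,
    forall h, M h -> cint (fun x => phi x * h x) = 0 &
    cint (fun x => phi x * g0 x) = 1].
Proof.
move=> ML linM l0 Mdist; have [Mz [MD MZ]] := linM.
pose p f : R := fine (L1norm f).
have pE f : L2 f -> (p f)%:E = L1norm f by move=> lf; rewrite L1norm_fin//; exact: L2_Lone.
have pD f g : L2 f -> L2 g -> p (fun x => f x + g x) <= p f + p g.
  move=> lf lg; rewrite -lee_fin EFinD !pE//; last exact: L2D.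
  by apply: L1normD; exact: L2_cmeas.
have pZ (t : R) f : 0 <= t -> L2 f -> p (fun x => t%:C * f x) = t * p f.
  move=> t0 lf; apply: EFin_inj; rewrite EFinM !pE//; last exact: L2Z.
  by rewrite L1normZ ?cabs_real ?ger0_norm//; exact: L2_cmeas.
pose A := [set v : fnT R n * R | exists (c : R[i]) h,
  M h /\ v = (fun x => c * g0 x + h x, complex.Re c)].
have linA : lin_graph A.
  move=> _ _ _ _ t [c1 [h1 [M1 [-> ->]]]] [c2 [h2 [M2 [-> ->]]]].
  exists (c1 + t%:C * c2), (fun x => h1 x + t%:C * h2 x); split.
    by apply: MD => //; exact: MZ.
  congr pair; last by rewrite ReD ReM/= mul0r subr0.
  by apply/funext => x; ring.
have domA : dominated_graph p A.
  move=> _ _ [c [h [Mh [-> ->]]]]; have lh := ML _ Mh.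
  have lch : L2 (fun x => c * g0 x + h x) by apply: L2D => //; exact: L2Z.
  split => //; apply: le_trans (Re_le_cabs _) _.
  rewrite -lee_fin pE//; have [c0|c0] := eqVneq c 0.
    by rewrite {1}c0 cabs0 L1norm_ge0//; exact: L2_cmeas.
  have := Mdist _ (MZ (- c^-1) _ Mh).
  have e : (fun x => c * g0 x + h x) = (fun x => c * (g0 x - (- c^-1 * h x))).
    by apply/funext => x; field.
  rewrite e L1normZ; last first.
    by apply: cmeasB; [exact: L2_cmeas|apply: cmeasZ; exact: L2_cmeas].
  move=> h1; apply: (@le_trans _ _ ((cabs c)%:E * 1)%E); first by rewrite mule1.
  by apply: lee_wpmul2l => //; rewrite lee_fin cabs_ge0.
have A0 : A !=set0 by exists (fun x => 0 * g0 x + 0, complex.Re (0 : R[i])), 0, (fun=> 0).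
have [u [ulin up uA]] := hahn_banach pD pZ linA domA A0.
have u_c (c : R[i]) : u (fun x => c * g0 x) = complex.Re c.
  apply: uA; exists c, (fun=> 0); split => //.
  by congr pair; apply/funext => x; rewrite addr0.
have u_h h : M h -> u h = 0.
  move=> Mh; apply: uA; exists 0, h; split => //.
  by congr pair; apply/funext => x; rewrite mul0r add0r.
have ug0 : u g0 = 1.
  have := u_c 1; rewrite /= => <-; congr u; apply/funext => x; by rewrite mul1r.
have unrm f : L2 f -> u f <= nrm f.
  move=> lf; apply: le_trans (up _ lf) _; rewrite -lee_fin pE//; exact: L1norm_nrm.
have u0 : u g0 != 0 by rewrite ug0 oner_neq0.
have [phi lphi uphi] := riesz_real ulin unrm l0 u0.
have pb f : L2 f -> ((complex.Re (cint (fun x => phi x * f x)%R))%:E <= L1norm f)%E.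
  by move=> lf; rewrite -uphi// -pE// lee_fin up.
have [phi' [m' b' e']] := dual_bounded lphi pb.
(* The functional [u] sees only real parts; the imaginary part of the integral at [f] is minus its
   real part at [i f]. *)
have both f (a b : R) : L2 f -> u f = a -> u (fun x => ci * f x) = - b ->
    cint (fun x => phi' x * f x) = a +i* b.
  move=> lf fa fb; rewrite e'//; apply: complex_ext; first by rewrite -uphi.
  have := uphi _ (L2Z ci lf); rewrite fb.
  have -> : (fun x => phi x * (ci * f x)) = (fun x => ci * (phi x * f x)).
    by apply/funext => x; ring.
  rewrite cintZ; last exact: L2M.
  by rewrite ReM mul0r mul1r sub0r => /oppr_inj ->.
exists phi'; split => //.
- move=> h Mh; rewrite (both _ 0 0)//; [exact: ML|exact: u_h|].
  by rewrite u_h ?oppr0//; exact: MZ.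
- by rewrite (both _ 1 0)// u_c oppr0.
Qed.

End DualElement.

(** * Quotient modules and lifting *)

Section L2Equality.
Variables (R : realType) (n : nat).
Implicit Types (F G H f g h : fnT R n).
Local Notation mu := (torus_measure R n).

Lemma sqnorm_ae F G : cmeas F -> cmeas G -> {ae mu, forall x, F x = G x} ->
  sqnorm F = sqnorm G.
Proof.
move=> mF mG FG; rewrite !sqnormE//; apply: ge0_ae_eq_integral => //.
- exact: measurable_cabs2.
- exact: measurable_cabs2.
- by move=> x _; rewrite lee_fin sqr_ge0.
- by move=> x _; rewrite lee_fin sqr_ge0.
- by apply: filterS FG => x -> _.
Qed.

Lemma L2_ae F G : cmeas F -> L2 G -> {ae mu, forall x, F x = G x} -> L2 F.
Proof.
by move=> mF [mG lG] FG; split => //; rewrite (sqnorm_ae mF mG FG).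
Qed.

Lemma l2eq_ae F G : L2 F -> L2 G -> l2eq F G -> {ae mu, forall x, F x = G x}.
Proof.
move=> lF lG FG; have := sqnorm0_ae (L2_cmeas (L2B lF lG)) FG.
by apply: filterS => x /eqP; rewrite subr_eq0 => /eqP.
Qed.

Lemma ae_l2eq F G : L2 F -> L2 G -> {ae mu, forall x, F x = G x} -> l2eq F G.
Proof.
move=> lF lG FG; apply: ae_sqnorm0 (L2_cmeas (L2B lF lG)) _.
by apply: filterS FG => x ->; rewrite subrr.
Qed.

Lemma l2eq_sym F G : L2 F -> L2 G -> l2eq F G -> l2eq G F.
Proof.
move=> lF lG /(l2eq_ae lF lG) FG; apply: ae_l2eq => //.
by apply: filterS FG => x ->.
Qed.
Lemma l2eq_trans G F H : L2 F -> L2 G -> L2 H -> l2eq F G -> l2eq G H -> l2eq F H.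
Proof.
move=> lF lG lH /(l2eq_ae lF lG) FG /(l2eq_ae lG lH) GH; apply: ae_l2eq => //.
by apply: filterS2 FG GH => x -> ->.
Qed.

Lemma inner_l2eq F G H : L2 F -> L2 G -> L2 H -> l2eq F G -> inner F H = inner G H.
Proof.
move=> lF lG lH /(l2eq_ae lF lG) FG; apply: cint_ae; try exact: L2_innerL.
by apply: filterS FG => x ->.
Qed.

Lemma nsq0_l2eq F G : L2 F -> L2 G -> nsq (fun x => F x - G x) = 0 -> l2eq F G.
Proof. by move=> lF lG h; rewrite /l2eq sqnormK ?h//; exact: L2B. Qed.

Lemma inner_self0_l2eq F G : L2 F -> L2 G ->
  inner (fun x => F x - G x) (fun x => F x - G x) = 0 -> l2eq F G.
Proof.
move=> lF lG; rewrite inner_self; last exact: L2B.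
by move=> /(congr1 (@complex.Re R))/= h; apply: nsq0_l2eq.
Qed.

End L2Equality.

(** * The Hardy space and the adjoint shifts *)

Section Hardy.
Variables (R : realType) (n : nat).
Implicit Types (F G H f g h : fnT R n) (k m : n.-tuple int).
Local Notation mu := (torus_measure R n).

Definition nonneg k : Prop := forall j, 0 <= tnth k j.

Lemma off_or_nonneg k : offZplus k \/ nonneg k.
Proof.
have [h|h] := pselect (offZplus k); first by left.
by right=> j; rewrite leNgt; apply/negP => kj; apply: h; exists j.
Qed.
Lemma offN_nonneg k : offZplus k -> ~ nonneg k.
Proof. by move=> [j kj] /(_ j); rewrite leNgt kj. Qed.

Lemma H2_L2 : @H2 R n `<=` @L2 R n. Proof. by move=> f []. Qed.

Lemma H2_lin : lin_subspace (@H2 R n).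
Proof.
have lc k := L2_chr R k.
split.
  split; first exact: L2_cst.
  move=> k _; rewrite fourierE /inner -[RHS](@cint0 R n); congr cint.
  by apply/funext => x; rewrite mul0r.
split=> [f g [lf f0] [lg g0]|c f [lf f0]]; split.
- exact: L2D.
- by move=> k ko; rewrite fourierE innerDl// -!fourierE f0// g0// addr0.
- exact: L2Z.
- by move=> k ko; rewrite fourierE innerZl// -fourierE f0// mulr0.
Qed.

Lemma H2_closed : l2closed (@H2 R n).
Proof.
move=> u F uH lF uF; split => // k ko.
have lu i : L2 (u i) by case: (uH i).
have nu := nrm_cvg0 lu lF uF; have lc := L2_chr R k.
rewrite fourierE; apply: cabs_eq0; apply/eqP; rewrite eq_le cabs_ge0 andbT.
have c2 : (nrm (fun x => u i x - F x) * nrm (chr R k)) @[i --> \oo] --> 0.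
  by have := cvgM nu (cvg_cst (nrm (chr R k))); rewrite mul0r; apply.
apply: (cvgr_to_ge c2); apply: nearW => i /=.
apply: le_trans (cabs_inner_le (L2B (lu i) lF) lc).
by rewrite innerBl// -[inner (u i) _]fourierE (uH i).2// sub0r cabsN.
Qed.

Lemma fourier_mul_chr f k m : fourier (fun x => chr R k x * f x) m =
  fourier f (kadd m (kopp k)).
Proof.
rewrite !fourierE; congr cint; apply/funext => x.
rewrite chr_kadd chr_kopp conjcM conjCK; ring.
Qed.

Lemma L2_mul_chr f k : L2 f -> L2 (fun x => chr R k x * f x).
Proof.
by apply: (@L2_mulb _ _ 1); [exact: cmeas_chr|move=> x; rewrite cabs_chr].
Qed.

Lemma H2_mul_chr f k : nonneg k -> H2 f -> H2 (fun x => chr R k x * f x).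
Proof.
move=> k0 [lf f0]; split; first exact: L2_mul_chr.
move=> m [j mj]; rewrite fourier_mul_chr; apply: f0; exists j.
by rewrite !tnth_mktuple; have := k0 j; lia.
Qed.

Lemma H2_chr k : nonneg k -> H2 (chr R k).
Proof.
move=> kn; split; first exact: L2_chr.
move=> m mo; rewrite fourierE inner_chr; case: eqP => // e.
by case: (offN_nonneg mo); rewrite -e.
Qed.

Lemma nonneg_k0 : nonneg (k0 n). Proof. by move=> j; rewrite tnth_mktuple. Qed.
Lemma nonneg_single j : nonneg (single j 1).
Proof. by move=> i; rewrite tnth_mktuple; case: ifP. Qed.

Lemma chr_k0E : chr R (k0 n) = fun=> 1.
Proof. by apply/funext => x; rewrite chr_k0. Qed.

Lemma H2_1 : H2 (fun _ : n.-tuple R => 1 : R[i]).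
Proof. by rewrite -chr_k0E; apply: H2_chr; exact: nonneg_k0. Qed.

Lemma zcoordE j : @zcoord R n j = chr R (single j 1).
Proof. by apply/funext => x; rewrite chr_single /zcoord mul1r. Qed.

(** Every analytic monomial is a product of coordinate functions; the induction is on its total
    degree. *)
Lemma nonneg_ind (P : n.-tuple int -> Prop) : P (k0 n) ->
  (forall k j, nonneg k -> P k -> P (kadd (single j 1) k)) ->
  forall k, nonneg k -> P k.
Proof.
move=> P0 PS k; move: {2}(\sum_(j < n) `|tnth k j|)%N (leqnn (\sum_(j < n) `|tnth k
  j|)%N) => s.
elim: s k => [|s IH] k ks kn.
  suff -> : k = k0 n by [].
  apply: eq_from_tnth => j; rewrite tnth_mktuple; apply/eqP; rewrite -absz_eq0 -leqn0.
  by apply: leq_trans ks; rewrite (bigD1 j)//= leq_addr.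
have [/existsP[j kj]|] := boolP [exists j, tnth k j != 0]; last first.
  rewrite negb_exists => /forallP h; suff -> : k = k0 n by [].
  by apply: eq_from_tnth => j; rewrite tnth_mktuple; have := h j; rewrite negbK => /eqP.
have kj0 : 0 < tnth k j by rewrite lt_def kj kn.
pose k' : n.-tuple int := kadd k (kopp (single j 1)).
have -> : k = kadd (single j 1) k'.
  by apply: eq_from_tnth => i; rewrite !tnth_mktuple; ring.
have k'n : nonneg k'.
  move=> i; rewrite !tnth_mktuple; case: eqP => [->|_]; first by lia.
  by rewrite subr0.
apply: PS => //; apply: IH => //.
rewrite -ltnS; apply: leq_trans ks.
rewrite (bigD1 j)//= [X in (_ < X)%N](bigD1 j)//= !tnth_mktuple eqxx.
rewrite (eq_bigr (fun i => `|tnth k i|%N)); last first.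
  by move=> i ij; rewrite !tnth_mktuple (negbTE ij) subr0.
by rewrite ltn_add2r; lia.
Qed.

(** The projection onto [H2] of [f] times the conjugate of [z_j] is a witness, so the choice in
    [Tzstar] meets its specification. *)
Lemma TzstarP (j : 'I_n) f : H2 f -> H2 (Tzstar j f) /\
  forall h, H2 h -> inner (fun x => zcoord j x * h x) f = inner h (Tzstar j f).
Proof.
move=> [lf _]; rewrite /Tzstar /pick_fn.
apply: (@ClassicalEpsilon.epsilon_spec _ _ [set g | H2 g /\
    forall h, H2 h -> inner (fun x => zcoord j x * h x) f = inner h g]).
pose d := single j 1.
have lzf : L2 (fun x => chr R (kopp d) x * f x) by exact: L2_mul_chr.
have [g Hg gh] := proj_exists H2_L2 H2_lin H2_closed lzf.
exists g; split => // h Hh; have lh := H2_L2 Hh; have lg := H2_L2 Hg.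
have := gh _ Hh; rewrite innerBl// => /eqP; rewrite subr_eq0 => /eqP e.
rewrite (inner_conj lg lh) -e -inner_conj//; congr cint; apply/funext => x.
by rewrite zcoordE -/d conjcM chr_kopp conjCK; ring.
Qed.

End Hardy.

(** * The summands of the annihilated subspace, and the Schur class *)

Section Subspaces.
Variables (R : realType) (n : nat).
Implicit Types (F G f g phi : fnT R n) (k : n.-tuple int).
Local Notation mu := (torus_measure R n).

Lemma L2_lin : lin_subspace (@L2 R n).
Proof. by split; [exact: L2_cst|split=> [f g|a f]; [exact: L2D|exact: L2Z]]. Qed.

Lemma H2_0_L2 : @H2_0 R n `<=` @L2 R n. Proof. by move=> f [/H2_L2]. Qed.

Lemma H2_0_lin : lin_subspace (@H2_0 R n).
Proof.
have lc := L2_chr R (k0 n); have [H0 [HD HZ]] := H2_lin R n.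
split.
  split => //; rewrite fourierE /inner -[RHS](@cint0 R n); congr cint.
  by apply/funext => x; rewrite mul0r.
split=> [f g [Hf f0] [Hg g1]|a f [Hf f0]]; split.
- exact: HD.
- by rewrite fourierE innerDl -?fourierE ?f0 ?g1 ?addr0//; exact: H2_L2.
- exact: HZ.
- by rewrite fourierE innerZl -?fourierE ?f0 ?mulr0//; exact: H2_L2.
Qed.

Lemma Mn_L2 : @Mn R n `<=` @L2 R n. Proof. by move=> f []. Qed.

Lemma inner_cconj F G : L2 F -> L2 G -> inner (cconj F) (cconj G) = (inner F G)^*.
Proof.
move=> lF lG; rewrite -inner_conj//; congr cint; apply/funext => x.
by rewrite /cconj -[(F x)^*%C]/((F x)^*) -[(G x)^*%C]/((G x)^*) conjCK mulrC.
Qed.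

Lemma conjset_L2 (S : set (fnT R n)) : S `<=` @L2 R n -> conjset S `<=` @L2 R n.
Proof. by move=> SL _ [f /SL lf ->]; exact: (L2_conj lf). Qed.

Lemma conjset_lin (S : set (fnT R n)) : lin_subspace S -> lin_subspace (conjset S).
Proof.
move=> [S0 [SD SZ]]; split.
  by exists (fun=> 0) => //; apply/funext => x; rewrite /cconj conjc0.
split=> [_ _ [f Sf ->] [g Sg ->]|a _ [f Sf ->]].
  by exists (fun x => f x + g x); [exact: SD|apply/funext => x;
    rewrite /cconj -[RHS]/((f x + g x)^*) conjcD].
exists (fun x => a^* * f x); first exact: SZ.
by apply/funext => x; rewrite /cconj -[RHS]/((a^* * f x)^*) conjcM conjCK.
Qed.

Lemma ssum_L2 (S T : set (fnT R n)) : S `<=` @L2 R n -> T `<=` @L2 R n ->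
  ssum S T `<=` @L2 R n.
Proof. by move=> SL TL _ [f /SL lf [g /TL lg ->]]; exact: L2D. Qed.

Lemma ssum_lin (S T : set (fnT R n)) : lin_subspace S -> lin_subspace T ->
  lin_subspace (ssum S T).
Proof.
move=> [S0 [SD SZ]] [T0 [TD TZ]]; split.
  by exists (fun=> 0) => //; exists (fun=> 0) => //; apply/funext => x; rewrite addr0.
split=> [_ _ [f1 S1 [g1 T1 ->]] [f2 S2 [g2 T2 ->]]|a _ [f1 S1 [g1 T1 ->]]].
  exists (fun x => f1 x + f2 x); first exact: SD.
  exists (fun x => g1 x + g2 x); first exact: TD.
  by apply/funext => x; ring.
exists (fun x => a * f1 x); first exact: SZ.
by exists (fun x => a * g1 x); [exact: TZ|apply/funext => x; ring].
Qed.

Lemma orth_lin (S A : set (fnT R n)) : S `<=` @L2 R n -> A `<=` @L2 R n ->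
  lin_subspace S -> lin_subspace (orth_in S A).
Proof.
move=> SL AL [S0 [SD SZ]]; split.
  split => // G /AL lG; rewrite /inner -[RHS](@cint0 R n); congr cint.
  by apply/funext => x; rewrite mul0r.
split=> [f g [Sf f0] [Sg g1]|a f [Sf f0]]; split.
- exact: SD.
- by move=> G AG; rewrite innerDl ?f0 ?g1 ?addr0//; [exact: SL|exact: SL|exact: AL].
- exact: SZ.
- by move=> G AG; rewrite innerZl ?f0 ?mulr0//; [exact: SL|exact: AL].
Qed.

Lemma zero_Mn : @Mn R n (fun=> 0).
Proof.
by apply: (orth_lin _ _ L2_lin).1 => //; apply: ssum_L2; [apply: conjset_L2|]; exact: H2_L2.
Qed.

(** Members of the Schur class are bounded by 1 only almost everywhere. Setting them to 0 on the
    exceptional null set gives the pointwise bound used by the multiplier lemmas and leaves the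
    Fourier coefficients unchanged. *)
Lemma Schur_bounded phi : Defs.Schur phi ->
  exists phi', [/\ cmeas phi', forall x, cabs (phi' x) <= 1,
    {ae mu, forall x, phi' x = phi x} & forall k, offZplus k -> fourier phi' k = 0].
Proof.
move=> [mp [p1 p0]].
pose A := [set x | 1 < cabs (phi x)].
have mA : measurable A.
  rewrite (_ : A = (fun x => cabs (phi x)) @^-1` `]1, +oo[); last first.
    by apply/seteqP; split => x; rewrite /A/= in_itv/= andbT.
  by rewrite -[X in measurable X]setTI; apply: (measurable_cabs mp).
have muA : mu A = 0%E.
  rewrite -p1 tintE.
  - have := integral_indic mu measurableT mA; rewrite setIT => <-.
    apply: eq_integral => x _; rewrite indicE; congr ((_ : bool)%:R%:E).
    by apply/idP/idP; rewrite inE.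
  - rewrite (_ : (fun _ => _) = fun x => (\1_A x)%:E).
      by apply/measurable_EFinP; exact: measurable_indic.
    apply/funext => x; rewrite indicE; congr ((_ : bool)%:R%:E).
    by apply/idP/idP; rewrite inE.
  - by move=> x; rewrite lee_fin.
pose phi' x := cind (~` A) x * phi x.
have mp' : cmeas phi' by apply: cmeasM => //; apply: cmeas_cind; exact: measurableC.
have b x : cabs (phi' x) <= 1.
  rewrite /phi' cabsM cabs_real indicE; have [xA|xA] := boolP (x \in ~` A).
    by rewrite normr1 mul1r leNgt; apply/negP; move: xA; rewrite inE.
  by rewrite normr0 mul0r.
have ae' : {ae mu, forall x, phi' x = phi x}.
  exists A; split => // x /= h; apply: contrapT => nA; apply: h.
  by rewrite /phi' /cind indicE mem_set// mul1r.
exists phi'; split => // k ko; rewrite -(p0 _ ko) !fourierE.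
have l' : Lone phi' by exact: Lone_bounded b.
have l : Lone phi.
  split => //; rewrite L1normE//.
  rewrite (@ge0_ae_eq_integral _ _ _ mu setT _ (fun x => (cabs (phi' x))%:E))//.
  - by rewrite -L1normE//; case: l'.
  - by apply/measurable_EFinP; exact: measurable_cabs.
  - by apply/measurable_EFinP; exact: measurable_cabs.
  - by move=> x _; rewrite lee_fin cabs_ge0.
  - by move=> x _; rewrite lee_fin cabs_ge0.
  - by apply: filterS ae' => x -> _.
apply: cint_ae; [exact: Lone_conj_chr|exact: Lone_conj_chr|].
by apply: filterS ae' => x ->.
Qed.

Lemma bounded_Schur phi : cmeas phi -> (forall x, cabs (phi x) <= 1) ->
  (forall k, offZplus k -> fourier phi k = 0) -> Defs.Schur phi.
Proof.
move=> mp p1 p0; split => //; split => //.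
rewrite (_ : (fun _ => _) = fun _ : n.-tuple R => 0%E) ?tint_cst//.
by apply/funext => x; rewrite ltNge p1.
Qed.

End Subspaces.

(** * Compressions to a quotient module *)

Section QuotientModule.
Variables (R : realType) (n : nat) (Q : set (fnT R n)).
Hypothesis hQ : quotient_module Q.
Implicit Types (F G H f g h q : fnT R n) (k m : n.-tuple int).
Local Notation mu := (torus_measure R n).
Local Notation P := (projQ Q).

Let QH : Q `<=` @H2 R n. Proof. by case: hQ. Qed.
Let linQ : lin_subspace Q. Proof. by case: hQ => _ []. Qed.
Let clQ : l2closed Q. Proof. by case: hQ => _ [_ []]. Qed.
Let QT j f : Q f -> Q (Tzstar j f). Proof. by case: hQ => _ [_ [_]]; apply. Qed.
Let QL : Q `<=` @L2 R n. Proof. by move=> f /QH/H2_L2. Qed.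

Lemma proj_in f : L2 f -> Q (P f).
Proof. by move=> lf; have [] := projQP QL linQ clQ lf. Qed.
Lemma proj_inner f q : L2 f -> Q q -> inner (P f) q = inner f q.
Proof.
move=> lf Qq; have [Qf /(_ _ Qq)] := projQP QL linQ clQ lf.
by rewrite innerBl; [move=> /eqP; rewrite subr_eq0 => /eqP| |exact: QL|exact: QL].
Qed.

Lemma proj_unique f g : L2 f -> Q g -> (forall q, Q q -> inner f q = inner g q) ->
  l2eq (P f) g.
Proof.
move=> lf Qg fg; have Qf := proj_in lf; apply: inner_self0_l2eq; [exact: QL..|].
have Qd := subspaceB linQ Qf Qg.
by rewrite innerBl ?proj_inner ?fg ?subrr//; exact: QL.
Qed.

(** Moving one factor [z_j] across the inner product turns it into the adjoint shift acting on [q],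
    which stays in [Q]. *)
Lemma orth_mul_chr f k : nonneg k -> H2 f -> (forall q, Q q -> inner f q = 0) ->
  forall q, Q q -> inner (fun x => chr R k x * f x) q = 0.
Proof.
move=> kn Hf f0; move: k kn; apply: nonneg_ind.
  by move=> q Qq; rewrite chr_k0E -(f0 _ Qq); congr inner; apply/funext => x; rewrite mul1r.
move=> k j kn IH q Qq; have [_ Tz] := TzstarP j (QH Qq).
rewrite -(IH _ (QT j Qq)) -Tz; last exact: H2_mul_chr.
congr inner; apply/funext => x; rewrite zcoordE chr_kadd; ring.
Qed.

Section Multiplier.
Variable phi : fnT R n.
Hypotheses (mphi : cmeas phi) (phi1 : forall x, cabs (phi x) <= 1)
  (phi0 : forall k, offZplus k -> fourier phi k = 0).

Lemma orth_mul f : H2 f -> (forall q, Q q -> inner f q = 0) ->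
  forall q, Q q -> inner (fun x => phi x * f x) q = 0.
Proof.
move=> Hf f0 q Qq; apply: inner_mul_spectral0 => //; [exact: H2_L2|exact: QL|].
move=> k; have [ko|kn _] := off_or_nonneg k; first by rewrite phi0.
exact: orth_mul_chr.
Qed.

Let lmul f : L2 f -> L2 (fun x => phi x * f x). Proof. exact: (@L2_mulb _ _ 1). Qed.

(** [P f - f] lies in [H2] and is orthogonal to [Q], and multiplication by [phi] preserves this. It
    is the identity [S_phi P = P T_phi] on [H2]. *)
Lemma proj_mul_proj f : H2 f ->
  l2eq (P (fun x => phi x * P f x)) (P (fun x => phi x * f x)).
Proof.
move=> Hf; have lf := H2_L2 Hf; have Qf := proj_in lf; have lPf := QL Qf.
apply: proj_unique; [exact: lmul|by apply: proj_in; exact: lmul|].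
move=> q Qq; rewrite proj_inner//; last exact: lmul.
apply/eqP; rewrite -subr_eq0 -innerBl; [|exact: lmul|exact: lmul|exact: QL].
rewrite (_ : (fun _ => _) = fun x => phi x * (P f x - f x)); last first.
  by apply/funext => x; rewrite mulrBr.
apply/eqP; apply: orth_mul => //.
  by apply: (subspaceB (@H2_lin R n)) => //; exact: QH.
by move=> q' Qq'; rewrite innerBl ?proj_inner ?subrr//; exact: QL.
Qed.

Lemma contraction_Sop : contraction_on Q (Sop Q phi).
Proof.
split=> [f Qf|]; first by apply: proj_in; apply: lmul; exact: QL.
split=> [a f g Qf Qg|f Qf].
  have lf := QL Qf; have lg := QL Qg.
  have Q1 := proj_in (lmul lf); have Q2 := proj_in (lmul lg).
  have [_ [QD QZ]] := linQ.
  apply: proj_unique.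
  - by apply: lmul; apply: L2D => //; exact: L2Z.
  - by apply: QD => //; exact: QZ.
  move=> q Qq; have lq := QL Qq.
  rewrite innerDl//; [|by apply: L2Z; exact: QL|exact: QL].
  rewrite innerZl//; last exact: QL.
  rewrite !proj_inner//; [|exact: lmul|exact: lmul].
  rewrite -innerZl//; last exact: lmul.
  rewrite -innerDl//; [|by apply: L2Z; exact: lmul|exact: lmul].
  by congr inner; apply/funext => x; ring.
have lf := QL Qf; have lp := lmul lf; have Qp := proj_in lp; have lQ := QL Qp.
apply: (@le_trans _ _ (sqnorm (fun x => phi x * f x)%R)); last first.
  apply: sqnorm_le; [exact: L2_cmeas|exact: L2_cmeas|].
  by move=> x; rewrite cabsM ler_piMl ?cabs_ge0.
rewrite !sqnormK// lee_fin.
have := nsq_ge0 (L2B lp lQ); rewrite nsqB//.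
have -> : inner (fun x => phi x * f x) (P (fun x => phi x * f x)) =
  (nsq (P (fun x => phi x * f x)))%:C.
  by rewrite -proj_inner// inner_self.
by rewrite /= /Sop; lra.
Qed.

End Multiplier.

Lemma contraction_dist (X : fnT R n -> fnT R n) f g : contraction_on Q X -> Q f -> Q g ->
  nrm (fun x => X f x - X g x) <= nrm (fun x => f x - g x).
Proof.
move=> [XQ [Xlin Xle]] Qf Qg.
have Qd := subspaceB linQ Qf Qg.
have e : (fun x => -1 * g x + f x) = (fun x => f x - g x).
  by apply/funext => x; ring.
have := Xlin (-1) _ _ Qg Qf; rewrite e => h.
have lXd := QL (XQ _ Qd); have lXf := QL (XQ _ Qf); have lXg := QL (XQ _ Qg).
have lC := L2B lXf lXg.
have e2 : (fun x => -1 * X g x + X f x) = (fun x => X f x - X g x).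
  by apply/funext => x; ring.
rewrite e2 in h.
have -> : nrm (fun x => X f x - X g x) = nrm (X (fun x => f x - g x)).
  rewrite /nrm /nsq (@sqnorm_ae R n _ (X (fun x => f x - g x)))//;
    [exact: L2_cmeas|exact: L2_cmeas|].
  by apply: filterS (l2eq_ae lXd lC h) => x ->.
rewrite -ler_sqr ?nnegrE ?nrm_ge0// !sqr_nrm//; last exact: QL.
by rewrite -lee_fin -!sqnormK//; [exact: Xle|exact: QL].
Qed.

Lemma nrm0_l2eq f g : L2 f -> L2 g -> nrm (fun x => f x - g x) <= 0 -> l2eq f g.
Proof.
move=> lf lg h; apply: nsq0_l2eq => //; rewrite -sqr_nrm; last exact: L2B.
have /eqP -> : nrm (fun x => f x - g x) == 0 by rewrite eq_le h nrm_ge0.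
by rewrite expr0n.
Qed.

Lemma l2eq_nrm f g : l2eq f g -> nrm (fun x => f x - g x) = 0.
Proof. by move=> h; rewrite /nrm /nsq h sqrtr0. Qed.

(** [X] acts on representatives, so its compatibility with equality almost everywhere is a
    consequence of linearity up to null sets and the norm bound. *)
Lemma contraction_l2eq (X : fnT R n -> fnT R n) f g : contraction_on Q X -> Q f -> Q g ->
  l2eq f g -> l2eq (X f) (X g).
Proof.
move=> cX Qf Qg fg; have [XQ _] := cX.
apply: nrm0_l2eq; [exact/QL/XQ|exact/QL/XQ|].
by rewrite -(l2eq_nrm fg) contraction_dist.
Qed.

(** The functions on which [X] and [Y] agree form a closed subspace [D] of [Q]. The residual of [f]
    off [D] is orthogonal to the projected analytic characters, hence, lying in [Q], to those
    characters themselves; its other coefficients vanish because it is in [H2]. *)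
Lemma contraction_eq_on_characters (X Y : fnT R n -> fnT R n) :
  contraction_on Q X -> contraction_on Q Y ->
  (forall k, nonneg k -> l2eq (X (P (chr R k))) (Y (P (chr R k)))) ->
  forall f, Q f -> l2eq (X f) (Y f).
Proof.
move=> cX cY XY f Qf.
have [XQ [Xlin _]] := cX; have [YQ [Ylin _]] := cY.
have [Q0 [QD QZ]] := linQ.
pose D := [set f | Q f /\ l2eq (X f) (Y f)].
have lX g : Q g -> L2 (X g) by move=> /XQ/QL.
have lY g : Q g -> L2 (Y g) by move=> /YQ/QL.
have comb (a : R[i]) g h : D g -> D h -> D (fun x => a * g x + h x).
  move=> [Qg g1] [Qh h1]; have Qc : Q (fun x => a * g x + h x) by apply: QD => //;
    exact: QZ.
  split => //.
  have lXc : L2 (fun x => a * X g x + X h x) by apply: L2D; [apply: L2Z|]; exact: lX.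
  have lYc : L2 (fun x => a * Y g x + Y h x) by apply: L2D; [apply: L2Z|]; exact: lY.
  apply: (l2eq_trans (lX _ Qc) lXc (lY _ Qc) (Xlin a _ _ Qg Qh)).
  apply: (l2eq_trans lXc lYc (lY _ Qc)); last first.
    by apply: l2eq_sym; [exact: lY|exact: lYc|exact: Ylin].
  apply: ae_l2eq => //.
  apply: filterS2 (l2eq_ae (lX _ Qg) (lY _ Qg) g1) (l2eq_ae (lX _ Qh) (lY _ Qh) h1).
  by move=> x -> ->.
have D0 : D (fun=> 0).
  split => //; have z T : contraction_on Q T -> l2eq (T (fun=> 0)) (fun=> 0).
    move=> [TQ [_ Tle]]; have lT := QL (TQ _ Q0).
    have s0 : sqnorm (fun _ : n.-tuple R => 0 : R[i]) = 0%E.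
      by rewrite /sqnorm tint_cst cabs0 expr0n.
    have := Tle _ Q0; rewrite s0 => h.
    have e : sqnorm (T (fun=> 0)) = 0%E.
      by apply/eqP; rewrite eq_le h sqnorm_ge0//; exact: L2_cmeas.
    by rewrite /l2eq; under [X in sqnorm X]eq_fun do rewrite subr0.
  apply: (l2eq_trans (lX _ Q0) (L2_cst n 0) (lY _ Q0) (z _ cX)).
  by apply: l2eq_sym; [exact: lY|exact: L2_cst|exact: z].
have linD : lin_subspace D.
  split => //; split=> [g h Dg Dh|a g Dg].
    have := comb 1 _ _ Dg Dh; congr D; apply/funext => x; by rewrite mul1r.
  have := comb a _ _ Dg D0; congr D; apply/funext => x; by rewrite addr0.
have clD : l2closed D.
  move=> u F uD lF uF; have Qu i : Q (u i) by case: (uD i).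
  have QF : Q F by exact: clQ uF.
  split => //; have lu i := QL (Qu i).
  have nu := nrm_cvg0 lu lF uF.
  apply: nrm0_l2eq; [exact: lX|exact: lY|].
  have c2 : (2 * nrm (fun x => u i x - F x)) @[i --> \oo] --> 0.
    by have := cvgM (cvg_cst (2 : R)) nu; rewrite mulr0; apply.
  apply: (cvgr_to_ge c2); apply: nearW => i /=.
  have h1 := contraction_dist cX (Qu i) QF; have h2 := contraction_dist cY (Qu i) QF.
  have h3 := l2eq_nrm (uD i).2.
  have lXu := lX _ (Qu i); have lYu := lY _ (Qu i); have lXF := lX _ QF;
    have lYF := lY _ QF.
  (* [X F - Y F] is split through [X (u i)] and [Y (u i)]; the middle term is null and contractivity
     bounds the outer two. *)
  have t1 := nrmD (L2B (L2Z (-1) lXu) (L2Z (-1) lXF)) (L2D (L2B lXu lYu) (L2B lYu lYF)).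
  have t2 := nrmD (L2B lXu lYu) (L2B lYu lYF).
  have e1 : nrm (fun x => -1 * X (u i) x - -1 * X F x) = nrm (fun x => X (u i) x - X F x).
    rewrite /nrm (_ : (fun _ => _) = fun x => -1 * (X (u i) x - X F x)); last first.
      by apply/funext => x; ring.
    by rewrite nsqZ ?cabsN ?cabs1 ?expr1n ?mul1r//; exact: L2B.
  have e2 : (fun x => -1 * X (u i) x - -1 * X F x + (X (u i) x - Y (u i) x + (Y (u i) x
    - Y F x))) =
     (fun x => X F x - Y F x) by apply/funext => x; ring.
  rewrite e2 e1 in t1; lra.
have DL : D `<=` @L2 R n by move=> g [/QL].
have lf := QL Qf.
have [g Dg gh] := proj_exists DL linD clD lf.
have [Qg _] := Dg; have lg := QL Qg.
have Qr := subspaceB linQ Qf Qg; have lr := QL Qr.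
suff Df : D f by case: Df.
apply: (l2closed_l2eq clD Dg lf); apply: l2eq_sym => //; apply: ae_l2eq => //.
have rc k : inner (fun x => f x - g x) (chr R k) = 0.
  have [ko|kn] := off_or_nonneg k.
    by rewrite -fourierE; have [_ ->] := QH Qr.
  have lc := L2_chr R k; have Qc := proj_in lc.
  have Dc : D (P (chr R k)) by split => //; exact: XY.
  by rewrite inner_conj// -proj_inner// -inner_conj ?gh//; exact: QL.
have : {ae mu, forall x, f x - g x = 0}.
  apply: fourier_unique; first exact: L2_Lone.
  move=> k; rewrite -[RHS](rc (kopp k)); congr cint; apply/funext => x.
  by rewrite chr_kopp conjCK.
by apply: filterS => x /eqP; rewrite subr_eq0 => /eqP.
Qed.

End QuotientModule.

(** * Symbols of module maps and the distance criterion *)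

Section Lifting.
Variables (R : realType) (n : nat) (Q : set (fnT R n)) (X : fnT R n -> fnT R n).
Hypotheses (hQ : quotient_module Q) (cX : contraction_on Q X) (mX : module_map Q X).
Implicit Types (F G H f g h q phi : fnT R n) (k m : n.-tuple int).
Local Notation mu := (torus_measure R n).
Local Notation P := (projQ Q).
Local Notation psi := (psiQX Q X).

Let QH : Q `<=` @H2 R n. Proof. by case: hQ. Qed.
Let linQ : lin_subspace Q. Proof. by case: hQ => _ []. Qed.
Let QL : Q `<=` @L2 R n. Proof. by move=> f /QH/H2_L2. Qed.

Lemma psi_in : Q psi.
Proof. by case: cX => XQ _; apply: XQ; apply: (proj_in hQ); exact: L2_cst. Qed.

(* [X] is determined by [psi], because the [P_Q z^k] span a dense subspace of [Q]. *)
Lemma symbol_lifts phi : cmeas phi -> (forall x, cabs (phi x) <= 1) ->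
  (forall k, offZplus k -> fourier phi k = 0) ->
  (forall q, Q q -> inner phi q = inner psi q) ->
  forall f, Q f -> l2eq (X f) (Sop Q phi f).
Proof.
move=> mp p1 p0 pq; have [XQ _] := cX.
have lp : L2 phi by exact: L2_bounded p1.
have lm f : L2 f -> L2 (fun x => phi x * f x) by exact: (@L2_mulb _ _ 1).
have cY := contraction_Sop hQ mp p1.
apply: (contraction_eq_on_characters hQ cX cY) => k kn.
have Qc m := proj_in hQ (L2_chr R m).
have lX m := QL (XQ _ (Qc m)).
have QY m := proj_in hQ (lm _ (L2_chr R m)).
have lS m := QL (proj_in hQ (lm _ (QL (Qc m)))).
suff main : l2eq (X (P (chr R k))) (P (fun x => phi x * chr R k x)).
  apply: (l2eq_trans (lX k) (QL (QY k)) (lS k) main).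
  apply: l2eq_sym; [exact: lS|exact: QL|].
  by apply: (proj_mul_proj hQ) => //; exact: H2_chr.
move: k kn; apply: nonneg_ind.
  rewrite chr_k0E; have Qp := proj_in hQ (lm _ (L2_cst n 1)).
  apply: l2eq_sym; [exact: QL|exact: QL psi_in|].
  apply: (proj_unique hQ) psi_in _; first exact: lm (L2_cst n 1).
  move=> q Qq; rewrite -pq//; congr inner; apply/funext => x; by rewrite mulr1.
move=> k j kn IH.
have z1 (x : n.-tuple R) : cabs (zcoord j x) <= 1 by rewrite zcoordE cabs_chr.
have mz : cmeas (@zcoord R n j) by rewrite zcoordE; exact: cmeas_chr.
have z0 m : offZplus m -> fourier (@zcoord R n j) m = 0.
  by rewrite zcoordE; have [_] := H2_chr R (@nonneg_single n j); apply.
have lz f : L2 f -> L2 (fun x => zcoord j x * f x) by exact: (@L2_mulb _ _ 1).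
have Qz f : L2 f -> Q (P (fun x => zcoord j x * f x)).
  by move=> lf; apply: (proj_in hQ); exact: lz.
have lc := L2_chr R k; have lPc := QL (Qc k).
have Hp : H2 (fun x => phi x * chr R k x).
  have := H2_mul_chr kn (conj lp p0 : H2 phi); congr H2; apply/funext => x; exact: mulrC.
(* The induction step is the chain [X P(z_j z^k) = X S_{z_j} P z^k = S_{z_j} X P z^k = S_{z_j} P(phi
   z^k) = P(phi z_j z^k)], whose middle equalities are the module property and the induction
   hypothesis. *)
have s1 : l2eq (P (chr R (kadd (single j 1) k))) (Sop Q (zcoord j) (P (chr R k))).
  apply: l2eq_sym; [exact: QL (Qz _ lPc)|exact: QL|].
  rewrite (_ : chr R (kadd (single j 1) k) = fun x => zcoord j x * chr R k x).
    by apply: (proj_mul_proj hQ) => //; exact: H2_chr.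
  by apply/funext => x; rewrite zcoordE chr_kadd.
have s2 := contraction_l2eq hQ cX (Qc _) (Qz _ lPc) s1.
have s3 := mX j (Qc k).
have s4 : l2eq (Sop Q (zcoord j) (X (P (chr R k)))) (Sop Q (zcoord j) (P (fun x => phi
  x * chr R k x))).
  exact: (contraction_l2eq hQ (contraction_Sop hQ mz z1) (XQ _ (Qc k)) (QY k) IH).
have s5 : l2eq (Sop Q (zcoord j) (P (fun x => phi x * chr R k x)))
               (P (fun x => phi x * chr R (kadd (single j 1) k) x)).
  rewrite (_ : (fun x => phi x * chr R (kadd (single j 1) k) x) =
     fun x => zcoord j x * (phi x * chr R k x)).
    exact: (proj_mul_proj hQ).
  by apply/funext => x; rewrite zcoordE chr_kadd; ring.
have a1 := QL (XQ _ (Qc (kadd (single j 1) k))).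
have a2 := QL (XQ _ (Qz _ lPc)).
have a3 := QL (Qz _ (lX k)).
have a4 := QL (Qz _ (QL (QY k))).
have a5 := QL (QY (kadd (single j 1) k)).
apply: (l2eq_trans a1 a2 a5 s2); apply: (l2eq_trans a2 a3 a5 s3).
exact: (l2eq_trans a3 a4 a5 s4).
Qed.

(** Evaluating the lift at [P 1] gives [psi = P (phi P 1)]; this is [P phi], because [1 - P 1] is
    orthogonal to [Q] and remains so after multiplication by the symbol. *)
Lemma liftable_symbol phi : Defs.Schur phi -> (forall f, Q f -> l2eq (X f) (Sop Q phi f)) ->
  exists phi', [/\ cmeas phi', forall x, cabs (phi' x) <= 1,
    forall k, offZplus k -> fourier phi' k = 0 &
    forall q, Q q -> inner phi' q = inner psi q].
Proof.
move=> Sp lift; have [phi' [m' b' ae' f']] := Schur_bounded Sp.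
exists phi'; split => // q Qq; have lq := QL Qq.
have l1 : L2 (fun _ : n.-tuple R => 1 : R[i]) := L2_cst n 1.
have Qe := proj_in hQ l1; have le := QL Qe.
set e := P (fun=> 1) in Qe le.
have l'e : L2 (fun x => phi' x * e x) by exact: (@L2_mulb _ _ 1).
have lpe : L2 (fun x => phi x * e x).
  apply: (L2_ae _ l'e); first by apply: cmeasM; [case: Sp|exact: L2_cmeas].
  by apply: filterS ae' => x ->.
have Qpe := proj_in hQ lpe.
rewrite (inner_l2eq (QL psi_in) (QL Qpe) lq (lift _ Qe)) (proj_inner hQ)//.
have -> : inner (fun x => phi x * e x) q = inner (fun x => phi' x * e x) q.
  apply: inner_l2eq => //; apply: ae_l2eq => //.
  by apply: filterS ae' => x ->.
apply/eqP; rewrite -subr_eq0 -innerBl//; last exact: L2_bounded b'.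
rewrite (_ : (fun _ => _) = fun x => phi' x * (1 - e x)); last first.
  by apply/funext => x; rewrite mulrBr mulr1.
apply/eqP; apply: (orth_mul hQ) => //.
  by apply: (subspaceB (@H2_lin R n)); [exact: H2_1|exact: QH].
by move=> q' Qq'; rewrite innerBl ?(proj_inner hQ) ?subrr//; exact: QL.
Qed.

Hypothesis psi0 : sqnorm psi <> 0%E.

Let lpsi : L2 psi. Proof. exact: QL psi_in. Qed.
Let npsi : nsq psi != 0.
Proof. by apply/eqP => h; apply: psi0; rewrite sqnormK// h. Qed.

Let g0 := normalized_conj psi.
Let g0E x : g0 x = (nsq psi)^-1%:C * (psi x)^*.
Proof. by rewrite /g0 /normalized_conj mulrC fmorphV. Qed.
Let lg0 : L2 g0.
Proof.
have := L2Z (nsq psi)^-1%:C (L2_conj lpsi); congr L2; apply/funext => x.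
by rewrite g0E.
Qed.

Lemma cint_mul_g0 phi : L2 phi ->
  cint (fun x => phi x * g0 x) = (nsq psi)^-1%:C * inner phi psi.
Proof.
move=> lp; rewrite -cintZ; last exact: L2_innerL.
by congr cint; apply/funext => x; rewrite g0E mulrCA.
Qed.

Lemma orth_L2 : orth_in (conjset Q) [set cconj psi] `<=` @L2 R n.
Proof. by move=> _ [[q /QL lq ->] _]; exact: (L2_conj lq). Qed.

Lemma Mtilde_L2 : Mtilde Q X `<=` @L2 R n.
Proof.
by apply: ssum_L2 (@H2_0_L2 R n); apply: ssum_L2; [exact: orth_L2|exact: Mn_L2].
Qed.

Lemma Mtilde_lin : lin_subspace (Mtilde Q X).
Proof.
apply: ssum_lin (H2_0_lin R n); apply: ssum_lin; apply: orth_lin.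
- exact: conjset_L2.
- by move=> _ ->; exact: (L2_conj lpsi).
- exact: conjset_lin.
- by [].
- apply: ssum_L2; [apply: conjset_L2|]; exact: H2_L2.
- exact: L2_lin.
Qed.

Lemma zero_orth : orth_in (conjset Q) [set cconj psi] (fun=> 0).
Proof.
apply: (orth_lin _ _ (conjset_lin linQ)).1; first exact: conjset_L2.
by move=> _ ->; exact: (L2_conj lpsi).
Qed.
Lemma zero_H2_0 : @H2_0 R n (fun=> 0). Proof. exact: (H2_0_lin R n).1. Qed.

Lemma H2_0_Mtilde f : H2_0 f -> Mtilde Q X f.
Proof.
move=> Hf; exists (fun x => 0 + 0).
  by exists (fun=> 0); [exact: zero_orth|exists (fun=> 0); [exact: zero_Mn|]].
by exists f => //; apply/funext => x; rewrite !add0r.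
Qed.
Lemma Mn_Mtilde f : Mn f -> Mtilde Q X f.
Proof.
move=> Mf; exists (fun x => 0 + f x).
  by exists (fun=> 0); [exact: zero_orth|exists f].
by exists (fun=> 0); [exact: zero_H2_0|apply/funext => x; rewrite add0r addr0].
Qed.
Lemma orth_Mtilde f : orth_in (conjset Q) [set cconj psi] f -> Mtilde Q X f.
Proof.
move=> Of; exists (fun x => f x + 0).
  by exists f => //; exists (fun=> 0); [exact: zero_Mn|].
by exists (fun=> 0); [exact: zero_H2_0|apply/funext => x; rewrite !addr0].
Qed.

Lemma liftable_dist : liftable Q X -> (1%:E <= distL1 g0 (Mtilde Q X))%E.
Proof.
move=> [phi0 Sp lift]; have [phi [mp p1 p0 pq]] := liftable_symbol Sp lift.
have lp : L2 phi by exact: L2_bounded p1.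
have Hp : H2 phi by split.
apply: le_ereal_inf_tmp => _ [h Mh <-]; have lh := Mtilde_L2 Mh.
have ld := L2B lg0 lh.
have main : cint (fun x => phi x * (g0 x - h x)) = 1.
  rewrite (_ : (fun _ => _) = fun x => phi x * g0 x - phi x * h x); last first.
    by apply/funext => x; rewrite mulrBr.
  rewrite cintB; [|exact: L2M|exact: L2M].
  rewrite cint_mul_g0// pq ?inner_self//; last exact: psi_in.
  rewrite -rmorphM/= mulVf// rmorph1.
  have [_ [A OA [B MB ->]] [C HC ->]] := Mh.
  have lA := orth_L2 OA; have lB := Mn_L2 MB; have lC := H2_0_L2 HC.
  rewrite (_ : (fun _ => _) = fun x => phi x * A x + phi x * B x + phi x * C x); last first.
    by apply/funext => x; ring.
  rewrite !cintD; [|exact: L2M|exact: L2M|by apply: LoneD; exact: L2M|exact: L2M].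
  (* [A] is the conjugate of some [q] in [Q] orthogonal to [psi], and pairing [phi] with [q] amounts
     to pairing [psi] with [q]. *)
  have -> : cint (fun x => phi x * A x) = 0.
    have [[q Qq Aq] /(_ _ erefl)] := OA; have lq := QL Qq.
    rewrite Aq inner_cconj// -inner_conj// => qp.
    by rewrite -[LHS]/(inner phi q) pq.
  (* The conjugate of [phi] belongs to the conjugate of [H2], to which [B] is orthogonal. *)
  have -> : cint (fun x => phi x * B x) = 0.
    have [_ hB] := MB.
    rewrite -(hB (fun x => cconj phi x + 0)).
      by congr cint; apply/funext => x;
        rewrite addr0 /cconj -[X in _ = _ * X]/((phi x)^*^*) conjCK mulrC.
    exists (cconj phi); first by exists phi.
    by exists (fun=> 0) => //; have [] := H2_lin R n.
  (* Only frequencies [k >= 0] of [phi] matter, and they pair with the coefficient of [C] at [-k]: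
     it vanishes since [C] is in [H2] when [k <> 0], and since [C] has mean 0 when [k = 0]. *)
  have -> : cint (fun x => phi x * C x) = 0.
    have := @inner_mul_spectral0 R n phi mp p1 C (fun=> 1) lC (L2_cst n 1).
    have e1 F : inner F (fun=> 1) = cint F.
      by congr cint; apply/funext => x; rewrite -[RHS]mulr1; congr (_ * _); exact: conjc1.
    rewrite e1; apply => k; have [ko|kn _] := off_or_nonneg k; first by rewrite p0.
    rewrite e1; have -> : cint (fun x => chr R k x * C x) = fourier C (kopp k).
      by rewrite fourierE; congr cint; apply/funext => x; rewrite chr_kopp conjCK mulrC.
    have [[_ C1] C2] := HC; have [ok|nk] := off_or_nonneg (kopp k); first exact: C1.
    rewrite (_ : kopp k = k0 n)//; apply: eq_from_tnth => j.
    by have := kn j; have := nk j; rewrite !tnth_mktuple; lia.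
  by rewrite !addr0 subr0.
have lpd := L2M lp ld.
have -> : 1%:E = (cabs (cint (fun x => phi x * (g0 x - h x))))%:E by rewrite main cabs1.
apply: le_trans (cabs_cint_le lpd) _; apply: L1norm_le.
- exact: lpd.1.
- exact: L2_cmeas.
- by move=> x; rewrite cabsM ler_piMl ?cabs_ge0.
Qed.

Lemma dist_liftable : (1%:E <= distL1 g0 (Mtilde Q X))%E -> liftable Q X.
Proof.
move=> dist.
have [phi [mp p1 pM pg]] : exists phi, [/\ cmeas phi, forall x, cabs (phi x) <= 1,
    forall h, Mtilde Q X h -> cint (fun x => phi x * h x) = 0 &
    cint (fun x => phi x * g0 x) = 1].
  apply: dual_element lg0 _; [exact: Mtilde_L2|exact: Mtilde_lin|].
  move=> h Mh; apply: (le_trans dist); apply: ereal_inf_lbound.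
  by exists h.
have lp : L2 phi by exact: L2_bounded p1.
have p0 k : offZplus k -> fourier phi k = 0.
  move=> ko; have -> : fourier phi k = cint (fun x => phi x * chr R (kopp k) x).
    by rewrite fourierE; congr cint; apply/funext => x; rewrite chr_kopp.
  (* If [-k] is nonnegative, then [k <> 0] and [z^(-k)] is in [H2_0]. Otherwise both [k] and [-k]
     are off the cone, so [z^(-k)] is orthogonal to [H2] and to its conjugate. *)
  apply: pM; have [mo|mn] := off_or_nonneg (kopp k); last first.
    apply: H2_0_Mtilde; split; first exact: H2_chr.
    rewrite fourierE inner_chr; case: eqP => // e; case: ko => j kj.
    have := congr1 (fun z => tnth z j) e; rewrite !tnth_mktuple; lia.
  apply: Mn_Mtilde; split; first exact: L2_chr.
  move=> _ [_ [F1 HF1 ->] [F2 HF2 ->]].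
  have l1 := H2_L2 HF1; have l2 := H2_L2 HF2; have lc := L2_chr R (kopp k).
  have lc1 : L2 (cconj F1) := L2_conj l1.
  rewrite innerDr//.
  have -> : inner (chr R (kopp k)) F2 = 0.
    by rewrite inner_conj// -fourierE HF2.2// rmorph0.
  rewrite addr0 -[RHS](HF1.2 _ ko) fourierE; congr cint; apply/funext => x.
  by rewrite /cconj -[X in _ * X]/((F1 x)^*^*) conjCK chr_kopp mulrC.
(* The value 1 at the normalized conjugate fixes the component of [phi] along [psi]. *)
have pp : inner phi psi = (nsq psi)%:C.
  have := pg; rewrite cint_mul_g0// => /(congr1 (fun z => (nsq psi)%:C * z)).
  by rewrite mulrA -rmorphM/= mulfV// rmorph1 mul1r mulr1.
have pq q : Q q -> inner phi q = inner psi q.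
  move=> Qq; have lq := QL Qq; have [_ [QD QZ]] := linQ.
  (* Coefficient of [q] along [psi]. The conjugate of [q - c psi] lies in [Mtilde] and is
     annihilated, so the pairing of [phi] with [q] is carried by [c psi], where [pp] gives it. *)
  pose c : R[i] := inner q psi * (nsq psi)^-1%:C.
  have Qd : Q (fun x => q x - c * psi x).
    by apply: (subspaceB linQ) => //; apply: QZ; exact: psi_in.
  have lcp := L2Z c lpsi.
  have d0 : inner (fun x => q x - c * psi x) psi = 0.
    rewrite innerBl// innerZl// inner_self// /c -mulrA -rmorphM/= mulVf//.
    by rewrite rmorph1 mulr1 subrr.
  have : inner phi (fun x => q x - c * psi x) = 0.
    apply: pM; apply: orth_Mtilde; split; first by exists (fun x => q x - c * psi x).
    move=> _ ->; have ld := QL Qd.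
    by have := inner_cconj ld lpsi; rewrite d0 rmorph0.
  rewrite innerBr// innerZr// pp => /eqP; rewrite subr_eq0 => /eqP ->.
  rewrite /c conjcM conjc_realE -mulrA -rmorphM/= mulVf// rmorph1 mulr1.
  by rewrite -inner_conj.
exists phi; first exact: bounded_Schur.
exact: symbol_lifts.
Qed.

End Lifting.

(** Dividing by the squared norm presupposes [psi <> 0] in [L^2]. For null [psi] the convention
    [x / 0 = 0] would give the function 0, at distance 0, although [X] would then be null on [Q] and
    lifted by the symbol 0. *)
Theorem theorem4p3 (R : realType) (n : nat) (Q : set (fnT R n))
  (X : fnT R n -> fnT R n) :
  (1 <= n)%N ->
  quotient_module Q ->
  contraction_on Q X ->
  module_map Q X ->
  sqnorm (psiQX Q X) <> 0%E ->
  (liftable Q X <->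
   (1%:E <= distL1 (normalized_conj (psiQX Q X)) (Mtilde Q X))%E).
Proof.
move=> _ hQ cX mX psi0; split.
  exact: liftable_dist.
exact: dist_liftable.
Qed.
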